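(* Let $\Gamma$ be a well-formed context, $\sigma,\tau$ expressions and $e[x]$ an expression with free variable $x$, such that $\Gamma;\,x{:}\sigma \models e[x] : \tau$, where $\Gamma$, $\sigma$, $\tau$ and $e[x]$ do not contain the constant $\mathbf{Bij}$, and $x$ does not occur free in $\tau$. Then for expressions $u,v$, $\Gamma \models u =_\sigma v$ implies $\Gamma \models e[u] =_\tau e[v]$ (where $e[u]$, $e[v]$ denote substitution of $u$, $v$ for $x$).
   Context: Fix a Grothendieck universe $V$. Basic values are defined by well-founded recursion: $\langle\text{''atom''},x\rangle$ with $x\in V$; $\langle\text{''Bool''},b\rangle$ with $b\in\{\mathbf{True},\mathbf{False}\}$; $\langle\text{''pair''},\langle x,y\rangle\rangle$ with $x,y$ basic; $\langle\text{''function''},f\rangle$ with $f\in V$ a function from basic values to basic values; $\langle\text{''set''},s\rangle$ with $s\in V$ a set of basic values. Extended values are defined the same way but built from extended values (functions need not lie in $V$), with the additional case of iso-pairs $\langle\text{''isopair''},\langle x,y\rangle\rangle$ where $x,y$ are basic values. (Membership in and application of tagged sets/functions refers to the underlying set/function.) The left projection $L$ is: identity on atoms and Booleans; $L(\text{pair }\langle u,w\rangle)=\text{pair }\langle L(u),L(w)\rangle$; $L(\text{set } s)=\text{set }\{L(x):x\in s\}$; $L(\text{function } f)$ is the function mapping $L(u)\mapsto L(f(u))$ for $u\in\mathrm{dom} f$; $L(\text{isopair}\langle u,w\rangle)=u$. The right projection $R$ is the same except $R(\text{isopair}\langle u,w\rangle)=w$. Bijective values: atoms, Booleans, iso-pairs;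 pairs of bijective values; functions from bijective values to bijective values whose domain is a bijective set; and tagged sets $\langle\text{''set''},s\rangle$, $s\in V$, of bijective values such that $\{\langle L(u),R(u)\rangle : u\in s\}$ is a bijection between $L(s)$ and $R(s)$ (bijective sets). Language: expressions are variables; constants $\mathbf{Set}$, $\mathbf{Bool}$ and (extended language only) $\mathbf{Bij}$; pairs $\langle u,v\rangle$; projections $\pi_1(u),\pi_2(u)$; $\lambda\,x{:}\sigma\;e$; applications $f(u)$; equalities $u=v$; $\forall x{:}\sigma\,\Phi$; Boolean connectives; $\prod_{x:\sigma}\tau$, $\sum_{x:\sigma}\tau$, and subtypes $S_{x:\sigma}\Phi$. An expression is set-level if $\mathbf{Set}$/$\mathbf{Bij}$ occur only inside Boolean subformulas; otherwise it is a class expression. A context is a sequence of declarations $x{:}\sigma$ and formulas $\Phi$. Semantics is given by partial functions $\mathcal V[\![\Gamma]\!]$ (a set/class of variable interpretations) and $\mathcal V_\Gamma[\![e]\!]\gamma$ for $\gamma\in\mathcal V[\![\Gamma]\!]$, defined as the least (inductively generated, via an iteration index) partial functions satisfying the clauses below; well-formedness means definedness. Notation: $e$ is defined under $\Gamma$ if $\mathcal V[\![\Gamma]\!]$ is defined and $\mathcal V_\Gamma[\![e]\!]\gamma$ is defined for all $\gamma\in\mathcal V[\![\Gamma]\!]$; $\Gamma\models\sigma:\mathbf{Type}$ (resp. $\mathbf{Class}$) means $\sigma$ is defined under $\Gamma$ and its values are sets or classes (resp. classes: the empty class, distinguished from the empty set, or proper classes, i.e. subsets of the value universe not in $V$); for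 set-level $u$, $\Gamma\models u:\sigma$ means $u$ defined, $\Gamma\models\sigma:\mathbf{Type}$ and $\mathcal V_\Gamma[\![u]\!]\gamma\in\mathcal V_\Gamma[\![\sigma]\!]\gamma$ for all $\gamma$; $\Gamma\models\Phi$ means $\Gamma\models\Phi:\mathbf{Bool}$ and $\Phi$ evaluates to $\mathbf{True}$ at every $\gamma$. Clauses: $\mathcal V[\![\epsilon]\!]=\{\text{empty interpretation}\}$; if $\Gamma\models\sigma:\mathbf{Type}$ and $x$ undeclared, $\mathcal V[\![\Gamma;x{:}\sigma]\!]=\{\gamma[x:=a]:\gamma\in\mathcal V[\![\Gamma]\!],a\in\mathcal V_\Gamma[\![\sigma]\!]\gamma\}$; if $\Gamma\models\Phi:\mathbf{Bool}$, $\mathcal V[\![\Gamma;\Phi]\!]=\{\gamma\in\mathcal V[\![\Gamma]\!]:\Phi \text{ true at }\gamma\}$. For $\gamma\in\mathcal V[\![\Gamma]\!]$: $\mathbf{Set}$ denotes the class of all basic tagged sets; $\mathbf{Bij}$ the class of all bijective sets; $\mathbf{Bool}$ the two truth values; a declared variable $x$ denotes $\gamma(x)$; if $\Gamma\models\sigma:\mathbf{Type}$ and $\Gamma;x{:}\sigma\models\tau:\mathbf{Type}$, $\sum_{x:\sigma}\tau$ denotes all pairs $\langle a,b\rangle$ with $a\in\mathcal V_\Gamma[\![\sigma]\!]\gamma$, $b\in\mathcal V_{\Gamma;x:\sigma}[\![\tau]\!]\gamma[x:=a]$; if $\Gamma\models\sigma:\mathbf{Type}$ and $\Gamma;x{:}\sigma\models\Phi:\mathbf{Bool}$,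 $S_{x:\sigma}\Phi$ denotes those $a\in\mathcal V_\Gamma[\![\sigma]\!]\gamma$ with $\Phi$ true at $\gamma[x:=a]$; if $\Gamma\models\sigma:\mathbf{S}$ and $\Gamma;x{:}\sigma\models\tau:\mathbf{S}$, $\prod_{x:\sigma}\tau$ denotes all functions $f$ with domain $\mathcal V_\Gamma[\![\sigma]\!]\gamma$ and $f(a)\in\mathcal V_{\Gamma;x:\sigma}[\![\tau]\!]\gamma[x:=a]$; Boolean connectives of Boolean formulas are classical; if $\Gamma\models f:\prod_{x:\sigma}\tau$ and $\Gamma\models u:\sigma$ for some $\sigma,\tau$, $f(u)$ denotes application; if $\Gamma\models u:\sigma$, $\Gamma\models v:\sigma$, $\Gamma\models\sigma:\mathbf{S}$ for some $\sigma$, $u=v$ is true iff the values are identical; if $\Gamma;x{:}\sigma\models\Phi:\mathbf{Bool}$, $\forall x{:}\sigma\,\Phi$ is true iff $\Phi$ holds for all values of $x$ in $\sigma$; if $u,v$ are set-level and defined, $\langle u,v\rangle$ denotes the pair; if $\Gamma\models u:\sum_{x:\sigma}\tau$, $\pi_i(u)$ is the $i$-th component; if $\Gamma\models\sigma:\mathbf{S}$ and $\Gamma;x{:}\sigma\models e:\tau$ for some $\tau$, $\lambda x{:}\sigma\,e$ denotes the function on $\mathcal V_\Gamma[\![\sigma]\!]\gamma$ with $a\mapsto\mathcal V_{\Gamma;x:\sigma}[\![e]\!]\gamma[x:=a]$. In the base language (no $\mathbf{Bij}$) $\mathbf S$ is $\mathbf{Set}$; in the extended language (allowing $\mathbf{Bij}$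 and extended values) $\mathbf S$ is $\mathbf{Bij}$. For an expression $\sigma$, $\sigma^*$ is the result of replacing every occurrence of $\mathbf{Set}$ by $\mathbf{Bij}$. Isomorphism: if in the base language $\Gamma\models\tau:\mathbf{Type}$, $\Gamma\models u:\tau$, $\Gamma\models v:\tau$, then for $\gamma\in\mathcal V[\![\Gamma]\!]$ the formula $u=_\tau v$ is true at $\gamma$ iff there exists $w\in\mathcal V_\Gamma[\![\tau^*]\!]\gamma$ (extended language) with $L(w)=\mathcal V_\Gamma[\![u]\!]\gamma$ and $R(w)=\mathcal V_\Gamma[\![v]\!]\gamma$; $\Gamma\models u=_\tau v$ means this holds for all $\gamma\in\mathcal V[\![\Gamma]\!]$. *)

(* Defs.v *)
From Stdlib Require Import List Lia ClassicalEpsilon.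
Import ListNotations.

(** * Ambient set theory *)

(** ZF with separation and replacement for arbitrary predicates and functions
    of the metatheory, and foundation as well-foundedness of membership. *)
Record ZF : Type := {
  carrier :> Type;
  mem : carrier -> carrier -> Prop;
  empty : carrier;
  upair : carrier -> carrier -> carrier;
  union : carrier -> carrier;
  power : carrier -> carrier;
  sep : (carrier -> Prop) -> carrier -> carrier;
  repl : (carrier -> carrier) -> carrier -> carrier;
  omega : carrier;
  ZF_ext : forall a b, (forall x, mem x a <-> mem x b) -> a = b;
  ZF_found : well_founded mem;
  ZF_empty : forall x, ~ mem x empty;
  ZF_upair : forall a b x, mem x (upair a b) <-> x = a \/ x = b;
  ZF_union : forall a x, mem x (union a) <-> exists y, mem y a /\ mem x y;
  ZF_power : forall a x, mem x (power a) <-> forall y, mem y x -> mem y a;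
  ZF_sep : forall P a x, mem x (sep P a) <-> mem x a /\ P x;
  ZF_repl : forall F a y, mem y (repl F a) <-> exists x, mem x a /\ y = F x;
  ZF_omega : mem empty omega /\
    forall x, mem x omega -> mem (union (upair x (upair x x))) omega
}.

Arguments mem {z}.
Arguments empty {z}.
Arguments upair {z}.
Arguments union {z}.
Arguments power {z}.
Arguments sep {z}.
Arguments repl {z}.

Declare Scope set_scope.
Notation "x ∈ a" := (mem x a) (at level 70) : set_scope.
Open Scope set_scope.

Definition grothendieck {U : ZF} (V : U) : Prop :=
  (exists x, x ∈ V) /\
  (forall x y, x ∈ y -> y ∈ V -> x ∈ V) /\
  (forall x y, x ∈ V -> y ∈ V -> upair x y ∈ V) /\
  (forall x, x ∈ V -> power x ∈ V) /\
  (forall I (F : U -> U),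
     I ∈ V -> (forall i, i ∈ I -> F i ∈ V) -> union (repl F I) ∈ V).

Section Sets.
Context {U : ZF}.

Definition opair (a b : U) : U := upair (upair a a) (upair a b).

Definition is_function (f : U) : Prop :=
  (forall p, p ∈ f -> exists a b, p = opair a b) /\
  (forall a b b', opair a b ∈ f -> opair a b' ∈ f -> b = b').

Definition is_domain (f A : U) : Prop :=
  forall a, a ∈ A <-> exists b, opair a b ∈ f.

Definition is_range (f B : U) : Prop :=
  forall b, b ∈ B <-> exists a, opair a b ∈ f.

Definition is_bijection (r A B : U) : Prop :=
  is_function r /\ is_domain r A /\ is_range r B /\
  (forall a a' b, opair a b ∈ r -> opair a' b ∈ r -> a = a').

(** Von Neumann numerals, used as tags and as the truth values. *)
Fixpoint numeral (n : nat) : U :=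
  match n with
  | O => empty
  | S n => union (upair (numeral n) (upair (numeral n) (numeral n)))
  end.

Lemma opair_inj (a b c d : U) : opair a b = opair c d -> a = c /\ b = d.
Proof.
intros H.
assert (E : forall x, x = upair a a \/ x = upair a b <->
                      x = upair c c \/ x = upair c d).
{ intros x. rewrite <- !ZF_upair. fold (opair a b) (opair c d). now rewrite H. }
assert (M : forall p q r s : U, upair p q = upair r s ->
              forall x, x = p \/ x = q <-> x = r \/ x = s).
{ intros p q r s K x. rewrite <- !ZF_upair. now rewrite K. }
assert (ac : a = c).
{ destruct (proj1 (E (upair a a)) (or_introl eq_refl)) as [K|K];
    [destruct (proj2 (M _ _ _ _ K c) (or_introl eq_refl))
    |destruct (proj2 (M _ _ _ _ K c) (or_introl eq_refl))]; congruence. }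
subst c. split; [reflexivity|].
destruct (proj1 (E (upair a b)) (or_intror eq_refl)) as [K|K].
- assert (b = a) by (destruct (proj1 (M _ _ _ _ K b) (or_intror eq_refl)); auto).
  subst b.
  destruct (proj2 (E (upair a d)) (or_intror eq_refl)) as [K'|K'];
    destruct (proj1 (M _ _ _ _ K' d) (or_intror eq_refl)); congruence.
- destruct (proj1 (M _ _ _ _ K b) (or_intror eq_refl)) as [->|?]; [|assumption].
  destruct (proj2 (M _ _ _ _ K d) (or_intror eq_refl)); congruence.
Qed.

Lemma numeral_lt m n : m < n -> numeral m ∈ numeral n.
Proof.
induction 1; simpl; apply ZF_union.
- exists (upair (numeral m) (numeral m)). rewrite !ZF_upair. auto.
- exists (numeral m0). rewrite ZF_upair. auto.
Qed.

Lemma mem_irrefl (x : U) : ~ x ∈ x.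
Proof.
induction (ZF_found U x) as [x _ IH]. intros H. exact (IH x H H).
Qed.

Lemma numeral_inj m n : numeral m = numeral n -> m = n.
Proof.
intros H. destruct (Compare_dec.lt_eq_lt_dec m n) as [[K|K]|K]; auto;
  apply numeral_lt in K; rewrite H in K; now apply mem_irrefl in K.
Qed.

End Sets.

(** * Values *)

Section Values.
Context {U : ZF}.

Definition vatom (x : U) : U := opair (numeral 0) x.
Definition vbool (b : bool) : U :=
  opair (numeral 1) (numeral (if b then 1 else 0)).
Definition vpair (x y : U) : U := opair (numeral 2) (opair x y).
Definition vfun (f : U) : U := opair (numeral 3) f.
Definition vset (s : U) : U := opair (numeral 4) s.
Definition visopair (x y : U) : U := opair (numeral 5) (opair x y).

Variable V : U.

Inductive basic : U -> Prop :=
| basic_atom x : x ∈ V -> basic (vatom x)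
| basic_bool b : basic (vbool b)
| basic_pair x y : basic x -> basic y -> basic (vpair x y)
| basic_fun f :
    f ∈ V -> is_function f ->
    (forall a b, opair a b ∈ f -> basic a) ->
    (forall a b, opair a b ∈ f -> basic b) ->
    basic (vfun f)
| basic_set s : s ∈ V -> (forall x, x ∈ s -> basic x) -> basic (vset s).

Inductive extended : U -> Prop :=
| extended_atom x : x ∈ V -> extended (vatom x)
| extended_bool b : extended (vbool b)
| extended_pair x y : extended x -> extended y -> extended (vpair x y)
| extended_fun f :
    is_function f ->
    (forall a b, opair a b ∈ f -> extended a) ->
    (forall a b, opair a b ∈ f -> extended b) ->
    extended (vfun f)
| extended_set s : s ∈ V -> (forall x, x ∈ s -> extended x) -> extended (vset s)
| extended_isopair x y : basic x -> basic y -> extended (visopair x y).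

Inductive side : Type := Left | Right.

(** [proj Left w a] is the graph [L(w) = a], [proj Right w a] the graph
    [R(w) = a]; they are functions defined exactly on the extended values (see
    [proj_extended], [proj_total] and [proj_functional]). For [vfun f] the result carries the
    relation [{(L(u), L(f(u)))}], which is single-valued as soon as [L] is
    injective on the domain of [f]; this is the case for bijective values. *)
Inductive proj (i : side) : U -> U -> Prop :=
| proj_atom x : x ∈ V -> proj i (vatom x) (vatom x)
| proj_bool b : proj i (vbool b) (vbool b)
| proj_pair x y x' y' :
    proj i x x' -> proj i y y' -> proj i (vpair x y) (vpair x' y')
| proj_fun f f' (g : U -> U) :
    is_function f ->
    (forall a b, opair a b ∈ f -> proj i a (g a)) ->
    (forall a b, opair a b ∈ f -> proj i b (g b)) ->
    (forall p, p ∈ f' <-> exists a b, opair a b ∈ f /\ p = opair (g a) (g b)) ->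
    proj i (vfun f) (vfun f')
| proj_set s (g : U -> U) :
    s ∈ V -> (forall x, x ∈ s -> proj i x (g x)) ->
    proj i (vset s) (vset (repl g s))
| proj_isopair x y :
    basic x -> basic y ->
    proj i (visopair x y) (match i with Left => x | Right => y end).

Lemma proj_extended i w a : proj i w a -> extended w.
Proof. induction 1; econstructor; eauto. Qed.

Lemma proj_total i w : extended w -> exists a, proj i w a.
Proof.
set (g := fun x => epsilon (inhabits (@empty U)) (proj i x)).
assert (gP : forall x, (exists a, proj i x a) -> proj i x (g x))
  by (intros x; apply epsilon_spec).
induction 1 as [x Hx|b|x y _ [x' IHx] _ [y' IHy]|f Hf _ IH1 _ IH2|s Hs _ IH|x y Hx Hy].
- eexists; now constructor.
- eexists; constructor.
- eexists; constructor; eassumption.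
- set (k := fun p => epsilon (inhabits (@empty U))
    (fun q => exists a b, p = opair a b /\ q = opair (g a) (g b))).
  assert (kP : forall a b, k (opair a b) = opair (g a) (g b)).
  { intros a b.
    destruct (epsilon_spec (inhabits (@empty U)) (fun q => exists a' b',
      opair a b = opair a' b' /\ q = opair (g a') (g b'))) as (a' & b' & E & K);
      [eauto|].
    apply opair_inj in E. destruct E; subst. exact K. }
  exists (vfun (repl k f)). apply proj_fun with g; eauto.
  intros p. rewrite ZF_repl. split.
  + intros (q & Hq & ->). destruct (proj1 Hf q Hq) as (a & b & ->). eauto.
  + intros (a & b & H & ->). exists (opair a b). now rewrite kP.
- exists (vset (repl g s)). apply proj_set; auto.
- eexists; now constructor.
Qed.

Lemma proj_functional i w a b : proj i w a -> proj i w b -> a = b.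
Proof.
intros H. revert b.
induction H as [x Hx|c|x y x' y' _ IHx _ IHy|f f' g Hf _ IH1 _ IH2 Hf'|s g Hs _ IH|x y Hx Hy];
  intros r K; inversion K as [z Hz E|d E|z t z' t' Hz Ht E|h h' k Hh K1 K2 Hh' E|u k Hu K1 E|z t Hz Ht E];
  subst r;
  unfold vatom, vbool, vpair, vfun, vset, visopair in E; apply opair_inj in E;
  destruct E as [E1 E2]; try (apply numeral_inj in E1; discriminate).
- congruence.
- apply numeral_inj in E2. destruct c, d; congruence.
- apply opair_inj in E2. destruct E2; subst. f_equal; auto.
- subst h. unfold vfun. f_equal. apply ZF_ext. intros p. rewrite Hf', Hh'.
  split; intros (a & b & H & ->); exists a, b; (split; [exact H|]).
  + f_equal; eauto.
  + f_equal; symmetry; eauto.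
- subst u. unfold vset. f_equal. apply ZF_ext. intros p. rewrite !ZF_repl.
  split; intros (x & H & ->); exists x; (split; [exact H|]); auto.
  symmetry; auto.
- apply opair_inj in E2. destruct E2; subst. reflexivity.
Qed.

Definition projections_biject (s : U) : Prop :=
  exists A B r,
    proj Left (vset s) (vset A) /\ proj Right (vset s) (vset B) /\
    (forall p, p ∈ r <->
       exists u a b, u ∈ s /\ proj Left u a /\ proj Right u b /\ p = opair a b) /\
    is_bijection r A B.

Inductive bijective : U -> Prop :=
| bijective_atom x : x ∈ V -> bijective (vatom x)
| bijective_bool b : bijective (vbool b)
| bijective_isopair x y : basic x -> basic y -> bijective (visopair x y)
| bijective_pair x y : bijective x -> bijective y -> bijective (vpair x y)
| bijective_fun f s :
    is_function f ->
    is_domain f s -> bijective (vset s) ->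
    (forall a b, opair a b ∈ f -> bijective a) ->
    (forall a b, opair a b ∈ f -> bijective b) ->
    bijective (vfun f)
| bijective_set s :
    s ∈ V -> (forall x, x ∈ s -> bijective x) -> projections_biject s ->
    bijective (vset s).

End Values.

(** * Syntax *)

Inductive connective : Type := And | Or | Imp | Iff.

Definition conn_fun (c : connective) : bool -> bool -> bool :=
  match c with
  | And => andb
  | Or => orb
  | Imp => implb
  | Iff => Bool.eqb
  end.

(** De Bruijn indices: the second argument of [Lam], [All], [Pi], [Sum] and
    [Sub] is in the scope of one more variable, with index 0. *)
Inductive expr : Type :=
| Var (n : nat)
| SetC
| BoolC
| BijC
| Pair (u v : expr)
| Pr1 (u : expr)
| Pr2 (u : expr)
| Lam (s e : expr)
| App (f u : expr)
| Eq (u v : expr)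
| All (s p : expr)
| Not (p : expr)
| Conn (c : connective) (p q : expr)
| Pi (s t : expr)
| Sum (s t : expr)
| Sub (s p : expr).

Fixpoint set_level (e : expr) : bool :=
  match e with
  | Var _ | BoolC => true
  | SetC | BijC => false
  | Pair u v | App u v | Lam u v | Pi u v | Sum u v => set_level u && set_level v
  | Pr1 u | Pr2 u => set_level u
  | Eq _ _ | All _ _ | Not _ | Conn _ _ _ => true
  | Sub s _ => set_level s
  end.

Fixpoint bij_free (e : expr) : bool :=
  match e with
  | Var _ | SetC | BoolC => true
  | BijC => false
  | Pr1 u | Pr2 u | Not u => bij_free u
  | Pair u v | Lam u v | App u v | Eq u v | All u v | Conn _ u v
  | Pi u v | Sum u v | Sub u v => bij_free u && bij_free v
  end.

Fixpoint star (e : expr) : expr :=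
  match e with
  | Var n => Var n
  | SetC => BijC
  | BoolC => BoolC
  | BijC => BijC
  | Pair u v => Pair (star u) (star v)
  | Pr1 u => Pr1 (star u)
  | Pr2 u => Pr2 (star u)
  | Lam s e => Lam (star s) (star e)
  | App f u => App (star f) (star u)
  | Eq u v => Eq (star u) (star v)
  | All s p => All (star s) (star p)
  | Not p => Not (star p)
  | Conn c p q => Conn c (star p) (star q)
  | Pi s t => Pi (star s) (star t)
  | Sum s t => Sum (star s) (star t)
  | Sub s p => Sub (star s) (star p)
  end.

Definition up_ren (r : nat -> nat) (n : nat) : nat :=
  match n with O => O | S n => S (r n) end.

Fixpoint rename (r : nat -> nat) (e : expr) : expr :=
  match e with
  | Var n => Var (r n)
  | SetC => SetC
  | BoolC => BoolC
  | BijC => BijC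
  | Pair u v => Pair (rename r u) (rename r v)
  | Pr1 u => Pr1 (rename r u)
  | Pr2 u => Pr2 (rename r u)
  | Lam s e => Lam (rename r s) (rename (up_ren r) e)
  | App f u => App (rename r f) (rename r u)
  | Eq u v => Eq (rename r u) (rename r v)
  | All s p => All (rename r s) (rename (up_ren r) p)
  | Not p => Not (rename r p)
  | Conn c p q => Conn c (rename r p) (rename r q)
  | Pi s t => Pi (rename r s) (rename (up_ren r) t)
  | Sum s t => Sum (rename r s) (rename (up_ren r) t)
  | Sub s p => Sub (rename r s) (rename (up_ren r) p)
  end.

(** [shift t] is [t] seen in the context extended by one variable; the
    expressions of this form are those in which that variable is not free. *)
Definition shift : expr -> expr := rename S.

Definition up (f : nat -> expr) (n : nat) : expr :=
  match n with O => Var O | S n => shift (f n) end.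

Fixpoint subst (f : nat -> expr) (e : expr) : expr :=
  match e with
  | Var n => f n
  | SetC => SetC
  | BoolC => BoolC
  | BijC => BijC
  | Pair u v => Pair (subst f u) (subst f v)
  | Pr1 u => Pr1 (subst f u)
  | Pr2 u => Pr2 (subst f u)
  | Lam s e => Lam (subst f s) (subst (up f) e)
  | App g u => App (subst f g) (subst f u)
  | Eq u v => Eq (subst f u) (subst f v)
  | All s p => All (subst f s) (subst (up f) p)
  | Not p => Not (subst f p)
  | Conn c p q => Conn c (subst f p) (subst f q)
  | Pi s t => Pi (subst f s) (subst (up f) t)
  | Sum s t => Sum (subst f s) (subst (up f) t)
  | Sub s p => Sub (subst f s) (subst (up f) p)
  end.

(** [inst e u] is [e[u]]: substitution for the variable with index 0. *)
Definition inst (e u : expr) : expr :=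
  subst (fun n => match n with O => u | S n => Var n end) e.

Inductive ctx : Type :=
| Nil
| Decl (G : ctx) (s : expr)
| Hyp (G : ctx) (p : expr).

Fixpoint ctx_bij_free (G : ctx) : bool :=
  match G with
  | Nil => true
  | Decl G s => ctx_bij_free G && bij_free s
  | Hyp G p => ctx_bij_free G && bij_free p
  end.

Inductive language : Type := Base | Ext.

Definition in_language (m : language) (e : expr) : Prop :=
  match m with Base => bij_free e = true | Ext => True end.

Definition sort_S (m : language) : expr :=
  match m with Base => SetC | Ext => BijC end.

(** * Semantics *)

Section Semantics.
Context {U : ZF}.
Variable V : U.

(** Set-level expressions denote values, class expressions denote classes; in
    particular [Cls (fun _ => False)] differs from [Val (vset empty)]. *)
Inductive den : Type :=
| Val (v : U)
| Cls (C : U -> Prop).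

Definition in_den (a : U) (d : den) : Prop :=
  match d with
  | Val v => exists s, v = vset s /\ a ∈ s
  | Cls C => C a
  end.

Definition set_or_class (d : den) : Prop :=
  match d with
  | Val v => exists s, s ∈ V /\ v = vset s
  | Cls _ => True
  end.

(** A variable interpretation lists the values of the variables, the most
    recently declared one (index 0) first. *)
Definition env : Type := list U.

(** A pair of partial functions given by their graphs: [ctx_val I G X] means
    that the interpretation of [G] is defined and is the class [X];
    [exp_val I G e g d] that the value of [e] under [G] at [g] is [d]. *)
Record interp : Type := {
  ctx_val : ctx -> (env -> Prop) -> Prop;
  exp_val : ctx -> expr -> env -> den -> Prop
}.

Section Judgments.
Variables (m : language) (I : interp).

Definition defined (G : ctx) (e : expr) : Prop :=
  in_language m e /\
  exists X, ctx_val I G X /\ forall g, X g -> exists d, exp_val I G e g d.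

Definition is_Type (G : ctx) (s : expr) : Prop :=
  defined G s /\
  exists X, ctx_val I G X /\
    forall g, X g -> exists d, exp_val I G s g d /\ set_or_class d.

Definition has_type (G : ctx) (u s : expr) : Prop :=
  set_level u = true /\ defined G u /\ is_Type G s /\
  exists X, ctx_val I G X /\
    forall g, X g -> exists a d,
      exp_val I G u g (Val a) /\ exp_val I G s g d /\ in_den a d.

Definition holds (G : ctx) (p : expr) (g : env) : Prop :=
  exp_val I G p g (Val (vbool true)).

Definition ctx_clause (G : ctx) (X : env -> Prop) : Prop :=
  match G with
  | Nil => forall g, X g <-> g = []
  | Decl G s =>
      is_Type G s /\
      exists X0, ctx_val I G X0 /\
        forall g', X g' <->
          exists g a d, g' = a :: g /\ X0 g /\ exp_val I G s g d /\ in_den a d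
  | Hyp G p =>
      has_type G p BoolC /\
      exists X0, ctx_val I G X0 /\ forall g, X g <-> X0 g /\ holds G p g
  end.

(** [d] is the collection [C], as the denotation of the type expression [e]. *)
Definition collects (e : expr) (C : U -> Prop) (d : den) : Prop :=
  if set_level e
  then exists s, s ∈ V /\ (forall a, a ∈ s <-> C a) /\ d = Val (vset s)
  else exists D, (forall a, D a <-> C a) /\ d = Cls D.

Definition in_exp (a : U) (G : ctx) (s : expr) (g : env) : Prop :=
  exists d, exp_val I G s g d /\ in_den a d.

Definition exp_clause (G : ctx) (e : expr) (g : env) (d : den) : Prop :=
  match e with
  | Var n => exists a, nth_error g n = Some a /\ d = Val a
  | SetC => collects e (fun a => basic V a /\ exists s, a = vset s) d
  | BijC =>
      m = Ext /\ collects e (fun a => bijective V a /\ exists s, a = vset s) d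
  | BoolC => collects e (fun a => exists b, a = vbool b) d
  | Pair u v =>
      set_level u = true /\ set_level v = true /\ defined G u /\ defined G v /\
      exists a b, exp_val I G u g (Val a) /\ exp_val I G v g (Val b) /\
        d = Val (vpair a b)
  | Pr1 u =>
      (exists s t, has_type G u (Sum s t)) /\
      exists a b, exp_val I G u g (Val (vpair a b)) /\ d = Val a
  | Pr2 u =>
      (exists s t, has_type G u (Sum s t)) /\
      exists a b, exp_val I G u g (Val (vpair a b)) /\ d = Val b
  | Lam s e =>
      has_type G s (sort_S m) /\ (exists t, has_type (Decl G s) e t) /\
      exists f,
        (forall p, p ∈ f <-> exists a b,
           in_exp a G s g /\ exp_val I (Decl G s) e (a :: g) (Val b) /\
           p = opair a b) /\
        d = Val (vfun f)
  | App f u =>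
      (exists s t, has_type G f (Pi s t) /\ has_type G u s) /\
      exists h a b, exp_val I G f g (Val (vfun h)) /\ exp_val I G u g (Val a) /\
        opair a b ∈ h /\ d = Val b
  | Eq u v =>
      (exists s, has_type G u s /\ has_type G v s /\ has_type G s (sort_S m)) /\
      exists a a' b, exp_val I G u g (Val a) /\ exp_val I G v g (Val a') /\
        (b = true <-> a = a') /\ d = Val (vbool b)
  | All s p =>
      has_type (Decl G s) p BoolC /\
      exists b,
        (b = true <-> forall a, in_exp a G s g -> holds (Decl G s) p (a :: g)) /\
        d = Val (vbool b)
  | Not p =>
      has_type G p BoolC /\
      exists b, exp_val I G p g (Val (vbool b)) /\ d = Val (vbool (negb b))
  | Conn c p q =>
      has_type G p BoolC /\ has_type G q BoolC /\
      exists b b', exp_val I G p g (Val (vbool b)) /\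
        exp_val I G q g (Val (vbool b')) /\ d = Val (vbool (conn_fun c b b'))
  | Pi s t =>
      has_type G s (sort_S m) /\ has_type (Decl G s) t (sort_S m) /\
      collects e
        (fun v => exists f, v = vfun f /\ is_function f /\
           (forall a, in_exp a G s g <-> exists b, opair a b ∈ f) /\
           (forall a b, opair a b ∈ f -> in_exp b (Decl G s) t (a :: g)))
        d
  | Sum s t =>
      is_Type G s /\ is_Type (Decl G s) t /\
      collects e
        (fun v => exists a b, v = vpair a b /\
           in_exp a G s g /\ in_exp b (Decl G s) t (a :: g))
        d
  | Sub s p =>
      is_Type G s /\ has_type (Decl G s) p BoolC /\
      collects e (fun a => in_exp a G s g /\ holds (Decl G s) p (a :: g)) d
  end.

Definition step : interp := {|
  ctx_val := ctx_clause;
  exp_val := fun G e g d =>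
    (exists X, ctx_val I G X /\ X g) /\ exp_clause G e g d
|}.

End Judgments.

(** The premises of every clause are uniform in the interpretation [g], so the
    iteration closes after finite stages: when [V] is a Grothendieck universe,
    the union [sem] of the stages is the least solution of the clauses. *)
Fixpoint stage (m : language) (n : nat) : interp :=
  match n with
  | O => {| ctx_val := fun _ _ => False; exp_val := fun _ _ _ _ => False |}
  | S n => step m (stage m n)
  end.

Definition sem (m : language) : interp := {|
  ctx_val := fun G X => exists n, ctx_val (stage m n) G X;
  exp_val := fun G e g d => exists n, exp_val (stage m n) G e g d
|}.

Definition wf_ctx (m : language) (G : ctx) : Prop :=
  exists X, ctx_val (sem m) G X.

Definition models_type (m : language) (G : ctx) (u s : expr) : Prop :=
  has_type m (sem m) G u s.

Definition iso_at (G : ctx) (t u v : expr) (g : env) : Prop :=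
  exists w a b,
    in_exp (sem Ext) w G (star t) g /\
    exp_val (sem Base) G u g (Val a) /\ proj V Left w a /\
    exp_val (sem Base) G v g (Val b) /\ proj V Right w b.

(** [models_iso G t u v] is the judgment that [u =_t v] holds under [G]. *)
Definition models_iso (G : ctx) (t u v : expr) : Prop :=
  is_Type Base (sem Base) G t /\
  models_type Base G u t /\ models_type Base G v t /\
  forall X, ctx_val (sem Base) G X -> forall g, X g -> iso_at G t u v g.

End Semantics.

(* Main.v *)
From Stdlib Require Import List Lia Classical ClassicalEpsilon.
From Stdlib Require Import FunctionalExtensionality PropExtensionality.
From Stdlib Require Import Relation_Operators Transitive_Closure.
Require Import Defs.
Import ListNotations.

(** A pattern is an environment whose values are built from the atoms of finitely
    many sorts (sets of atoms). A labelling maps atoms to values, injectively on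
    each sort, and turns the sorts into basic sets, or into bijective sets for the
    extended language. A set-level expression has, over a pattern, a simple type
    that can be read off its syntax; therefore its evaluation commutes with
    labellings, in the base language and, for the starred expression, in the
    extended one. A member of a class type over an instance of a pattern is itself
    an instance of an extension of the pattern by fresh sorts, and so the truth of
    a formula does not depend on the labelling.

    Let [w] be a member of [s*] with projections [a] and [b] in [s]. It is an
    instance of a pattern [p] under some labelling [lam]. A bijective set may
    contain different values with the same two projections, so [L ∘ lam] need not
    be injective on the sorts. Identifying the atoms whose labels have the same
    projections yields a quotient of [p] on which [L ∘ lam] and [R ∘ lam] are
    labellings, with instances [a] and [b]; as [a] belongs to [s], the quotient is
    again a pattern for [s]. The value of [e] on it, labelled by the iso-pairs of
    the two labels, is the required member of [t*]. *)

(** * Closure of Grothendieck universes *)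

(** The direct induction, showing that $L$ and $R$ commute with evaluation, breaks down at equality.
    A bijective set may contain both the pair of the iso-pairs of $a,c$ and $b,d$ and the iso-pair
    of the pairs of $a,b$ and $c,d$: these are distinct values with equal projections, so an
    equation between them is false in the extended language and true on either side. Labellings are
    injective on each sort and therefore respect equality; the collapse caused by the projections is
    confined to atoms, and the quotient performs it before [e] is evaluated. For this reason [w]
    itself is never substituted into [e]. The clauses quantify over auxiliary types that are not
    subexpressions, so the invariance under labellings is proved by induction on the stage of the
    iteration. This requires every judgment to hold already at a finite stage, which follows from
    the uniformity of the premises and the closure of [V]. Relabelling inside the base language
    belongs to the same induction, because the invariance of a quantifier moves a value to its
    pattern and from there to another labelling. *)

Section Universe.
Context {U : ZF} {V : U} (HV : grothendieck V).

Lemma univ_trans (x y : U) : x ∈ y -> y ∈ V -> x ∈ V.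
Proof. apply HV. Qed.

Lemma univ_sub (a b : U) : b ∈ V -> (forall x, x ∈ a -> x ∈ b) -> a ∈ V.
Proof.
intros Hb Hab. apply univ_trans with (power b).
- now apply ZF_power.
- now apply HV.
Qed.

Lemma univ_empty : empty ∈ V.
Proof.
destruct (proj1 HV) as [x Hx]. apply univ_sub with x; [exact Hx|].
intros y Hy. now apply ZF_empty in Hy.
Qed.

Lemma univ_upair (x y : U) : x ∈ V -> y ∈ V -> upair x y ∈ V.
Proof. apply HV. Qed.

Lemma univ_opair (x y : U) : x ∈ V -> y ∈ V -> opair x y ∈ V.
Proof. intros. repeat apply univ_upair; assumption. Qed.

Lemma univ_union_repl (I : U) (F : U -> U) :
  I ∈ V -> (forall i, i ∈ I -> F i ∈ V) -> union (repl F I) ∈ V.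
Proof. apply HV. Qed.

Lemma univ_repl (I : U) (F : U -> U) :
  I ∈ V -> (forall i, i ∈ I -> F i ∈ V) -> repl F I ∈ V.
Proof.
intros HI HF.
apply univ_sub with (union (repl (fun i => upair (F i) (F i)) I)).
- apply univ_union_repl; auto using univ_upair.
- intros x. rewrite ZF_repl. intros (i & Hi & ->). apply ZF_union.
  exists (upair (F i) (F i)). rewrite ZF_repl, ZF_upair. eauto.
Qed.

Lemma univ_union (x : U) : x ∈ V -> union x ∈ V.
Proof.
intros Hx. replace x with (repl (fun y => y) x).
- apply univ_union_repl; eauto using univ_trans.
- apply ZF_ext. intros y. rewrite ZF_repl. split; [|eauto]. now intros (z & ? & ->).
Qed.

Lemma univ_numeral n : numeral n ∈ V.
Proof.
induction n; simpl.
- apply univ_empty.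
- auto using univ_union, univ_upair.
Qed.

Lemma univ_vbool b : vbool b ∈ V.
Proof. apply univ_opair; apply univ_numeral. Qed.

Lemma univ_vpair (x y : U) : x ∈ V -> y ∈ V -> vpair x y ∈ V.
Proof. intros. repeat apply univ_opair; auto using univ_numeral. Qed.

Lemma univ_vfun (f : U) : f ∈ V -> vfun f ∈ V.
Proof. intros. repeat apply univ_opair; auto using univ_numeral. Qed.

Lemma univ_vset (s : U) : s ∈ V -> vset s ∈ V.
Proof. intros. repeat apply univ_opair; auto using univ_numeral. Qed.

Lemma univ_vatom (s : U) : s ∈ V -> vatom s ∈ V.
Proof. intros. repeat apply univ_opair; auto using univ_numeral. Qed.

Lemma univ_visopair (x y : U) : x ∈ V -> y ∈ V -> visopair x y ∈ V.
Proof. intros. repeat apply univ_opair; auto using univ_numeral. Qed.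

Lemma univ_collect (C : U -> Prop) (b : U) :
  b ∈ V -> (forall a, C a -> a ∈ b) -> exists s, s ∈ V /\ forall a, a ∈ s <-> C a.
Proof.
intros Hb HC. exists (sep C b). split.
- apply univ_sub with b; [exact Hb|]. intros x Hx. now apply ZF_sep in Hx.
- intros a. rewrite ZF_sep. firstorder.
Qed.

(** The dependent sum of a family of sets. Functions collected by [Pi] are subsets of it and pairs
    collected by [Sum] are its elements up to a tag, so its membership in [V] bounds both. *)
Definition graph (s : U) (T : U -> U) : U :=
  union (repl (fun a => repl (opair a) (T a)) s).

Lemma graph_mem (s : U) (T : U -> U) p :
  p ∈ graph s T <-> exists a b, a ∈ s /\ b ∈ T a /\ p = opair a b.
Proof.
unfold graph. rewrite ZF_union. split.
- intros (y & Hy & Hp). apply ZF_repl in Hy. destruct Hy as (a & Ha & ->).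
  apply ZF_repl in Hp. destruct Hp as (b & Hb & ->). eauto.
- intros (a & b & Ha & Hb & ->). exists (repl (opair a) (T a)).
  split; apply ZF_repl; eauto.
Qed.

Lemma univ_graph (s : U) (T : U -> U) :
  s ∈ V -> (forall a, a ∈ s -> T a ∈ V) -> graph s T ∈ V.
Proof.
intros Hs HT. apply univ_union_repl; [exact Hs|]. intros a Ha.
apply univ_repl; eauto using univ_opair, univ_trans.
Qed.

End Universe.

Lemma vpair_inj {U : ZF} (a b c d : U) : vpair a b = vpair c d -> a = c /\ b = d.
Proof. intros H. apply opair_inj in H. now apply opair_inj. Qed.

Lemma visopair_inj {U : ZF} (a b c d : U) :
  visopair a b = visopair c d -> a = c /\ b = d.
Proof. intros H. apply opair_inj in H. now apply opair_inj. Qed.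

Lemma vset_inj {U : ZF} (a b : U) : vset a = vset b -> a = b.
Proof. intros H. now apply opair_inj in H. Qed.

Lemma vfun_inj {U : ZF} (a b : U) : vfun a = vfun b -> a = b.
Proof. intros H. now apply opair_inj in H. Qed.

Lemma vatom_inj {U : ZF} (a b : U) : vatom a = vatom b -> a = b.
Proof. intros H. now apply opair_inj in H. Qed.

Lemma vbool_inj {U : ZF} b c : @vbool U b = vbool c -> b = c.
Proof.
intros H. apply opair_inj in H. destruct H as [_ H]. apply numeral_inj in H.
destruct b, c; congruence.
Qed.

Ltac tag_clash :=
  match goal with
  | H : _ = _ |- _ =>
      exfalso; unfold vatom, vbool, vpair, vfun, vset, visopair in H;
      apply opair_inj in H; destruct H as [H _]; apply numeral_inj in H;
      discriminate H
  end.

(** * The clauses as uniform premises and pointwise values *)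

Fixpoint depth (G : ctx) : nat :=
  match G with Nil => 0 | Decl G _ => S (depth G) | Hyp G _ => depth G end.

Section Clauses.
Context {U : ZF} (V : U).
Notation interp := (@interp U).

(** The part of a clause in which no environment occurs. As it is uniform, a clause that applies at
    one environment applies at all, and this makes the iteration close at finite stages. For a
    variable the bound on the index replaces the success of the lookup, all environments of a
    context having length [depth G]. *)
Definition premise (m : language) (I : interp) (G : ctx) (e : expr) : Prop :=
  match e with
  | Var n => n < depth G
  | SetC | BoolC => True
  | BijC => m = Ext
  | Pair u v =>
      set_level u = true /\ set_level v = true /\ defined m I G u /\ defined m I G v
  | Pr1 u | Pr2 u => exists s t, has_type V m I G u (Sum s t)
  | Lam s e =>
      has_type V m I G s (sort_S m) /\ exists t, has_type V m I (Decl G s) e t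
  | App f u => exists s t, has_type V m I G f (Pi s t) /\ has_type V m I G u s
  | Eq u v => exists s, has_type V m I G u s /\ has_type V m I G v s /\
      has_type V m I G s (sort_S m)
  | All s p => has_type V m I (Decl G s) p BoolC
  | Not p => has_type V m I G p BoolC
  | Conn _ p q => has_type V m I G p BoolC /\ has_type V m I G q BoolC
  | Pi s t =>
      has_type V m I G s (sort_S m) /\ has_type V m I (Decl G s) t (sort_S m)
  | Sum s t => is_Type V m I G s /\ is_Type V m I (Decl G s) t
  | Sub s p => is_Type V m I G s /\ has_type V m I (Decl G s) p BoolC
  end.

Definition members (I : interp) (G : ctx) (e : expr) (g : env) (v : U) : Prop :=
  match e with
  | SetC => basic V v /\ exists s, v = vset s
  | BijC => bijective V v /\ exists s, v = vset s
  | BoolC => exists b, v = vbool b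
  | Pi s t => exists f, v = vfun f /\ is_function f /\
      (forall a, in_exp I a G s g <-> exists b, opair a b ∈ f) /\
      (forall a b, opair a b ∈ f -> in_exp I b (Decl G s) t (a :: g))
  | Sum s t => exists a b, v = vpair a b /\
      in_exp I a G s g /\ in_exp I b (Decl G s) t (a :: g)
  | Sub s p => in_exp I v G s g /\ holds I (Decl G s) p (v :: g)
  | _ => False
  end.

Definition value (I : interp) (G : ctx) (e : expr) (g : env) (d : @den U) : Prop :=
  match e with
  | Var n => exists a, nth_error g n = Some a /\ d = Val a
  | Pair u v =>
      exists a b, exp_val I G u g (Val a) /\ exp_val I G v g (Val b) /\
        d = Val (vpair a b)
  | Pr1 u => exists a b, exp_val I G u g (Val (vpair a b)) /\ d = Val a
  | Pr2 u => exists a b, exp_val I G u g (Val (vpair a b)) /\ d = Val b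
  | Lam s e =>
      exists f,
        (forall p, p ∈ f <-> exists a b,
           in_exp I a G s g /\ exp_val I (Decl G s) e (a :: g) (Val b) /\
           p = opair a b) /\
        d = Val (vfun f)
  | App f u =>
      exists h a b, exp_val I G f g (Val (vfun h)) /\ exp_val I G u g (Val a) /\
        opair a b ∈ h /\ d = Val b
  | Eq u v =>
      exists a a' b, exp_val I G u g (Val a) /\ exp_val I G v g (Val a') /\
        (b = true <-> a = a') /\ d = Val (vbool b)
  | All s p =>
      exists b,
        (b = true <-> forall a, in_exp I a G s g -> holds I (Decl G s) p (a :: g)) /\
        d = Val (vbool b)
  | Not p => exists b, exp_val I G p g (Val (vbool b)) /\ d = Val (vbool (negb b))
  | Conn c p q =>
      exists b b', exp_val I G p g (Val (vbool b)) /\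
        exp_val I G q g (Val (vbool b')) /\ d = Val (vbool (conn_fun c b b'))
  | _ => collects V e (members I G e g) d
  end.

Lemma exp_clause_iff m I G e g d :
  length g = depth G ->
  exp_clause V m I G e g d <-> premise m I G e /\ value I G e g d.
Proof.
intros Hg. destruct e; simpl; try tauto.
split; [|tauto]. intros H. split; [|exact H].
destruct H as (a & H & _). rewrite <- Hg. apply nth_error_Some. congruence.
Qed.

Definition le (I J : interp) : Prop :=
  (forall G X, ctx_val I G X -> ctx_val J G X) /\
  (forall G e g d, exp_val I G e g d -> exp_val J G e g d).

Definition det (I : interp) : Prop :=
  (forall G X X', ctx_val I G X -> ctx_val I G X' -> X = X') /\
  (forall G e g d d', exp_val I G e g d -> exp_val I G e g d' -> d = d').

Definition env_depth (I : interp) : Prop :=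
  forall G X g, ctx_val I G X -> X g -> length g = depth G.

(** The inclusion [le I (step V m I)] says that every entry of [I] is justified by its clause read
    in [I] itself, so entries can be inverted without descending to an earlier stage. [env_depth]
    serves to pass between clauses and premises. *)
Definition good (m : language) (I : interp) : Prop :=
  det I /\ le I (step V m I) /\ env_depth I.

Lemma collects_det e (C : U -> Prop) d d' :
  collects V e C d -> collects V e C d' -> d = d'.
Proof.
unfold collects. destruct (set_level e).
- intros (s & _ & Hs & ->) (s' & _ & Hs' & ->). do 2 f_equal. apply ZF_ext.
  intros x. now rewrite Hs, Hs'.
- intros (D & HD & ->) (D' & HD' & ->). f_equal. extensionality a.
  apply propositional_extensionality. now rewrite HD, HD'.
Qed.

Lemma bool_iff_det b b' P : (b = true <-> P) -> (b' = true <-> P) -> b = b'.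
Proof. destruct b, b'; intuition congruence. Qed.

Definition type_former (e : expr) : bool :=
  match e with SetC | BijC | BoolC | Pi _ _ | Sum _ _ | Sub _ _ => true | _ => false end.

Lemma value_type_former I G e g d :
  type_former e = true -> value I G e g d = collects V e (members I G e g) d.
Proof. destruct e; simpl; congruence. Qed.

Lemma in_collects e (C : U -> Prop) d v : collects V e C d -> in_den v d <-> C v.
Proof.
unfold collects. destruct (set_level e).
- intros (s & _ & Hs & ->). simpl. rewrite <- Hs. split; [|eauto].
  intros (s' & E & Hv). apply vset_inj in E. now subst.
- intros (D & HD & ->). apply HD.
Qed.

Lemma good_exp m I G e g d :
  good m I -> exp_val I G e g d ->
  (exists X, ctx_val I G X /\ X g) /\ premise m I G e /\ value I G e g d.
Proof.
intros (_ & (_ & HI) & HD) H. apply HI in H. destruct H as [(X & HX & Hg) H].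
split; [eauto|]. apply exp_clause_iff in H; eauto.
Qed.

Lemma in_exp_members m I G e g v :
  good m I -> type_former e = true -> in_exp I v G e g -> members I G e g v.
Proof.
intros HI He (d & Hd & Hv). apply (good_exp m) in Hd; [|exact HI].
destruct Hd as (_ & _ & Hd). rewrite value_type_former in Hd by exact He.
now apply (in_collects _ _ _ v) in Hd; apply Hd.
Qed.

Lemma defined_at m I G X e g :
  det I -> defined m I G e -> ctx_val I G X -> X g -> exists d, exp_val I G e g d.
Proof.
intros [HI _] (_ & X' & HX' & H) HX Hg. rewrite (HI _ _ _ HX HX') in Hg. auto.
Qed.

Lemma is_Type_at m I G X s g :
  det I -> is_Type V m I G s -> ctx_val I G X -> X g ->
  exists d, exp_val I G s g d /\ set_or_class V d.
Proof.
intros [HI _] (_ & X' & HX' & H) HX Hg. rewrite (HI _ _ _ HX HX') in Hg. auto.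
Qed.

Lemma has_type_at m I G X u s g :
  det I -> has_type V m I G u s -> ctx_val I G X -> X g ->
  exists a, exp_val I G u g (Val a) /\ in_exp I a G s g.
Proof.
intros [HI _] (_ & _ & _ & X' & HX' & H) HX Hg. rewrite (HI _ _ _ HX HX') in Hg.
apply H in Hg. destruct Hg as (a & d & ? & ? & ?). exists a. split; [assumption|].
now exists d.
Qed.

Lemma has_type_val m I G X u s g a :
  det I -> has_type V m I G u s -> ctx_val I G X -> X g ->
  exp_val I G u g (Val a) -> in_exp I a G s g.
Proof.
intros HI H HX Hg Ha. destruct (has_type_at _ _ _ _ _ _ _ HI H HX Hg) as (a' & Ha' & K).
pose proof (proj2 HI _ _ _ _ _ Ha Ha') as E. injection E as E. now subst.
Qed.

Lemma value_det m I G X e g d d' :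
  good m I -> ctx_val I G X -> X g -> premise m I G e ->
  value I G e g d -> value I G e g d' -> d = d'.
Proof.
intros HG HX Hg. pose proof (proj1 HG) as Hdet. pose proof (proj2 Hdet) as HI.
destruct e; simpl; intros HP H H';
  try (eapply collects_det; eassumption).
- destruct H as (a & H & ->), H' as (a' & H' & ->). congruence.
- destruct H as (a & b & Ha & Hb & ->), H' as (a' & b' & Ha' & Hb' & ->).
  pose proof (HI _ _ _ _ _ Ha Ha') as E. pose proof (HI _ _ _ _ _ Hb Hb') as E'. congruence.
- destruct H as (a & b & Ha & ->), H' as (a' & b' & Ha' & ->).
  pose proof (HI _ _ _ _ _ Ha Ha') as E. injection E as E.
  apply vpair_inj in E. now destruct E; subst.
- destruct H as (a & b & Ha & ->), H' as (a' & b' & Ha' & ->).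
  pose proof (HI _ _ _ _ _ Ha Ha') as E. injection E as E.
  apply vpair_inj in E. now destruct E; subst.
- destruct H as (f & Hf & ->), H' as (f' & Hf' & ->). do 2 f_equal. apply ZF_ext.
  intros p. now rewrite Hf, Hf'.
- destruct H as (h & a & b & Hh & Ha & Hb & ->), H' as (h' & a' & b' & Hh' & Ha' & Hb' & ->).
  pose proof (HI _ _ _ _ _ Hh Hh') as E. pose proof (HI _ _ _ _ _ Ha Ha') as E'.
  injection E as E. injection E' as E'. apply vfun_inj in E. subst h' a'.
  (* A graph under [vfun] need not be single-valued; here it is, because the premise types the
     function in a product. *)
  destruct HP as (s & t & Hf & _).
  apply (has_type_val _ _ _ _ _ _ _ _ Hdet Hf HX Hg) in Hh.
  apply (in_exp_members m) in Hh; [|exact HG|reflexivity].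
  destruct Hh as (f & E & Hfun & _). apply vfun_inj in E. subst f.
  f_equal. eapply Hfun; eassumption.
- destruct H as (a & b & c & Ha & Hb & Hc & ->), H' as (a' & b' & c' & Ha' & Hb' & Hc' & ->).
  pose proof (HI _ _ _ _ _ Ha Ha') as E. pose proof (HI _ _ _ _ _ Hb Hb') as E'.
  injection E as E. injection E' as E'. subst. do 2 f_equal. eapply bool_iff_det; eassumption.
- destruct H as (b & Hb & ->), H' as (b' & Hb' & ->). do 2 f_equal.
  eapply bool_iff_det; eassumption.
- destruct H as (b & Hb & ->), H' as (b' & Hb' & ->).
  pose proof (HI _ _ _ _ _ Hb Hb') as E. injection E as E. apply vbool_inj in E. now subst.
- destruct H as (a & b & Ha & Hb & ->), H' as (a' & b' & Ha' & Hb' & ->).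
  pose proof (HI _ _ _ _ _ Ha Ha') as E. pose proof (HI _ _ _ _ _ Hb Hb') as E'.
  injection E as E. injection E' as E'. apply vbool_inj in E, E'. now subst.
Qed.

Lemma value_level m I G e g d :
  premise m I G e -> value I G e g d ->
  if set_level e then exists v, d = Val v else exists C, d = Cls C.
Proof.
assert (K : forall C, collects V e C d ->
  if set_level e then exists v, d = Val v else exists C, d = Cls C).
{ intros C. unfold collects. destruct (set_level e); intros (? & ? & H).
  - destruct H as [_ ->]. eauto.
  - subst. eauto. }
destruct e; intros HP H; try (eapply K; exact H); clear K; simpl in HP, H |- *.
- destruct H as (a & _ & ->). eauto.
- destruct HP as (-> & -> & _), H as (a & b & _ & _ & ->). simpl. eauto.
- destruct HP as (s & t & -> & _), H as (a & b & _ & ->). eauto.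
- destruct HP as (s & t & -> & _), H as (a & b & _ & ->). eauto.
- destruct HP as [[-> _] [t [-> _]]], H as (f & _ & ->). simpl. eauto.
- destruct HP as (s & t & [-> _] & [-> _]), H as (h & a & b & _ & _ & _ & ->). simpl. eauto.
- destruct H as (a & b & c & _ & _ & _ & ->). eauto.
- destruct H as (b & _ & ->). eauto.
- destruct H as (b & _ & ->). eauto.
- destruct H as (a & b & _ & _ & ->). eauto.
Qed.

Lemma exp_val_level m I G e g d :
  good m I -> exp_val I G e g d ->
  if set_level e then exists v, d = Val v else exists C, d = Cls C.
Proof.
intros HI H. apply (good_exp m) in H; [|exact HI].
destruct H as (_ & HP & H). eapply value_level; eassumption.
Qed.

Lemma ctx_decl m I G s X1 X :
  good m I -> ctx_val I (Decl G s) X1 -> ctx_val I G X ->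
  is_Type V m I G s /\ forall g', X1 g' <-> exists a g, g' = a :: g /\ X g /\ in_exp I a G s g.
Proof.
intros (Hd & [Hle _] & _) H HX. apply Hle in H. destruct H as (HT & X0 & HX0 & H).
rewrite (proj1 Hd _ _ _ HX HX0). split; [exact HT|].
intros g'. rewrite H. unfold in_exp. firstorder.
Qed.

Lemma step_env_depth m I : env_depth I -> env_depth (step V m I).
Proof.
intros HI G X g H Hg. destruct G; simpl in *.
- apply H in Hg. now subst.
- destruct H as (_ & X0 & HX0 & H). apply H in Hg.
  destruct Hg as (g' & a & d & -> & Hg' & _). simpl. f_equal. eapply HI; eassumption.
- destruct H as (_ & X0 & HX0 & H). apply H in Hg. destruct Hg as [Hg _].
  eapply HI; eassumption.
Qed.

Lemma step_det m I : good m I -> det (step V m I).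
Proof.
intros HG. pose proof (proj1 HG) as Hd. split.
- intros G X X' H H'. extensionality g. apply propositional_extensionality.
  destruct G; simpl in H, H'.
  + now rewrite H, H'.
  + destruct H as (_ & X0 & HX0 & H), H' as (_ & X0' & HX0' & H').
    rewrite H, H', (proj1 Hd _ _ _ HX0 HX0'). reflexivity.
  + destruct H as (_ & X0 & HX0 & H), H' as (_ & X0' & HX0' & H').
    rewrite H, H', (proj1 Hd _ _ _ HX0 HX0'). reflexivity.
- intros G e g d d' [(X & HX & Hg) H] [_ H'].
  apply exp_clause_iff in H, H'; try (eapply HG; eassumption).
  destruct H as [HP H], H' as [_ H'].
  exact (value_det m I G X e g d d' HG HX Hg HP H H').
Qed.

End Clauses.

(** * Transfer of values along a substitution *)

Definition up_env {U : ZF} (th : @env U -> @env U) (g : @env U) : @env U :=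
  match g with [] => [] | a :: g => a :: th g end.

Lemma up_Var : up Var = Var.
Proof. extensionality n. now destruct n. Qed.

Lemma subst_Var e : subst Var e = e.
Proof. induction e; simpl; rewrite ?up_Var; congruence. Qed.

Lemma up_env_id {U : ZF} : @up_env U (fun g => g) = fun g => g.
Proof. extensionality g. now destruct g. Qed.

Section Transfer.
Context {U : ZF} (V : U).
Notation interp := (@interp U).
Notation env := (@env U).

Lemma collects_eq e e' (C C' : U -> Prop) d :
  set_level e' = set_level e -> (forall v, C v <-> C' v) ->
  collects V e C d -> collects V e' C' d.
Proof.
intros E HC. unfold collects. rewrite E. destruct (set_level e).
- intros (s & Hs & H & ->). exists s. repeat split; auto; rewrite <- HC; apply H.
- intros (D & H & ->). exists D. split; [|reflexivity]. intros a. now rewrite <- HC.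
Qed.

(** Monotonicity of [step] (the identity substitution between two interpretations), weakening,
    instantiation and the passage from the base to the extended language all have this form, so the
    clauses are traversed once for all of them. Values are required to move forward only; for
    defined expressions [tr_val_iff] gets the converse from a single-valued target. *)
Record transfer (m m' : language) (I J : interp) (f : nat -> expr) (G G' : ctx)
    (X X' : env -> Prop) (th : env -> env) : Prop := {
  tr_src : ctx_val I G X;
  tr_tgt : ctx_val J G' X';
  tr_env : forall g, X' g -> X (th g);
  tr_lang : forall e, in_language m e -> in_language m' (subst f e);
  tr_level : forall e, set_level (subst f e) = set_level e;
  tr_val : forall e g d, X' g -> defined m I G e ->
    exp_val I G e (th g) d -> exp_val J G' (subst f e) g d
}.

Arguments tr_src {_ _ _ _ _ _ _ _ _ _} _.
Arguments tr_lang {_ _ _ _ _ _ _ _ _ _} _.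
Arguments tr_level {_ _ _ _ _ _ _ _ _ _} _.
Arguments tr_val {_ _ _ _ _ _ _ _ _ _} _.

Section Judgments.
Context {m m' : language} {I J : interp} {f : nat -> expr} {G G' : ctx}
  {X X' : env -> Prop} {th : env -> env}.
Context (T : transfer m m' I J f G G' X X' th) (HI : det I) (HJ : det J).

Lemma tr_defined e : defined m I G e -> defined m' J G' (subst f e).
Proof.
intros H. split; [apply (tr_lang T), H|].
exists X'. split; [apply T|]. intros g Hg.
destruct (defined_at _ _ _ _ _ (th g) HI H (tr_src T)) as [d Hd].
- now apply T.
- exists d. now apply T.
Qed.

Lemma tr_is_Type s : is_Type V m I G s -> is_Type V m' J G' (subst f s).
Proof.
intros H. split; [apply tr_defined, H|]. exists X'. split; [apply T|]. intros g Hg.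
destruct (is_Type_at V _ _ _ _ _ (th g) HI H (tr_src T)) as [d [Hd K]].
- now apply T.
- exists d. split; [|exact K]. apply T; auto. apply H.
Qed.

Lemma tr_has_type u s :
  has_type V m I G u s -> has_type V m' J G' (subst f u) (subst f s).
Proof.
intros H. pose proof H as (Hl & Hu & Hs & _).
split; [|split; [|split]].
- now rewrite (tr_level T).
- now apply tr_defined.
- now apply tr_is_Type.
- exists X'. split; [apply T|]. intros g Hg.
  destruct (has_type_at V _ _ _ _ _ _ (th g) HI H (tr_src T))
    as (a & Ha & d & Hd & K).
  + now apply T.
  + exists a, d. repeat split; [| |exact K]; apply T; auto. apply Hs.
Qed.

Lemma tr_val_iff e g d :
  X' g -> defined m I G e ->
  exp_val I G e (th g) d <-> exp_val J G' (subst f e) g d.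
Proof.
intros Hg He. split; [now apply T|]. intros H.
destruct (defined_at _ _ _ _ _ (th g) HI He (tr_src T)) as [d' Hd].
- now apply T.
- replace d with d'; [exact Hd|].
  eapply HJ; [|exact H]. now apply T.
Qed.

Lemma tr_in_exp a e g :
  X' g -> defined m I G e -> in_exp I a G e (th g) <-> in_exp J a G' (subst f e) g.
Proof.
intros Hg He. unfold in_exp.
split; intros (d & Hd & K); exists d; (split; [|exact K]); now apply tr_val_iff.
Qed.

End Judgments.

Section Clause.
Context {m m' : language} {I J : interp} {f : nat -> expr} {G G' : ctx}
  {X X' : env -> Prop} {th : env -> env}.
Context (T : transfer m m' I J f G G' X X' th) (HI : good V m I) (HJ : det J).
Context (HB : forall s X1, ctx_val I (Decl G s) X1 -> exists X1',
  transfer m m' I J (up f) (Decl G s) (Decl G' (subst f s)) X1 X1' (up_env th) /\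
  forall a g, X' g -> in_exp I a G s (th g) -> X1' (a :: g)).
Context (Hm : m = Ext -> m' = Ext).
Context (HS : forall G' u, has_type V m' J G' u (sort_S m) -> has_type V m' J G' u (sort_S m')).

Let tr_sort u : has_type V m I G u (sort_S m) -> has_type V m' J G' (subst f u) (sort_S m').
Proof.
intros H. apply HS. apply (tr_has_type T (proj1 HI)) in H. now destruct m.
Qed.

Let trb_has_type s u t :
  has_type V m I (Decl G s) u t ->
  has_type V m' J (Decl G' (subst f s)) (subst (up f) u) (subst (up f) t).
Proof.
intros H. pose proof H as (_ & _ & _ & X1 & HX1 & _).
destruct (HB _ _ HX1) as (X1' & T1 & _).
exact (tr_has_type T1 (proj1 HI) _ _ H).
Qed.

Let trb_sort s u :
  has_type V m I (Decl G s) u (sort_S m) ->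
  has_type V m' J (Decl G' (subst f s)) (subst (up f) u) (sort_S m').
Proof.
intros H. apply HS. apply trb_has_type in H. now destruct m.
Qed.

Let trb_val s a g e d :
  X' g -> in_exp I a G s (th g) -> defined m I (Decl G s) e ->
  exp_val I (Decl G s) e (a :: th g) d <->
  exp_val J (Decl G' (subst f s)) (subst (up f) e) (a :: g) d.
Proof.
intros Hg Ha He. pose proof He as (_ & X1 & HX1 & _).
destruct (HB _ _ HX1) as (X1' & T1 & K).
apply (tr_val_iff T1 (proj1 HI) HJ e (a :: g)); auto.
Qed.

(** Variables are set apart because [f] may send them to any expression. Under a binder the transfer
    is supplied by [HB], and [HS] changes the sort when the source language is the base one and the
    target the extended one, whose premises ask for typings in [Bij]. *)
Lemma premise_transfer e :
  (forall n, e <> Var n) -> premise V m I G e -> premise V m' J G' (subst f e).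
Proof.
pose proof (tr_has_type T (proj1 HI)) as K1.
destruct e; intros Hv; simpl; auto.
- now destruct (Hv n).
- rewrite !(tr_level T). intros (? & ? & ? & ?).
  repeat split; auto; now apply (tr_defined T (proj1 HI)).
- intros (s & t & H). apply K1 in H. simpl in H. eauto.
- intros (s & t & H). apply K1 in H. simpl in H. eauto.
- intros (H & t & H'). split; eauto.
- intros (s & t & H & H'). apply K1 in H, H'. simpl in H. eauto.
- intros (s & H & H' & H''). exists (subst f s). auto.
- intros H. apply trb_has_type in H. exact H.
- exact (K1 e BoolC).
- intros [H H']. split; [exact (K1 _ _ H)|exact (K1 _ _ H')].
- intros [H H']. split; auto.
- intros [H H']. split; [now apply (tr_is_Type T (proj1 HI))|].
  pose proof H' as (_ & X1 & HX1 & _). destruct (HB _ _ HX1) as (X1' & T1 & _).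
  exact (tr_is_Type T1 (proj1 HI) _ H').
- intros [H H']. split; [now apply (tr_is_Type T (proj1 HI))|].
  apply trb_has_type in H'. exact H'.
Qed.

Lemma members_transfer e g v :
  (forall n, e <> Var n) -> premise V m I G e -> X' g ->
  members V I G e (th g) v <-> members V J G' (subst f e) g v.
Proof.
intros Hv HP Hg.
assert (K0 : forall a s, defined m I G s -> in_exp I a G s (th g) <-> in_exp J a G' (subst f s) g)
  by (intros; now apply (tr_in_exp T (proj1 HI) HJ)).
assert (K1 : forall s a b t, in_exp I a G s (th g) -> defined m I (Decl G s) t ->
  in_exp I b (Decl G s) t (a :: th g) <-> in_exp J b (Decl G' (subst f s)) (subst (up f) t) (a ::
    g)).
{ intros s a b t Ha Ht. unfold in_exp.
  split; intros (d & Hd & K); exists d; (split; [|exact K]); now apply trb_val. }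
destruct e; simpl in HP |- *; try tauto.
- now destruct (Hv n).
- destruct HP as [(_ & Hs & _) (_ & Ht & _)].
  split; intros (h & -> & Hf & H1 & H2); exists h;
    (split; [reflexivity|split; [exact Hf|split]]).
  + intros a. now rewrite <- K0.
  + intros a b Hab. apply K1; auto. apply H1. eauto.
  + intros a. now rewrite K0.
  + intros a b Hab. apply K1; auto. apply K0, H1; eauto.
- destruct HP as [[Hs _] [Ht _]].
  split; intros (a & b & -> & H1 & H2); exists a, b; (split; [reflexivity|]).
  + split; [now apply K0|now apply K1].
  + apply K0 in H1; auto. split; [exact H1|now apply K1].
- destruct HP as [[Hs _] (_ & Hp & _)]. unfold holds. rewrite <- K0 by exact Hs.
  split; intros [H1 H2]; (split; [exact H1|]); revert H2; now apply trb_val.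
Qed.

Lemma value_transfer e g d :
  (forall n, e <> Var n) -> premise V m I G e -> X' g ->
  value V I G e (th g) d -> value V J G' (subst f e) g d.
Proof.
intros Hv HP Hg.
assert (K : type_former e = true -> value V I G e (th g) d -> value V J G' (subst f e) g d).
{ intros He. rewrite !value_type_former; [|now destruct e|exact He].
  apply collects_eq; [apply T|]. intros v. now apply members_transfer. }
pose proof (fun e d => tr_val T e g d Hg) as KV.
destruct e; try (now apply K); clear K; simpl in HP |- *.
- now destruct (Hv n).
- destruct HP as (_ & _ & Hu & Hw). intros (a & b & Ha & Hb & ->). exists a, b. auto.
- destruct HP as (s & t & _ & Hu & _). intros (a & b & Ha & ->). exists a, b. auto.
- destruct HP as (s & t & _ & Hu & _). intros (a & b & Ha & ->). exists a, b. auto.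
- destruct HP as [(_ & Hs & _) [t (_ & He & _)]]. intros (h & H & ->). exists h.
  split; [|reflexivity]. intros p. rewrite H.
  split; intros (a & b & H1 & H2 & ->); exists a, b.
  + split; [now apply (tr_in_exp T (proj1 HI) HJ)|split; [now apply trb_val|reflexivity]].
  + apply (tr_in_exp T (proj1 HI) HJ) in H1; auto.
    split; [exact H1|split; [now apply trb_val|reflexivity]].
- destruct HP as (s & t & (_ & Hf & _) & (_ & Hu & _)).
  intros (h & a & b & H1 & H2 & H3 & ->). exists h, a, b. auto.
- destruct HP as (s & (_ & Hu & _) & (_ & Hw & _) & _).
  intros (a & b & c & H1 & H2 & H3 & ->). exists a, b, c. auto.
- pose proof HP as (_ & Hp & _ & X1 & HX1 & _).
  destruct (ctx_decl V _ _ _ _ _ _ HI HX1 (tr_src T)) as [[Hs _] _].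
  intros (b & H & ->). exists b. split; [|reflexivity]. rewrite H. unfold holds.
  split; intros K a Ha.
  + apply (tr_in_exp T (proj1 HI) HJ) in Ha; auto. apply trb_val; auto.
  + apply (trb_val _ _ g _ _ Hg Ha Hp). apply K. now apply (tr_in_exp T (proj1 HI) HJ).
- destruct HP as (_ & Hp & _). intros (b & H & ->). exists b. auto.
- destruct HP as [(_ & Hp & _) (_ & Hq & _)]. intros (a & b & Ha & Hb & ->). exists a, b. auto.
Qed.

End Clause.

Lemma transfer_le m I J G X :
  det J -> le I J -> ctx_val I G X -> transfer m m I J Var G G X X (fun g => g).
Proof.
intros HJ HIJ HX. split; auto.
- now apply HIJ.
- intros e. now rewrite subst_Var.
- intros e. now rewrite subst_Var.
- intros e g d _ _ H. rewrite subst_Var. now apply HIJ.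
Qed.

(** Monotonicity cannot be read off the clauses, because [All], [Lam] and [Pi] use the
    interpretation with both signs. It holds since the premises make all components defined at every
    environment, so that a larger single-valued interpretation has nothing to add to them. *)
Lemma step_mono m I J : good V m I -> det J -> le I J -> le (step V m I) (step V m J).
Proof.
intros HI HJ HIJ. pose proof (proj1 HI) as Hd. split.
- intros G X H. destruct G; simpl in *.
  + exact H.
  + destruct H as (Hs & X0 & HX0 & H). pose proof (transfer_le m I J _ _ HJ HIJ HX0) as T.
    pose proof (tr_is_Type T Hd s Hs) as K. rewrite subst_Var in K. split; [exact K|].
    exists X0. split; [now apply HIJ|]. intros g'. rewrite H.
    split; intros (g & a & d & -> & Hg & Hd' & Ha); exists g, a, d; repeat split; auto.
    * now apply HIJ.
    * apply (tr_val_iff T Hd HJ); [exact Hg|apply Hs|]. now rewrite subst_Var.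
  + destruct H as (Hs & X0 & HX0 & H). pose proof (transfer_le m I J _ _ HJ HIJ HX0) as T.
    pose proof (tr_has_type T Hd _ _ Hs) as K. rewrite !subst_Var in K. split; [exact K|].
    exists X0. split; [now apply HIJ|]. intros g. rewrite H. unfold holds.
    split; intros [Hg Hp]; (split; [exact Hg|]).
    * now apply HIJ.
    * apply (tr_val_iff T Hd HJ); [exact Hg|apply Hs|]. now rewrite subst_Var.
- intros G e g d [(X & HX & Hg) H]. split; [exists X; split; [now apply HIJ|exact Hg]|].
  assert (Hl : length g = depth G) by (eapply HI; eassumption).
  apply exp_clause_iff in H; [|exact Hl]. apply exp_clause_iff; [exact Hl|].
  destruct H as [HP H].
  destruct (classic (exists n, e = Var n)) as [[n ->]|Hv]; [split; [exact HP|exact H]|].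
  assert (Hv' : forall n, e <> Var n) by (intros n ->; eauto).
  pose proof (transfer_le m I J _ _ HJ HIJ HX) as T.
  assert (HB : forall s X1, ctx_val I (Decl G s) X1 -> exists X1',
    transfer m m I J (up Var) (Decl G s) (Decl G (subst Var s)) X1 X1' (up_env (fun g => g)) /\
    forall a g, X g -> in_exp I a G s g -> X1' (a :: g)).
  { intros s X1 HX1. exists X1. rewrite up_Var, subst_Var, up_env_id.
    split; [now apply transfer_le|]. intros a g' Hg' Ha.
    apply (ctx_decl V m I G s X1 X HI HX1 HX). eauto. }
  split.
  + rewrite <- (subst_Var e). eapply (premise_transfer T HI HB); auto.
  + rewrite <- (subst_Var e). eapply (value_transfer T HI HJ HB); eauto.
Qed.

Lemma step_good m I : good V m I -> good V m (step V m I).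
Proof.
intros HI. pose proof (step_det V m I HI) as Hd. split; [exact Hd|split].
- apply step_mono; [exact HI|exact Hd|apply HI].
- apply step_env_depth, HI.
Qed.

Lemma stage_good m n : good V m (stage V m n).
Proof.
induction n as [|n IH]; [|now apply step_good].
split; [|split]; try split; simpl; intros; try contradiction.
intros G X g [].
Qed.

Lemma stage_le m n k : n <= k -> le (stage V m n) (stage V m k).
Proof.
induction 1 as [|k _ IH]; [split; auto|].
pose proof (proj1 (proj2 (stage_good m k))) as K. split; intros.
- now apply K, IH.
- now apply K, IH.
Qed.

Lemma stage_le_sem m n : le (stage V m n) (sem V m).
Proof. split; intros; now exists n. Qed.

Lemma sem_det m : det (sem V m).
Proof.
split.
- intros G X X' [n H] [k H'].
  apply (proj1 (stage_le m n (n + k) ltac:(lia))) in H.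
  apply (proj1 (stage_le m k (n + k) ltac:(lia))) in H'.
  eapply (stage_good m (n + k)); eassumption.
- intros G e g d d' [n H] [k H'].
  apply (proj2 (stage_le m n (n + k) ltac:(lia))) in H.
  apply (proj2 (stage_le m k (n + k) ltac:(lia))) in H'.
  eapply (stage_good m (n + k)); eassumption.
Qed.

Lemma sem_good m : good V m (sem V m).
Proof.
split; [apply sem_det|split].
- split; intros.
  + destruct H as [[|n] H]; [contradiction|].
    apply (step_mono m (stage V m n)); auto using stage_good, sem_det, stage_le_sem.
  + destruct H as [[|n] H]; [contradiction|].
    apply (step_mono m (stage V m n)); auto using stage_good, sem_det, stage_le_sem.
- intros G X g [n H]. now apply (stage_good m n).
Qed.

End Transfer.

Arguments tr_src {_ _ _ _ _ _ _ _ _ _ _} _.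
Arguments tr_lang {_ _ _ _ _ _ _ _ _ _ _} _.
Arguments tr_level {_ _ _ _ _ _ _ _ _ _ _} _.
Arguments tr_val {_ _ _ _ _ _ _ _ _ _ _} _.

(** * The semantics as a fixed point of the clauses *)

Lemma choice_on {U : ZF} (S : U) (P : U -> U -> Prop) :
  (forall a, a ∈ S -> exists b, P a b) -> exists F, forall a, a ∈ S -> P a (F a).
Proof.
intros H. exists (fun a => epsilon (inhabits empty) (P a)).
intros a Ha. apply epsilon_spec. auto.
Qed.

Lemma basic_vset_inv {U : ZF} (V s : U) :
  basic V (vset s) -> s ∈ V /\ forall x, x ∈ s -> basic V x.
Proof.
intros H. inversion H as [x Hx E|b E|x y Hx Hy E|f Hf H1 H2 H3 E|s' Hs Hx E]; try tag_clash.
apply vset_inj in E. now subst.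
Qed.

Lemma bijective_vset_inv {U : ZF} (V s : U) :
  bijective V (vset s) ->
  s ∈ V /\ (forall x, x ∈ s -> bijective V x) /\ projections_biject V s.
Proof.
intros H. inversion H as [x Hx E|b E|x y Hx Hy E|x y Hx Hy E|f s' Hf H1 H2 H3 H4 E|s' Hs Hx Hp E];
  try tag_clash.
apply vset_inj in E. now subst.
Qed.

Definition decl_env {U : ZF} (I : @interp U) (G : ctx) (s : expr) (X : @env U -> Prop)
    (g' : @env U) : Prop :=
  exists a g, g' = a :: g /\ X g /\ in_exp I a G s g.

Section FixedPoint.
Context {U : ZF} {V : U} (HV : grothendieck V).
Notation interp := (@interp U).
Notation env := (@env U).

Lemma sort_is_Type m I G s :
  good V m I -> has_type V m I G s (sort_S m) -> is_Type V m I G s.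
Proof.
intros HI H. pose proof H as (_ & Hs & _ & X & HX & _). split; [exact Hs|].
exists X. split; [exact HX|]. intros g Hg.
destruct (has_type_at V _ _ _ _ _ _ _ (proj1 HI) H HX Hg) as (a & Ha & K).
exists (Val a). split; [exact Ha|].
apply (in_exp_members V m) in K; [|exact HI|now destruct m].
destruct m; destruct K as [K [S ->]]; exists S; (split; [|reflexivity]).
- apply (basic_vset_inv V S K).
- apply (bijective_vset_inv V S K).
Qed.

Lemma is_Type_set m I G X s g :
  good V m I -> is_Type V m I G s -> set_level s = true -> ctx_val I G X -> X g ->
  exists S, S ∈ V /\ exp_val I G s g (Val (vset S)).
Proof.
intros HI Hs Hl HX Hg.
destruct (is_Type_at V _ _ _ _ _ _ (proj1 HI) Hs HX Hg) as (d & Hd & K).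
pose proof (exp_val_level V _ _ _ _ _ _ HI Hd) as L. rewrite Hl in L.
destruct L as [v ->]. destruct K as (S & HS & ->). eauto.
Qed.

Lemma in_exp_vset (I : interp) G s g (S a : U) :
  det I -> exp_val I G s g (Val (vset S)) -> in_exp I a G s g <-> a ∈ S.
Proof.
intros HI HS. split.
- intros (d & Hd & K). rewrite (proj2 HI _ _ _ _ _ Hd HS) in K.
  destruct K as (S' & E & K). apply vset_inj in E. now subst.
- intros Ha. exists (Val (vset S)). split; [exact HS|]. now exists S.
Qed.

Lemma decl_family m (I : interp) G X s t g (S : U) :
  good V m I -> ctx_val I G X -> X g -> exp_val I G s g (Val (vset S)) ->
  is_Type V m I (Decl G s) t -> set_level t = true ->
  exists T, forall a, a ∈ S -> T a ∈ V /\ exp_val I (Decl G s) t (a :: g) (Val (vset (T a))).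
Proof.
intros HI HX Hg HS Ht Hl.
apply (choice_on S (fun a T => T ∈ V /\ exp_val I (Decl G s) t (a :: g) (Val (vset T)))).
intros a Ha.
pose proof Ht as (_ & X1 & HX1 & _).
apply (is_Type_set m I (Decl G s) X1); auto.
apply (ctx_decl V m I G s X1 X HI HX1 HX). exists a, g. split; [reflexivity|split; [exact Hg|]].
apply (in_exp_vset _ _ _ _ S); [apply HI|exact HS|exact Ha].
Qed.

Lemma members_total m I G X e g :
  good V m I -> ctx_val I G X -> X g -> premise V m I G e -> type_former e = true ->
  exists d, collects V e (members V I G e g) d.
Proof.
intros HI HX Hg HP He. pose proof (proj1 HI) as Hd.
assert (K : set_level e = false \/ exists b, b ∈ V /\ forall v, members V I G e g v -> v ∈ b).
2:{ unfold collects. destruct K as [->|(b & Hb & K)];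
      [exists (Cls (members V I G e g)); eexists; split; [|reflexivity]; reflexivity|].
    destruct (set_level e); [|eexists; eexists; split; [|reflexivity]; reflexivity].
    destruct (univ_collect HV _ b Hb K) as (s & Hs & H). eauto 6. }
destruct (set_level e) eqn:Hl; [right|now left].
destruct e; try discriminate; simpl in HP, Hl |- *.
- exists (upair (vbool true) (vbool false)). split.
  { now apply univ_upair; [|apply univ_vbool|apply univ_vbool]. }
  intros v [[] ->]; apply ZF_upair; auto.
- destruct HP as [Hs Ht]. pose proof Hs as (L1 & _). pose proof Ht as (L2 & _).
  assert (Ht' : is_Type V m I (Decl G e1) e2) by now apply sort_is_Type.
  apply sort_is_Type in Hs; [|exact HI].
  destruct (is_Type_set _ _ _ _ _ _ HI Hs L1 HX Hg) as (S & HS & KS).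
  destruct (decl_family _ _ _ _ _ _ _ _ HI HX Hg KS Ht' L2) as [T HT].
  exists (repl vfun (power (graph S T))). split.
  + apply univ_repl; [exact HV| |].
    * apply HV. apply univ_graph; auto. intros a Ha. now apply HT.
    * intros f Hf. apply (univ_vfun HV). eapply univ_trans; [exact HV|exact Hf|].
      apply HV. apply univ_graph; auto. intros a Ha. now apply HT.
  + intros v (f & -> & Hf & H1 & H2). apply ZF_repl. exists f. split; [|reflexivity].
    apply ZF_power. intros p Hp. destruct (proj1 Hf p Hp) as (a & b & ->).
    assert (Ha : a ∈ S) by (apply (in_exp_vset I G e1 g); [exact Hd|exact KS|apply H1; eauto]).
    apply graph_mem. exists a, b. split; [exact Ha|split; [|reflexivity]].
    apply (in_exp_vset I (Decl G e1) e2 (a :: g)); [exact Hd| |auto]. now apply HT.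
- apply andb_prop in Hl. destruct Hl as [L1 L2]. destruct HP as [Hs Ht].
  destruct (is_Type_set _ _ _ _ _ _ HI Hs L1 HX Hg) as (S & HS & KS).
  destruct (decl_family _ _ _ _ _ _ _ _ HI HX Hg KS Ht L2) as [T HT].
  exists (repl (opair (numeral 2)) (graph S T)).
  assert (HG : graph S T ∈ V) by (apply univ_graph; auto; intros a Ha; now apply HT).
  split.
  + apply univ_repl; auto. intros p Hp. apply univ_opair; auto using univ_numeral.
    now apply (univ_trans HV) with (graph S T).
  + intros v (a & b & -> & H1 & H2). apply ZF_repl. exists (opair a b).
    split; [|reflexivity]. apply graph_mem.
    apply (in_exp_vset I G e1 g S) in H1; auto.
    apply (in_exp_vset I (Decl G e1) e2 _ (T a)) in H2; auto; [|now apply HT].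
    eauto.
- destruct HP as [Hs _]. destruct (is_Type_set _ _ _ _ _ _ HI Hs Hl HX Hg) as (S & HS & KS).
  exists S. split; [exact HS|]. intros v [Hv _]. now apply (in_exp_vset I G e1 g S).
Qed.

Lemma has_type_pair m I G X u s t g :
  good V m I -> has_type V m I G u (Sum s t) -> ctx_val I G X -> X g ->
  exists a b, exp_val I G u g (Val (vpair a b)).
Proof.
intros HI H HX Hg. destruct (has_type_at V _ _ _ _ _ _ _ (proj1 HI) H HX Hg) as (v & Hv & K).
apply (in_exp_members V m) in K; [|exact HI|reflexivity].
destruct K as (a & b & -> & _). eauto.
Qed.

Lemma has_type_bool m I G X p g :
  good V m I -> has_type V m I G p BoolC -> ctx_val I G X -> X g ->
  exists b, exp_val I G p g (Val (vbool b)).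
Proof.
intros HI H HX Hg. destruct (has_type_at V _ _ _ _ _ _ _ (proj1 HI) H HX Hg) as (v & Hv & K).
apply (in_exp_members V m) in K; [|exact HI|reflexivity].
destruct K as (b & ->). eauto.
Qed.

Lemma bool_of_prop (P : Prop) : exists b, b = true <-> P.
Proof. destruct (classic P); [exists true|exists false]; intuition congruence. Qed.

(** The premise carries the typing that lets the clause produce a value at any environment of the
    context: a pair to project, a truth value to negate, an argument in the domain of the function.
    Definedness thus depends on the premise alone. *)
Lemma value_total m I G X e g :
  good V m I -> ctx_val I G X -> X g -> premise V m I G e -> exists d, value V I G e g d.
Proof.
intros HI HX Hg HP. pose proof (proj1 HI) as Hd.
destruct (type_former e) eqn:He.
{ destruct (members_total m I G X e g HI HX Hg HP He) as [d H]. exists d.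
  now rewrite value_type_former. }
assert (V1 : forall u, set_level u = true -> defined m I G u -> exists a, exp_val I G u g (Val a)).
{ intros u Hl Hu. destruct (defined_at _ _ _ _ _ _ Hd Hu HX Hg) as [d K].
  pose proof (exp_val_level V _ _ _ _ _ _ HI K) as L. rewrite Hl in L. destruct L as [v ->].
    eauto. }
assert (V2 : forall u s, has_type V m I G u s -> exists a, exp_val I G u g (Val a)).
{ intros u s H. destruct (has_type_at V _ _ _ _ _ _ _ Hd H HX Hg) as (a & Ha & _). eauto. }
destruct e; try discriminate; simpl in HP |- *.
- destruct (nth_error g n) as [a|] eqn:E; [eauto|].
  apply nth_error_None in E. rewrite (proj2 (proj2 HI) _ _ _ HX Hg) in E. lia.
- destruct HP as (L1 & L2 & H1 & H2).
  destruct (V1 _ L1 H1) as [a Ha], (V1 _ L2 H2) as [b Hb]. eauto 6.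
- destruct HP as (s & t & H). destruct (has_type_pair _ _ _ _ _ _ _ _ HI H HX Hg) as (a & b & K).
  eauto.
- destruct HP as (s & t & H). destruct (has_type_pair _ _ _ _ _ _ _ _ HI H HX Hg) as (a & b & K).
  eauto.
- destruct HP as [Hs [t Ht]]. pose proof Hs as (L1 & _).
  apply sort_is_Type in Hs; [|exact HI].
  destruct (is_Type_set _ _ _ _ _ _ HI Hs L1 HX Hg) as (S & HS & KS).
  pose proof Ht as (_ & _ & _ & X1 & HX1 & _).
  destruct (choice_on S (fun a b => exp_val I (Decl G e1) e2 (a :: g) (Val b))) as [F HF].
  { intros a Ha. destruct (has_type_at V _ _ _ _ _ _ (a :: g) Hd Ht HX1) as (b & Hb & _); [|eauto].
    apply (ctx_decl V m I G e1 X1 X HI HX1 HX). exists a, g.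
    split; [reflexivity|split; [exact Hg|]]. now apply (in_exp_vset _ _ _ _ S). }
  exists (Val (vfun (repl (fun a => opair a (F a)) S))).
  eexists. split; [|reflexivity]. intros p. rewrite ZF_repl. split.
  + intros (a & Ha & ->). exists a, (F a). split; [now apply (in_exp_vset _ _ _ _ S)|auto].
  + intros (a & b & Ha & Hb & ->). apply (in_exp_vset _ _ _ _ S) in Ha; auto.
    exists a. split; [exact Ha|]. f_equal.
    pose proof (proj2 Hd _ _ _ _ _ Hb (HF a Ha)) as E. now injection E.
- destruct HP as (s & t & Hf & Hu).
  destruct (has_type_at V _ _ _ _ _ _ _ Hd Hf HX Hg) as (h & Hh & Kh).
  destruct (has_type_at V _ _ _ _ _ _ _ Hd Hu HX Hg) as (a & Ha & Ka).
  apply (in_exp_members V m) in Kh; [|exact HI|reflexivity].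
  destruct Kh as (f & -> & _ & H1 & _). apply H1 in Ka. destruct Ka as [b Hb].
  exists (Val b), f, a, b. auto.
- destruct HP as (s & Hu & Hv & _).
  destruct (V2 _ _ Hu) as [a Ha], (V2 _ _ Hv) as [b Hb].
  destruct (bool_of_prop (a = b)) as [c Hc]. exists (Val (vbool c)), a, b, c. auto.
- destruct (bool_of_prop (forall a, in_exp I a G e1 g -> holds I (Decl G e1) e2 (a :: g))) as [c
  Hc].
  eauto.
- destruct (has_type_bool _ _ _ _ _ _ HI HP HX Hg) as [b Hb]. eauto.
- destruct HP as [H1 H2]. destruct (has_type_bool _ _ _ _ _ _ HI H1 HX Hg) as [b Hb].
  destruct (has_type_bool _ _ _ _ _ _ HI H2 HX Hg) as [b' Hb']. eauto 7.
Qed.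

Lemma step_intro m I G X e g d :
  good V m I -> ctx_val I G X -> X g -> premise V m I G e -> value V I G e g d ->
  exp_val (step V m I) G e g d.
Proof.
intros HI HX Hg HP H. split; [eauto|]. apply exp_clause_iff; [|auto].
eapply HI; eassumption.
Qed.

(** A value at one environment certifies the premise; the premise is uniform and yields a value at
    every other environment, at the same stage. *)
Lemma stage_total m n G X e g g' d :
  exp_val (stage V m n) G e g d -> ctx_val (sem V m) G X -> X g' ->
  exists d', exp_val (stage V m n) G e g' d'.
Proof.
destruct n as [|n]; [contradiction|]. intros [(X' & HX' & Hg) H] HX Hg'.
pose proof (stage_good V m n) as HI.
assert (E : X' = X) by (apply (proj1 (sem_det V m) G); [now exists n|exact HX]). subst X'.
apply exp_clause_iff in H; [|eapply HI; eassumption]. destruct H as [HP _].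
destruct (value_total m _ G X e g' HI HX' Hg' HP) as [d' K].
exists d'. now apply (step_intro m _ G X).
Qed.

Lemma exp_val_defined m G e g d :
  in_language m e -> exp_val (sem V m) G e g d -> defined m (sem V m) G e.
Proof.
intros Hl [n H]. split; [exact Hl|].
destruct n as [|n]; [contradiction|]. pose proof H as [(X & HX & Hg) _].
exists X. split; [now exists n|]. intros g' Hg'.
destruct (stage_total m _ _ X _ _ g' _ H) as [d' K]; [now exists n|exact Hg'|].
exists d'. now exists (S n).
Qed.

(** A priori the values at different environments could appear at unbounded stages; [stage_total]
    makes the stage of one of them serve for all. A context without environments is settled as soon
    as its own interpretation is. *)
Lemma defined_stage m G e :
  defined m (sem V m) G e ->
  exists n, forall k, n <= k -> defined m (stage V m k) G e.
Proof.
intros (Hl & X & [a HX] & H).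
destruct (classic (exists g, X g)) as [[g Hg]|HE].
- destruct (H g Hg) as (d & n & Hn). exists (a + n). intros k Hk. split; [exact Hl|].
  exists X. split; [apply (stage_le V m a); [lia|exact HX]|]. intros g' Hg'.
  apply stage_total with X g d; [|now exists a|exact Hg'].
  apply (stage_le V m n); [lia|exact Hn].
- exists a. intros k Hk. split; [exact Hl|]. exists X.
  split; [now apply (stage_le V m a)|]. intros g Hg. destruct HE; eauto.
Qed.

Lemma is_Type_stage m G s :
  is_Type V m (sem V m) G s ->
  exists n, forall k, n <= k -> is_Type V m (stage V m k) G s.
Proof.
intros H. destruct (defined_stage m G s (proj1 H)) as [n Hn]. exists n. intros k Hk.
specialize (Hn k Hk). split; [exact Hn|]. destruct Hn as (_ & X & HX & Hd). exists X.
split; [exact HX|]. intros g Hg. destruct (Hd g Hg) as [d Kd]. exists d. split; [exact Kd|].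
destruct (is_Type_at V _ _ _ _ _ _ (sem_det V m) H (proj1 (stage_le_sem V m k) _ _ HX) Hg) as (d'
  & K & L).
now rewrite (proj2 (sem_det V m) _ _ _ _ _ (proj2 (stage_le_sem V m k) _ _ _ _ Kd) K).
Qed.

Lemma has_type_stage m G u s :
  has_type V m (sem V m) G u s ->
  exists n, forall k, n <= k -> has_type V m (stage V m k) G u s.
Proof.
intros H. pose proof H as (Hl & Hu & Hs & _).
destruct (defined_stage _ _ _ Hu) as [n Hn], (is_Type_stage _ _ _ Hs) as [n' Hn'].
exists (n + n'). intros k Hk. specialize (Hn k ltac:(lia)). specialize (Hn' k ltac:(lia)).
split; [exact Hl|split; [exact Hn|split; [exact Hn'|]]].
pose proof Hn as (_ & X & HX & Hd). exists X. split; [exact HX|]. intros g Hg.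
destruct (Hd g Hg) as [d Kd].
destruct (is_Type_at V _ _ _ _ _ _ (proj1 (stage_good V m k)) Hn' HX Hg) as (d' & Kd' & _).
pose proof (stage_le_sem V m k) as [L1 L2].
destruct (has_type_at V _ _ _ _ _ _ _ (sem_det V m) H (L1 _ _ HX) Hg) as (a & Ha & c & Hc & K).
rewrite (proj2 (sem_det V m) _ _ _ _ _ (L2 _ _ _ _ Kd) Ha) in Kd.
rewrite <- (proj2 (sem_det V m) _ _ _ _ _ (L2 _ _ _ _ Kd') Hc) in K. eauto.
Qed.

Lemma eventually_and (P Q : nat -> Prop) :
  (exists n, forall k, n <= k -> P k) -> (exists n, forall k, n <= k -> Q k) ->
  exists n, forall k, n <= k -> P k /\ Q k.
Proof.
intros [n1 H1] [n2 H2]. exists (n1 + n2). intros k Hk. split; [apply H1|apply H2]; lia.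
Qed.

Lemma premise_stage m G e :
  premise V m (sem V m) G e ->
  exists n, forall k, n <= k -> premise V m (stage V m k) G e.
Proof.
assert (K : forall P : nat -> Prop, (exists n, forall k, n <= k -> P k) ->
  forall Q : nat -> Prop, (forall k, P k -> Q k) -> exists n, forall k, n <= k -> Q k)
  by (intros P [n Hn] Q HPQ; exists n; auto).
destruct e; simpl; intros H; try (exists 0; intros; assumption);
  try (now apply has_type_stage).
- destruct H as (? & ? & H1%defined_stage & H2%defined_stage).
  apply (K _ (eventually_and _ _ H1 H2)). tauto.
- destruct H as (s & t & H%has_type_stage). apply (K _ H). eauto.
- destruct H as (s & t & H%has_type_stage). apply (K _ H). eauto.
- destruct H as (H1%has_type_stage & t & H2%has_type_stage).
  apply (K _ (eventually_and _ _ H1 H2)). intros k []. eauto.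
- destruct H as (s & t & H1%has_type_stage & H2%has_type_stage).
  apply (K _ (eventually_and _ _ H1 H2)). eauto.
- destruct H as (s & H1%has_type_stage & H2%has_type_stage & H3%has_type_stage).
  apply (K _ (eventually_and _ _ H1 (eventually_and _ _ H2 H3))). eauto.
- destruct H as [H1%has_type_stage H2%has_type_stage]. now apply eventually_and.
- destruct H as [H1%has_type_stage H2%has_type_stage]. now apply eventually_and.
- destruct H as [H1%is_Type_stage H2%is_Type_stage]. now apply eventually_and.
- destruct H as [H1%is_Type_stage H2%has_type_stage]. now apply eventually_and.
Qed.

(** The half of the fixed-point equation that rests on closure at finite stages: the premise holds
    at some stage, where [value_total] gives a value, and determinacy identifies that value with
    [d]. *)
Lemma sem_intro m G X e g d :
  ctx_val (sem V m) G X -> X g -> premise V m (sem V m) G e ->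
  value V (sem V m) G e g d -> exp_val (sem V m) G e g d.
Proof.
intros HX Hg HP H. pose proof HX as [a Ha].
destruct (premise_stage _ _ _ HP) as [n Hn]. set (k := a + n).
assert (HXk : ctx_val (stage V m k) G X) by (apply (stage_le V m a); [lia|exact Ha]).
pose proof (Hn k ltac:(lia)) as HPk.
destruct (value_total m _ G X e g (stage_good V m k) HXk Hg HPk) as [d' K].
assert (E : exp_val (sem V m) G e g d').
{ exists (S k). now apply (step_intro m _ G X); [apply stage_good| | | |]. }
replace d with d'; [exact E|].
apply (good_exp V m) in E; [|apply sem_good]. destruct E as (_ & _ & E).
exact (value_det V m _ G X e g d' d (sem_good V m) HX Hg HP E H).
Qed.

Lemma sem_decl m G X s :
  ctx_val (sem V m) G X -> is_Type V m (sem V m) G s ->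
  ctx_val (sem V m) (Decl G s) (decl_env (sem V m) G s X).
Proof.
intros [a Ha] Hs. destruct (is_Type_stage _ _ _ Hs) as [n Hn]. set (k := a + n).
assert (HXk : ctx_val (stage V m k) G X) by (apply (stage_le V m a); [lia|exact Ha]).
specialize (Hn k ltac:(lia)).
exists (S k). split; [exact Hn|]. exists X. split; [exact HXk|]. intros g'. split.
- intros (b & g & -> & Hg & d & Hd & K). exists g, b, d. repeat split; auto.
  destruct (is_Type_at V _ _ _ _ _ _ (proj1 (stage_good V m k)) Hn HXk Hg) as (d' & Kd' & _).
  now rewrite (proj2 (sem_det V m) _ _ _ _ _ Hd (proj2 (stage_le_sem V m k) _ _ _ _ Kd')).
- intros (g & b & d & -> & Hg & Hd & K). exists b, g. repeat split; auto.
  exists d. split; [now exists k|exact K].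
Qed.

Lemma sem_hyp m G X p :
  ctx_val (sem V m) G X -> has_type V m (sem V m) G p BoolC ->
  ctx_val (sem V m) (Hyp G p) (fun g => X g /\ holds (sem V m) G p g).
Proof.
intros [a Ha] Hp. destruct (has_type_stage _ _ _ _ Hp) as [n Hn]. set (k := a + n).
assert (HXk : ctx_val (stage V m k) G X) by (apply (stage_le V m a); [lia|exact Ha]).
specialize (Hn k ltac:(lia)).
exists (S k). split; [exact Hn|]. exists X. split; [exact HXk|]. intros g.
split; intros [Hg H]; (split; [exact Hg|]).
- destruct (has_type_at V _ _ _ _ _ _ _ (proj1 (stage_good V m k)) Hn HXk Hg) as (b & Hb & _).
  unfold holds in *.
  now rewrite (proj2 (sem_det V m) _ _ _ _ _ H (proj2 (stage_le_sem V m k) _ _ _ _ Hb)).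
- now exists k.
Qed.

End FixedPoint.

(** * Substitution *)

Lemma set_level_rename r e : set_level (rename r e) = set_level e.
Proof. revert r. induction e; intros r; simpl; congruence. Qed.

Lemma bij_free_rename r e : bij_free (rename r e) = bij_free e.
Proof. revert r. induction e; intros r; simpl; congruence. Qed.

Lemma set_level_subst f e :
  (forall n, set_level (f n) = true) -> set_level (subst f e) = set_level e.
Proof.
assert (K : forall f, (forall n, set_level (f n) = true) -> forall n, set_level (up f n) = true).
{ intros h H [|n]; [reflexivity|]. simpl. unfold shift. now rewrite set_level_rename. }
revert f. induction e; intros f H; simpl; rewrite ?H, ?IHe, ?IHe1, ?IHe2; auto.
Qed.

Lemma bij_free_subst f e :
  (forall n, bij_free (f n) = true) -> bij_free (subst f e) = bij_free e.
Proof.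
assert (K : forall f, (forall n, bij_free (f n) = true) -> forall n, bij_free (up f n) = true).
{ intros h H [|n]; [reflexivity|]. simpl. unfold shift. now rewrite bij_free_rename. }
revert f. induction e; intros f H; simpl; rewrite ?H, ?IHe, ?IHe1, ?IHe2; auto.
Qed.

Lemma up_Var_comp r : up (fun n => Var (r n)) = fun n => Var (up_ren r n).
Proof. extensionality n. now destruct n. Qed.

Lemma rename_subst r e : rename r e = subst (fun n => Var (r n)) e.
Proof.
revert r. induction e; intros r; simpl; rewrite ?up_Var_comp, ?IHe, ?IHe1, ?IHe2; reflexivity.
Qed.

Lemma subst_comp_rename f r e : subst f (rename r e) = subst (fun n => f (r n)) e.
Proof.
assert (K : forall f r, (fun n => up f (up_ren r n)) = up (fun n => f (r n))).
{ intros h q. extensionality n. now destruct n. }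
revert f r. induction e; intros f r; simpl; rewrite ?IHe, ?IHe1, ?IHe2, ?K; reflexivity.
Qed.

Lemma inst_shift t u : inst (shift t) u = t.
Proof. unfold inst, shift. rewrite subst_comp_rename. apply subst_Var. Qed.

Section Substitution.
Context {U : ZF} {V : U} (HV : grothendieck V).
Notation env := (@env U).

Section Languages.
Context (m m' : language) (Hm : m = Ext -> m' = Ext).
Context (HS : forall G u, has_type V m' (sem V m') G u (sort_S m) ->
  has_type V m' (sem V m') G u (sort_S m')).

(* The class [K] of substitutions is kept abstract because weakening, the case of
   renamings, is needed to push arbitrary substitutions under a binder. *)
Context (K : (nat -> expr) -> Prop).
Context (K_up : forall f, K f -> K (up f)).
Context (K_level : forall f n, K f -> set_level (f n) = true).
Context (K_lang : forall f e, K f -> in_language m e -> in_language m' (subst f e)).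
Context (K_shift : forall f n G s X1 a g d, K f ->
  ctx_val (sem V m') (Decl G s) X1 -> X1 (a :: g) ->
  exp_val (sem V m') G (f n) g d -> exp_val (sem V m') (Decl G s) (shift (f n)) (a :: g) d).

(** The induction is on the stage at which the source expression is defined. Structural induction
    would not reach the auxiliary types in the premises, which are not subexpressions of [e] but are
    defined at the previous stage. *)
Lemma stage_subst n : forall G G' X X' f th,
  K f -> ctx_val (sem V m) G X -> ctx_val (sem V m') G' X' ->
  (forall g, X' g -> X (th g) /\
     forall k a, nth_error (th g) k = Some a -> exp_val (sem V m') G' (f k) g (Val a)) ->
  forall e g d, X' g -> defined m (stage V m n) G e -> exp_val (sem V m) G e (th g) d ->
    exp_val (sem V m') G' (subst f e) g d.
Proof.
induction n as [|n IH]; intros G G' X X' f th Kf HX HX' Hth e g d Hg He Hd.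
{ destruct He as (_ & ? & [] & _). }
destruct (classic (exists k, e = Var k)) as [[k ->]|Hv].
{ apply (good_exp V m) in Hd; [|apply sem_good]. destruct Hd as (_ & _ & a & Ha & ->).
  simpl. now apply Hth. }
assert (Hv' : forall n, e <> Var n) by (intros i ->; eauto).
pose proof (stage_good V m n) as HI. pose proof (stage_le_sem V m n) as [L1 L2].
assert (HXn : ctx_val (stage V m (S n)) G X).
{ destruct He as (_ & Y & HY & _). replace X with Y; [exact HY|].
  apply (proj1 (sem_det V m) G); [now exists (S n)|exact HX]. }
destruct (defined_at _ _ _ _ _ (th g) (proj1 (stage_good V m (S n))) He HXn) as [d' Hd'];
  [now apply Hth|].
assert (E : d = d').
{ apply (proj2 (sem_det V m) _ _ _ _ _ Hd). now exists (S n). }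
subst d'. clear Hd HXn. destruct Hd' as [(Y & HXn & _) HC].
assert (E : Y = X) by (apply (proj1 (sem_det V m) G); [now exists n|exact HX]). subst Y.
apply exp_clause_iff in HC; [|eapply HI; [exact HXn|now apply Hth]]. destruct HC as [HP HC].
assert (T : transfer m m' (stage V m n) (sem V m') f G G' X X' th).
{ split; auto.
  - intros g' Hg'. now apply Hth.
  - intros e'. apply set_level_subst. auto.
  - intros e' g' d' Hg' He' Hd'. apply (IH G G' X X' f th); auto. }
assert (HB : forall s X1, ctx_val (stage V m n) (Decl G s) X1 -> exists X1',
  transfer m m' (stage V m n) (sem V m') (up f) (Decl G s) (Decl G' (subst f s)) X1 X1' (up_env
    th) /\
  forall a g, X' g -> in_exp (stage V m n) a G s (th g) -> X1' (a :: g)).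
{ intros s X1 HX1. destruct (ctx_decl V m _ _ _ _ _ HI HX1 HXn) as [Hs H1].
  pose proof (tr_is_Type V T (proj1 HI) _ Hs) as Hs'.
  pose proof (sem_decl HV m' G' X' _ HX' Hs') as HX1'.
  exists (decl_env (sem V m') G' (subst f s) X'). split.
  - assert (Henv : forall g, decl_env (sem V m') G' (subst f s) X' g ->
      X1 (up_env th g) /\ forall k a, nth_error (up_env th g) k = Some a ->
        exp_val (sem V m') (Decl G' (subst f s)) (up f k) g (Val a)).
    { intros g' Kg'. pose proof Kg' as (a & h & -> & Hh & Ha). split.
      - apply H1. exists a, (th h). split; [reflexivity|split; [now apply Hth|]].
        apply (tr_in_exp T (proj1 HI) (sem_det V m')); auto. apply Hs.
      - intros [|k] b Hb.
        + apply (sem_intro HV m' _ _ _ _ _ HX1' Kg'); [simpl; lia|].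
          exists b. split; [exact Hb|reflexivity].
        + simpl. apply (K_shift f k _ _ _ a h _ Kf HX1' Kg'). now apply Hth. }
    split; auto.
    + intros g' Hg'. now apply Henv.
    + intros e'. apply set_level_subst. auto.
    + intros e' g' d' Hg' He' Hd'.
      apply (IH (Decl G s) (Decl G' (subst f s)) X1
        (decl_env (sem V m') G' (subst f s) X') (up f) (up_env th)); auto.
  - intros a g' Hg' Ha. exists a, g'. split; [reflexivity|split; [exact Hg'|]].
    apply (tr_in_exp T (proj1 HI) (sem_det V m')); auto. apply Hs. }
apply (sem_intro HV m' G' X'); auto.
- apply (premise_transfer V T HI HB Hm HS); auto.
- apply (value_transfer V T HI (sem_det V m') HB); auto.
Qed.

Lemma sem_subst_transfer G G' X X' f th :
  K f -> ctx_val (sem V m) G X -> ctx_val (sem V m') G' X' ->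
  (forall g, X' g -> X (th g) /\
     forall k a, nth_error (th g) k = Some a -> exp_val (sem V m') G' (f k) g (Val a)) ->
  transfer m m' (sem V m) (sem V m') f G G' X X' th.
Proof.
intros Kf HX HX' Hth. split; auto.
- intros g Hg. now apply Hth.
- intros e. apply set_level_subst. auto.
- intros e g d Hg He Hd. destruct (defined_stage HV m G e He) as [n Hn].
  apply (stage_subst n G G' X X' f th); auto.
Qed.

End Languages.

Lemma sem_var m G X n g a :
  ctx_val (sem V m) G X -> X g -> nth_error g n = Some a ->
  exp_val (sem V m) G (Var n) g (Val a).
Proof.
intros HX Hg H. apply (sem_intro HV m G X); auto.
- simpl. rewrite <- (proj2 (proj2 (sem_good V m)) _ _ _ HX Hg).
  apply nth_error_Some. congruence.
- exists a. auto.
Qed.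

Definition renaming (f : nat -> expr) : Prop := exists r, f = fun n => Var (r n).

Lemma renaming_transfer m m' G G' X X' r th :
  (m = m' \/ m = Base) ->
  (forall G u, has_type V m' (sem V m') G u (sort_S m) ->
     has_type V m' (sem V m') G u (sort_S m')) ->
  ctx_val (sem V m) G X -> ctx_val (sem V m') G' X' ->
  (forall g, X' g -> X (th g) /\
     forall k a, nth_error (th g) k = Some a -> nth_error g (r k) = Some a) ->
  transfer m m' (sem V m) (sem V m') (fun n => Var (r n)) G G' X X' th.
Proof.
intros Hm HS HX HX' Hth. apply (sem_subst_transfer m m') with (K := renaming); auto.
- destruct Hm; congruence.
- intros f [q ->]. exists (up_ren q). apply up_Var_comp.
- intros f n [q ->]. reflexivity.
- intros f e [q ->]. destruct m, m'; simpl; auto; [now rewrite bij_free_subst|].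
  destruct Hm; discriminate.
- intros f n H s X1 a g d [q ->] HX1 Hg Hd.
  apply (good_exp V m') in Hd; [|apply sem_good]. destruct Hd as (_ & _ & b & Hb & ->).
  apply (sem_var m' _ X1); auto.
- now exists r.
- intros g Hg. split; [now apply Hth|]. intros k a Ha. apply (sem_var m' _ X'); auto.
  now apply Hth.
Qed.

Lemma shift_transfer m G X s X1 :
  ctx_val (sem V m) G X -> ctx_val (sem V m) (Decl G s) X1 ->
  transfer m m (sem V m) (sem V m) (fun n => Var (S n)) G (Decl G s) X X1 (@tl U).
Proof.
intros HX HX1. apply renaming_transfer; auto.
intros g Hg. apply (ctx_decl V m _ G s X1 X (sem_good V m) HX1 HX) in Hg.
destruct Hg as (a & h & -> & Hh & _). auto.
Qed.

Lemma inst_transfer m G X s X1 u a :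
  ctx_val (sem V m) G X -> ctx_val (sem V m) (Decl G s) X1 ->
  has_type V m (sem V m) G u s ->
  (forall g, X g -> exp_val (sem V m) G u g (Val (a g))) ->
  transfer m m (sem V m) (sem V m) (fun n => match n with O => u | S n => Var n end)
    (Decl G s) G X1 X (fun g => a g :: g).
Proof.
intros HX HX1 Hu Ha.
apply (sem_subst_transfer m m)
  with (K := fun f => (forall n, set_level (f n) = true) /\ forall n, in_language m (f n)); auto.
- intros f [H H']. split; intros [|n]; simpl; auto.
  + unfold shift. now rewrite set_level_rename.
  + now destruct m.
  + specialize (H' n). unfold shift. destruct m; simpl in *; auto. now rewrite bij_free_rename.
- intros f n [H _]. auto.
- intros f e [_ H]. destruct m; simpl in *; auto. now rewrite bij_free_subst.
- intros f n G0 s0 Y b g d [_ H] HY Hg Hd. unfold shift. rewrite rename_subst.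
  pose proof Hd as Hd'. apply (good_exp V m) in Hd'; [|apply sem_good].
  destruct Hd' as ((Y0 & HY0 & _) & _).
  apply (tr_val (shift_transfer m _ _ _ _ HY0 HY)); auto.
  apply (exp_val_defined HV m _ _ g d); auto.
- split; intros [|n]; simpl; auto; try apply Hu. now destruct m.
- intros g Hg. split.
  + apply (ctx_decl V m _ G s X1 X (sem_good V m) HX1 HX). exists (a g), g.
    split; [reflexivity|split; [exact Hg|]].
    apply (has_type_val V m _ _ X u _ _ _ (sem_det V m)); auto.
  + intros [|k] b Hb; simpl in *.
    * injection Hb as <-. auto.
    * apply (sem_var m _ X); auto.
Qed.

End Substitution.

(** * Relabelling the leaves of a value *)

Section Relabelling.
Context {U : ZF}.

(** The components of a tagged value lie several memberships below it, so recursion over values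
    follows the transitive closure of membership. *)
Definition below : U -> U -> Prop := clos_trans U mem.

Lemma below_wf : well_founded below.
Proof. apply wf_clos_trans, ZF_found. Qed.

Lemma below_mem (x y : U) : x ∈ y -> below x y.
Proof. apply t_step. Qed.

Lemma below_trans (x y z : U) : below x y -> below y z -> below x z.
Proof. apply t_trans. Qed.

Lemma below_opair_l (a b : U) : below a (opair a b).
Proof.
apply below_trans with (upair a a); apply below_mem; apply ZF_upair; auto.
Qed.

Lemma below_opair_r (a b : U) : below b (opair a b).
Proof.
apply below_trans with (upair a b); apply below_mem; apply ZF_upair; auto.
Qed.

Lemma below_irrefl (x : U) : ~ below x x.
Proof.
induction (below_wf x) as [x _ IH]. intros H. exact (IH x H H).
Qed.

Definition is_leaf (w : U) : Prop :=
  (exists x, w = vatom x) \/ (exists x y, w = visopair x y).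

Definition map_opair (h : U -> U) (p : U) : U :=
  epsilon (inhabits empty) (fun q => exists a b, p = opair a b /\ q = opair (h a) (h b)).

Definition map_graph (h : U -> U) (f : U) : U :=
  repl (map_opair h) (sep (fun p => exists a b, p = opair a b) f).

Lemma map_opair_opair h a b : map_opair h (opair a b) = opair (h a) (h b).
Proof.
unfold map_opair.
destruct (epsilon_spec (inhabits (@empty U)) (fun q => exists a' b',
  opair a b = opair a' b' /\ q = opair (h a') (h b'))) as (a' & b' & E & ->); [eauto|].
apply opair_inj in E. now destruct E; subst.
Qed.

Lemma mem_map_graph h f p :
  p ∈ map_graph h f <-> exists a b, opair a b ∈ f /\ p = opair (h a) (h b).
Proof.
unfold map_graph. rewrite ZF_repl. split.
- intros (q & Hq & ->). apply ZF_sep in Hq. destruct Hq as (Hq & a & b & ->).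
  exists a, b. now rewrite map_opair_opair.
- intros (a & b & H & ->). exists (opair a b). rewrite map_opair_opair.
  split; [|reflexivity]. apply ZF_sep. eauto.
Qed.

(** Atoms and iso-pairs are the leaves: a labelling replaces them as a whole and does not enter the
    components of an iso-pair. The cases form a relation that is resolved by choice, since there is
    no matching on tags; on sets of none of these forms the result is arbitrary. *)
Definition vmap_clause (lam h : U -> U) (w r : U) : Prop :=
  (is_leaf w /\ r = lam w) \/
  (exists b, w = vbool b /\ r = w) \/
  (exists x y, w = vpair x y /\ r = vpair (h x) (h y)) \/
  (exists f, w = vfun f /\ r = vfun (map_graph h f)) \/
  (exists s, w = vset s /\ r = vset (repl h s)).

Definition vmap_step (lam h : U -> U) (w : U) : U :=
  epsilon (inhabits empty) (vmap_clause lam h w).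

Definition vmap (lam : U -> U) : U -> U :=
  Fix below_wf (fun _ => U) (fun w rec =>
    vmap_step lam (fun y => match excluded_middle_informative (below y w) with
                            | left p => rec y p
                            | right _ => empty
                            end) w).

(** Only components strictly below [w] are consulted, which is what the recursion equation of [vmap]
    depends on. *)
Lemma vmap_clause_local lam h h' w r :
  (forall y, below y w -> h y = h' y) -> vmap_clause lam h w r -> vmap_clause lam h' w r.
Proof.
intros H [K|[K|[(x & y & -> & ->)|[(f & -> & ->)|(s & -> & ->)]]]]; unfold vmap_clause.
- auto.
- auto.
- right; right; left. exists x, y. split; [reflexivity|].
  rewrite !H; [reflexivity| |].
  + eapply below_trans; [apply below_opair_r|apply below_opair_r].
  + eapply below_trans; [apply below_opair_l|apply below_opair_r].
- right; right; right; left. exists f. split; [reflexivity|]. f_equal.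
  apply ZF_ext. intros p. rewrite !mem_map_graph.
  assert (K : forall a b, opair a b ∈ f -> h a = h' a /\ h b = h' b).
  { intros a b Hab. assert (L : below (opair a b) (vfun f)).
    { eapply below_trans; [apply below_mem, Hab|apply below_opair_r]. }
    split; apply H; (eapply below_trans; [|exact L]);
      [apply below_opair_l|apply below_opair_r]. }
  split; intros (a & b & Hab & ->); exists a, b; (split; [exact Hab|]);
    destruct (K a b Hab); congruence.
- right; right; right; right. exists s. split; [reflexivity|]. f_equal.
  apply ZF_ext. intros p. rewrite !ZF_repl.
  assert (K : forall a, a ∈ s -> h a = h' a).
  { intros a Ha. apply H. eapply below_trans; [apply below_mem, Ha|apply below_opair_r]. }
  split; intros (a & Ha & ->); exists a; (split; [exact Ha|]).
  + now apply K.
  + symmetry. now apply K.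
Qed.

Lemma vmap_unfold lam w : vmap lam w = vmap_step lam (vmap lam) w.
Proof.
unfold vmap at 1. rewrite Fix_eq; fold (vmap lam).
- unfold vmap_step. f_equal. extensionality r. apply propositional_extensionality.
  split; apply vmap_clause_local; intros y Hy;
    destruct (excluded_middle_informative (below y w)); tauto.
- intros x f g H. f_equal. extensionality y.
  destruct (excluded_middle_informative (below y x)); auto.
Qed.

Lemma vmap_spec lam w : (exists r, vmap_clause lam (vmap lam) w r) ->
  vmap_clause lam (vmap lam) w (vmap lam w).
Proof. intros H. rewrite vmap_unfold. unfold vmap_step. apply epsilon_spec, H. Qed.

Ltac solve_vmap :=
  match goal with
  | |- vmap ?lam ?w = ?r =>
      let H := fresh in
      assert (H : vmap_clause lam (vmap lam) w (vmap lam w));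
      [apply vmap_spec; exists r; unfold vmap_clause, is_leaf; eauto 10|
       destruct H as [[[[? H]|(? & ? & H)] K]|[(? & H & K)|[(? & ? & H & K)|[(? & H & K)|(? & H &
         K)]]]];
       try tag_clash]
  end.

Lemma vmap_atom lam x : vmap lam (vatom x) = lam (vatom x).
Proof. solve_vmap. exact K. Qed.

Lemma vmap_isopair lam x y : vmap lam (visopair x y) = lam (visopair x y).
Proof. solve_vmap. exact K. Qed.

Lemma vmap_bool lam b : vmap lam (vbool b) = vbool b.
Proof. solve_vmap. exact K. Qed.

Lemma vmap_pair lam x y : vmap lam (vpair x y) = vpair (vmap lam x) (vmap lam y).
Proof. solve_vmap. apply vpair_inj in H. destruct H; subst. exact K. Qed.

Lemma vmap_fun lam f : vmap lam (vfun f) = vfun (map_graph (vmap lam) f).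
Proof. solve_vmap. apply vfun_inj in H. subst. exact K. Qed.

Lemma vmap_set lam s : vmap lam (vset s) = vset (repl (vmap lam) s).
Proof. solve_vmap. apply vset_inj in H. subst. exact K. Qed.

Definition leaf_proj (i : side) (w : U) : U :=
  epsilon (inhabits empty) (fun r => (exists x, w = vatom x /\ r = w) \/
    (exists x y, w = visopair x y /\ r = match i with Left => x | Right => y end)).

(** With the projections written as relabellings, a projection after a labelling is again a
    relabelling by [vmap_comp], so equality of projections can be studied on the atoms. *)
Definition vproj (i : side) : U -> U := vmap (leaf_proj i).

Lemma vproj_atom i x : vproj i (vatom x) = vatom x.
Proof.
unfold vproj, leaf_proj. rewrite vmap_atom.
destruct (epsilon_spec (inhabits (@empty U)) (fun r => (exists x', vatom x = vatom x' /\ r =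
  vatom x) \/
  (exists x' y, vatom x = visopair x' y /\ r = match i with Left => x' | Right => y end)))
  as [(x' & E & K)|(x' & y & E & K)]; [eauto|exact K|tag_clash].
Qed.

Lemma vproj_isopair i x y :
  vproj i (visopair x y) = match i with Left => x | Right => y end.
Proof.
unfold vproj, leaf_proj. rewrite vmap_isopair.
destruct (epsilon_spec (inhabits (@empty U)) (fun r =>
  (exists x', visopair x y = vatom x' /\ r = visopair x y) \/
  (exists x' y', visopair x y = visopair x' y' /\ r = match i with Left => x' | Right => y' end)))
  as [(x' & E & K)|(x' & y' & E & K)]; [eauto 6|tag_clash|].
apply visopair_inj in E. destruct E; subst. exact K.
Qed.

End Relabelling.

(** * Projections and bijectivity of values *)

Section ValueUniverse.
Context {U : ZF} {V : U} (HV : grothendieck V).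

(** By replacement, the graph being the image of its domain. Bijective functions and the values of
    abstractions are not placed in [V] by definition; this puts them there. *)
Lemma univ_function (f s : U) :
  is_function f -> is_domain f s -> s ∈ V ->
  (forall a b, opair a b ∈ f -> b ∈ V) -> f ∈ V.
Proof.
intros [H1 H2] Hs HsV Hb.
destruct (choice_on s (fun a b => opair a b ∈ f)) as [F HF]; [intros a Ha; now apply Hs|].
apply (univ_sub HV) with (repl (fun a => opair a (F a)) s).
- apply (univ_repl HV); [exact HsV|]. intros a Ha.
  apply (univ_opair HV); [now apply (univ_trans HV) with s|eauto].
- intros p Hp. destruct (H1 p Hp) as (a & b & ->). apply ZF_repl. exists a.
  assert (Ha : a ∈ s) by (apply Hs; eauto). split; [exact Ha|]. f_equal. eauto.
Qed.

Lemma graph_domain (f : U) : f ∈ V ->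
  exists s, s ∈ V /\ forall a, a ∈ s <-> exists b, opair a b ∈ f.
Proof.
intros Hf. apply (univ_collect HV) with (union (union f)).
- now repeat apply (univ_union HV).
- intros a [b H]. apply ZF_union. exists (upair a a). split; [|apply ZF_upair; auto].
  apply ZF_union. exists (opair a b). split; [exact H|]. apply ZF_upair; auto.
Qed.

Lemma univ_map_graph h f : f ∈ V ->
  (forall a b, opair a b ∈ f -> h a ∈ V) -> (forall a b, opair a b ∈ f -> h b ∈ V) ->
  map_graph h f ∈ V.
Proof.
intros Hf Ha Hb. unfold map_graph. apply (univ_repl HV).
- apply (univ_sub HV) with f; [exact Hf|]. intros p Hp. now apply ZF_sep in Hp.
- intros p Hp. apply ZF_sep in Hp. destruct Hp as (Hp & a & b & ->).
  rewrite map_opair_opair. apply (univ_opair HV); eauto.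
Qed.

Lemma basic_univ w : basic V w -> w ∈ V.
Proof.
induction 1.
- now apply univ_vatom.
- now apply univ_vbool.
- now apply univ_vpair.
- now apply univ_vfun.
- now apply univ_vset.
Qed.

Lemma bijective_univ w : bijective V w -> w ∈ V.
Proof.
induction 1.
- now apply univ_vatom.
- now apply univ_vbool.
- apply univ_visopair; auto using basic_univ.
- now apply univ_vpair.
- apply univ_vfun; [exact HV|]. apply univ_function with s; auto.
  now apply bijective_vset_inv in H1.
- now apply univ_vset.
Qed.

Lemma bijective_extended w : bijective V w -> extended V w.
Proof. induction 1; econstructor; eauto. Qed.

Lemma vproj_proj i w : extended V w -> proj V i w (vproj i w).
Proof.
induction 1.
- rewrite vproj_atom. now constructor.
- unfold vproj. rewrite vmap_bool. constructor.
- unfold vproj. rewrite vmap_pair. now constructor.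
- unfold vproj. rewrite vmap_fun.
  apply proj_fun with (vproj i); auto. intros p. apply mem_map_graph.
- unfold vproj. rewrite vmap_set. now apply proj_set.
- rewrite vproj_isopair. now constructor.
Qed.

(** Between $L(s)$ and $R(s)$ the relation made of the pairs of projections is always total and
    onto. What bijectivity adds is that it is single-valued in both directions, that is, that the
    two projections have the same kernel on [s]. Each of them may still identify distinct
    elements. *)
Lemma bijective_vset (s : U) :
  bijective V (vset s) <-> s ∈ V /\ (forall x, x ∈ s -> bijective V x) /\
    forall x y, x ∈ s -> y ∈ s -> vproj Left x = vproj Left y <-> vproj Right x = vproj Right y.
Proof.
assert (P : forall i, s ∈ V -> (forall x, x ∈ s -> bijective V x) ->
  proj V i (vset s) (vset (repl (vproj i) s))).
{ intros i Hs Hx. apply proj_set; [exact Hs|]. intros x Hxs.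
  now apply vproj_proj, bijective_extended, Hx. }
split.
- intros H. apply bijective_vset_inv in H. destruct H as (Hs & Hx & A & B & r & HA & HB & Hr & Hf
  & _ & _ & Hi).
  split; [exact Hs|split; [exact Hx|]]. intros x y Hxs Hys.
  assert (K : forall z, z ∈ s -> opair (vproj Left z) (vproj Right z) ∈ r).
  { intros z Hz. apply Hr. exists z, (vproj Left z), (vproj Right z).
    assert (extended V z) by now apply bijective_extended, Hx.
    repeat split; auto using vproj_proj. }
  pose proof (K x Hxs) as Kx. pose proof (K y Hys) as Ky. split; intros E.
  + rewrite E in Kx. eapply Hf; eassumption.
  + rewrite E in Kx. eapply Hi; eassumption.
- intros (Hs & Hx & H). constructor; [exact Hs|exact Hx|].
  exists (repl (vproj Left) s), (repl (vproj Right) s),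
    (repl (fun z => opair (vproj Left z) (vproj Right z)) s).
  assert (Hr : forall a b, opair a b ∈ repl (fun z => opair (vproj Left z) (vproj Right z)) s <->
    exists z, z ∈ s /\ a = vproj Left z /\ b = vproj Right z).
  { intros a b. rewrite ZF_repl. split.
    - intros (z & Hz & E). apply opair_inj in E. exists z. tauto.
    - intros (z & Hz & -> & ->). eauto. }
  split; [auto|split; [auto|split; [|split; [|split; [|split]]]]].
  + intros p. rewrite ZF_repl. split.
    * intros (z & Hz & ->). exists z, (vproj Left z), (vproj Right z).
      assert (extended V z) by now apply bijective_extended, Hx.
      repeat split; auto using vproj_proj.
    * intros (z & a & b & Hz & Ha & Hb & ->). exists z. split; [exact Hz|].
      assert (extended V z) by now apply bijective_extended, Hx.
      f_equal; eapply proj_functional; eauto using vproj_proj.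
  + split.
    * intros p Hp. apply ZF_repl in Hp. destruct Hp as (z & _ & ->). eauto.
    * intros a b b' Hb Hb'. apply Hr in Hb, Hb'.
      destruct Hb as (z & Hz & -> & ->), Hb' as (z' & Hz' & E & ->). now apply H.
  + intros a. rewrite ZF_repl. split.
    * intros (z & Hz & ->). exists (vproj Right z). apply Hr. eauto.
    * intros [b Hb]. apply Hr in Hb. destruct Hb as (z & Hz & -> & _). eauto.
  + intros a. rewrite ZF_repl. split.
    * intros (z & Hz & ->). exists (vproj Left z). apply Hr. eauto.
    * intros [b Hb]. apply Hr in Hb. destruct Hb as (z & Hz & _ & ->). eauto.
  + intros a a' b Hb Hb'. apply Hr in Hb, Hb'.
    destruct Hb as (z & Hz & -> & ->), Hb' as (z' & Hz' & -> & E). now apply H.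
Qed.

Lemma vmap_basic_id lam w :
  (forall x, x ∈ V -> lam (vatom x) = vatom x) -> basic V w -> vmap lam w = w.
Proof.
intros Hl. induction 1 as [x Hx|b|x y _ IHx _ IHy|f Hf Hfun _ IH1 _ IH2|s Hs _ IH].
- rewrite vmap_atom. auto.
- apply vmap_bool.
- rewrite vmap_pair. congruence.
- rewrite vmap_fun. f_equal. apply ZF_ext. intros p. rewrite mem_map_graph. split.
  + intros (a & b & H & ->). rewrite (IH1 _ _ H), (IH2 _ _ H). exact H.
  + intros Hp. destruct (proj1 Hfun p Hp) as (a & b & ->). exists a, b.
    split; [exact Hp|]. now rewrite (IH1 _ _ Hp), (IH2 _ _ Hp).
- rewrite vmap_set. f_equal. apply ZF_ext. intros p. rewrite ZF_repl. split.
  + intros (a & H & ->). now rewrite (IH _ H).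
  + intros Hp. exists p. split; [exact Hp|]. now rewrite (IH _ Hp).
Qed.

Lemma vproj_basic i w : basic V w -> vproj i w = w.
Proof.
apply vmap_basic_id. intros x _. rewrite <- (vmap_atom (leaf_proj i)). apply vproj_atom.
Qed.

(** Both projections fix basic values, so on a basic set both kernels are equality. *)
Lemma basic_bijective w : basic V w -> bijective V w.
Proof.
assert (K : forall s, s ∈ V -> (forall x, x ∈ s -> basic V x) ->
  (forall x, x ∈ s -> bijective V x) -> bijective V (vset s)).
{ intros s Hs Hb Hx. apply bijective_vset. repeat split; auto;
    rewrite !vproj_basic; auto. }
induction 1.
- now constructor.
- constructor.
- now constructor.
- destruct (graph_domain f H) as (s & Hs & Hd).
  apply bijective_fun with s; auto. apply K; auto.
  + intros x Hx. apply Hd in Hx. destruct Hx as [b Hx]. eauto.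
  + intros x Hx. apply Hd in Hx. destruct Hx as [b Hx]. eauto.
- auto.
Qed.

Lemma basic_vpair_inv (x y : U) : basic V (vpair x y) -> basic V x /\ basic V y.
Proof.
intros H. inversion H as [z Hx E|b E|z t Hx Hy E|f Hf H1 H2 H3 E|s' Hs Hx E]; try tag_clash.
apply vpair_inj in E. now destruct E; subst.
Qed.

Lemma basic_vfun_inv (f : U) : basic V (vfun f) ->
  f ∈ V /\ is_function f /\ forall a b, opair a b ∈ f -> basic V a /\ basic V b.
Proof.
intros H. inversion H as [z Hx E|b E|z t Hx Hy E|f' Hf H1 H2 H3 E|s' Hs Hx E]; try tag_clash.
apply vfun_inj in E. subst. split; [exact Hf|split; [exact H1|]].
intros a b Hab. split; eauto.
Qed.

End ValueUniverse.

(** * Shapes and labellings *)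

(* Simple types over base sorts, a sort being a set of atoms. *)
Inductive shape {U : ZF} : Type :=
| Sbool
| Ssort (k : U)
| Spair (c d : shape)
| Sarr (c d : shape)
| Sset (c : shape).

Section Shapes.
Context {U : ZF} {V : U} (HV : grothendieck V).
Notation shape := (@shape U).

(* [Sarr] allows arbitrary relations: relabelling may destroy single-valuedness. *)
Fixpoint fits (c : shape) (v : U) : Prop :=
  match c with
  | Sbool => exists b, v = vbool b
  | Ssort k => v ∈ k
  | Spair c d => exists a b, v = vpair a b /\ fits c a /\ fits d b
  | Sarr c d => exists f, v = vfun f /\ f ∈ V /\
      forall p, p ∈ f -> exists a b, p = opair a b /\ fits c a /\ fits d b
  | Sset c => exists s, v = vset s /\ s ∈ V /\ forall a, a ∈ s -> fits c a
  end.

Fixpoint over (L : list U) (c : shape) : Prop :=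
  match c with
  | Sbool => True
  | Ssort k => In k L
  | Spair c d | Sarr c d => over L c /\ over L d
  | Sset c => over L c
  end.

Definition sort_atoms (L : list U) : Prop :=
  forall k, In k L -> k ∈ V /\ forall x, x ∈ k -> exists y, y ∈ V /\ x = vatom y.

Definition sval (m : language) : U -> Prop :=
  match m with Base => basic V | Ext => bijective V end.

(** Injectivity is asked within each sort, and atoms of different sorts may share a label. For [Ext]
    the second condition gives the two projections equal kernels on each labelled sort, which
    [vproj_vmap_kernel] spreads to all shapes. *)
Definition good_label (m : language) (lam : U -> U) (L : list U) : Prop :=
  forall k, In k L ->
    (forall x y, x ∈ k -> y ∈ k -> lam x = lam y -> x = y) /\ sval m (vset (repl lam k)).

Lemma sval_univ m w : sval m w -> w ∈ V.
Proof. destruct m; [apply basic_univ|apply bijective_univ]; exact HV. Qed.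

Lemma sval_basic m w : basic V w -> sval m w.
Proof. destruct m; [auto|apply basic_bijective, HV]. Qed.

Lemma sval_vset_inv m (s : U) : sval m (vset s) -> s ∈ V /\ forall x, x ∈ s -> sval m x.
Proof.
destruct m; simpl.
- apply basic_vset_inv.
- intros H. apply bijective_vset_inv in H. tauto.
Qed.

Lemma over_incl L L' c : incl L L' -> over L c -> over L' c.
Proof. intros H. induction c; simpl; intuition. Qed.

Section Labels.
Context {L : list U} (HL : sort_atoms L).

Lemma sort_atom k x : In k L -> x ∈ k -> exists y, y ∈ V /\ x = vatom y.
Proof. intros Hk. now apply HL. Qed.

Lemma vmap_sort lam k x : In k L -> x ∈ k -> vmap lam x = lam x.
Proof. intros Hk Hx. destruct (sort_atom k x Hk Hx) as (y & _ & ->). apply vmap_atom. Qed.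

Lemma vmap_agree lam mu c v :
  over L c -> (forall k x, In k L -> x ∈ k -> lam x = mu x) -> fits c v ->
  vmap lam v = vmap mu v.
Proof.
intros Hc E. revert v. induction c as [|k|c IHc d IHd|c IHc d IHd|c IHc]; simpl in *.
- intros v [b ->]. now rewrite !vmap_bool.
- intros v Hv. rewrite !(vmap_sort _ k v); eauto.
- intros v (a & b & -> & Ha & Hb). rewrite !vmap_pair. f_equal; intuition.
- intros v (f & -> & _ & Hf). rewrite !vmap_fun. f_equal. apply ZF_ext. intros p.
  rewrite !mem_map_graph.
  split; intros (a & b & H & ->); exists a, b; (split; [exact H|]);
    destruct (Hf _ H) as (a' & b' & E' & Ha & Hb); apply opair_inj in E';
    destruct E'; subst a' b'; destruct Hc; f_equal; auto; symmetry; auto.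
- intros v (s & -> & _ & Hs). rewrite !vmap_set. f_equal. apply ZF_ext. intros p.
  rewrite !ZF_repl. split; intros (a & H & ->); exists a; (split; [exact H|]); auto.
  symmetry. auto.
Qed.

Lemma vmap_comp lam mu c v : over L c -> fits c v ->
  vmap mu (vmap lam v) = vmap (fun x => vmap mu (lam x)) v.
Proof.
intros Hc. revert v. induction c as [|k|c IHc d IHd|c IHc d IHd|c IHc]; simpl in *.
- intros v [b ->]. now rewrite !vmap_bool.
- intros v Hv. now rewrite !(vmap_sort _ k v).
- intros v (a & b & -> & Ha & Hb). rewrite !vmap_pair. f_equal; intuition.
- intros v (f & -> & _ & Hf). rewrite !vmap_fun. f_equal. apply ZF_ext. intros p.
  rewrite !mem_map_graph. split.
  + intros (a' & b' & H & ->). apply mem_map_graph in H. destruct H as (a & b & H & E).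
    apply opair_inj in E. destruct E; subst. exists a, b. split; [exact H|].
    destruct (Hf _ H) as (a' & b' & E' & Ha & Hb); apply opair_inj in E'.
    destruct E'; subst a' b'. f_equal; intuition.
  + intros (a & b & H & ->). exists (vmap lam a), (vmap lam b).
    split; [apply mem_map_graph; eauto|].
    destruct (Hf _ H) as (a' & b' & E' & Ha & Hb); apply opair_inj in E'.
    destruct E'; subst a' b'. f_equal; symmetry; intuition.
- intros v (s & -> & _ & Hs). rewrite !vmap_set. f_equal. apply ZF_ext. intros p.
  rewrite !ZF_repl. split.
  + intros (a' & H & ->). apply ZF_repl in H. destruct H as (a & H & ->). exists a. auto.
  + intros (a & H & ->). exists (vmap lam a). rewrite ZF_repl.
    split; [eauto|]. symmetry. auto.
Qed.

(** Two values of one shape are compared component by component until atoms of a common sort meet,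
    so an inclusion of kernels on the sorts propagates to the shape. This is the purpose of shapes:
    without a common one, an atom labelled by a pair could be confused with a pair of labelled
    atoms. Comparison with the identity labelling gives injectivity. *)
Lemma vmap_kernel lam mu c v w :
  over L c ->
  (forall k x y, In k L -> x ∈ k -> y ∈ k -> lam x = lam y -> mu x = mu y) ->
  fits c v -> fits c w -> vmap lam v = vmap lam w -> vmap mu v = vmap mu w.
Proof.
intros Hc E. revert v w. induction c as [|k|c IHc d IHd|c IHc d IHd|c IHc]; simpl in *.
- intros v w [b ->] [b' ->]. now rewrite !vmap_bool.
- intros v w Hv Hw. rewrite !(vmap_sort _ k v), !(vmap_sort _ k w) by auto. eauto.
- intros v w (a & b & -> & Ha & Hb) (a' & b' & -> & Ha' & Hb'). rewrite !vmap_pair.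
  intros K. apply vpair_inj in K. destruct K. f_equal; intuition.
- assert (K : forall f g, (forall p, p ∈ f -> exists a b, p = opair a b /\ fits c a /\ fits d b) ->
    (forall p, p ∈ g -> exists a b, p = opair a b /\ fits c a /\ fits d b) ->
    map_graph (vmap lam) f = map_graph (vmap lam) g ->
    forall p, p ∈ map_graph (vmap mu) f -> p ∈ map_graph (vmap mu) g).
  { intros f g Hf Hg K p Hp. apply mem_map_graph in Hp. destruct Hp as (a & b & Hab & ->).
    assert (Q : opair (vmap lam a) (vmap lam b) ∈ map_graph (vmap lam) g).
    { rewrite <- K. apply mem_map_graph. eauto. }
    apply mem_map_graph in Q. destruct Q as (a' & b' & Hab' & Q). apply opair_inj in Q.
    apply mem_map_graph. exists a', b'. split; [exact Hab'|].
    destruct (Hf _ Hab) as (a1 & b1 & E1 & Ha & Hb); apply opair_inj in E1.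
    destruct E1; subst a1 b1.
    destruct (Hg _ Hab') as (a1 & b1 & E1 & Ha' & Hb'); apply opair_inj in E1.
    destruct E1; subst a1 b1. destruct Q. f_equal; intuition. }
  intros v w (f & -> & _ & Hf) (g & -> & _ & Hg). rewrite !vmap_fun. intros Q.
  apply vfun_inj in Q. f_equal. apply ZF_ext. split; apply K; auto.
- assert (K : forall s t, (forall a, a ∈ s -> fits c a) -> (forall a, a ∈ t -> fits c a) ->
    repl (vmap lam) s = repl (vmap lam) t ->
    forall p, p ∈ repl (vmap mu) s -> p ∈ repl (vmap mu) t).
  { intros s t Hs Ht K p Hp. apply ZF_repl in Hp. destruct Hp as (a & Ha & ->).
    assert (Q : vmap lam a ∈ repl (vmap lam) t) by (rewrite <- K; apply ZF_repl; eauto).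
    apply ZF_repl in Q. destruct Q as (b & Hb & Q). apply ZF_repl. exists b. auto. }
  intros v w (s & -> & _ & Hs) (t & -> & _ & Ht). rewrite !vmap_set. intros Q.
  apply vset_inj in Q. f_equal. apply ZF_ext. split; apply K; auto.
Qed.

Lemma vmap_id c v : over L c -> fits c v -> vmap (fun x => x) v = v.
Proof.
intros Hc. revert v. induction c as [|k|c IHc d IHd|c IHc d IHd|c IHc]; simpl in *.
- intros v [b ->]. apply vmap_bool.
- intros v Hv. now rewrite (vmap_sort _ k v).
- intros v (a & b & -> & Ha & Hb). rewrite vmap_pair. f_equal; intuition.
- intros v (f & -> & _ & Hf). rewrite vmap_fun. f_equal. apply ZF_ext. intros p.
  rewrite mem_map_graph. split.
  + intros (a & b & H & ->). destruct (Hf _ H) as (a' & b' & E' & Ha & Hb); apply opair_inj in E'.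
    destruct E'; subst a' b'. now rewrite IHc, IHd.
  + intros H. destruct (Hf _ H) as (a & b & -> & Ha & Hb). exists a, b. split; [exact H|].
    now rewrite IHc, IHd.
- intros v (s & -> & _ & Hs). rewrite vmap_set. f_equal. apply ZF_ext. intros p.
  rewrite ZF_repl. split.
  + intros (a & H & ->). rewrite IHc; auto.
  + intros H. exists p. rewrite IHc; auto.
Qed.

Lemma vmap_inj m lam c v w : good_label m lam L -> over L c -> fits c v -> fits c w ->
  vmap lam v = vmap lam w -> v = w.
Proof.
intros Hl Hc Hv Hw E. rewrite <- (vmap_id c v Hc Hv), <- (vmap_id c w Hc Hw).
apply (vmap_kernel lam (fun x => x) c); auto. intros k x y Hk. now apply (Hl k Hk).
Qed.

(** On a sort this is the bijectivity of the labelled sort. Projection after labelling is one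
    relabelling, so [vmap_kernel] carries both inclusions to the whole shape. *)
Lemma vproj_vmap_kernel lam c v w : good_label Ext lam L -> over L c -> fits c v -> fits c w ->
  vproj Left (vmap lam v) = vproj Left (vmap lam w) <->
  vproj Right (vmap lam v) = vproj Right (vmap lam w).
Proof.
intros Hl Hc Hv Hw. unfold vproj. rewrite !(vmap_comp lam _ c) by assumption.
assert (K : forall k x y, In k L -> x ∈ k -> y ∈ k ->
  vproj Left (lam x) = vproj Left (lam y) <-> vproj Right (lam x) = vproj Right (lam y)).
{ intros k x y Hk Hx Hy. pose proof (proj2 (Hl k Hk)) as Hb.
  apply (bijective_vset (repl lam k)) in Hb. apply Hb; apply ZF_repl; eauto. }
split; apply (vmap_kernel _ _ c); auto; intros k x y Hk Hx Hy; now apply (K k).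
Qed.

(** In the extended language the condition on the kernels of the projections comes from the common
    shape of the elements. *)
Lemma sval_set m lam c s : good_label m lam L -> over L c -> s ∈ V ->
  (forall a, a ∈ s -> fits c a /\ sval m (vmap lam a)) -> sval m (vmap lam (vset s)).
Proof.
intros Hl Hc Hs Ha. rewrite vmap_set.
assert (K : repl (vmap lam) s ∈ V).
{ apply (univ_repl HV); [exact Hs|]. intros a Has. apply (sval_univ m). now apply Ha. }
destruct m; simpl in *.
- constructor; [exact K|]. intros x Hx. apply ZF_repl in Hx. destruct Hx as (a & Has & ->).
  now apply Ha.
- apply bijective_vset. split; [exact K|split].
  + intros x Hx. apply ZF_repl in Hx. destruct Hx as (a & Has & ->). now apply Ha.
  + intros x y Hx Hy. apply ZF_repl in Hx, Hy.
    destruct Hx as (a & Has & ->), Hy as (b & Hbs & ->).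
    apply (vproj_vmap_kernel lam c); auto; now apply Ha.
Qed.

Lemma vmap_sval m lam c v : good_label m lam L -> over L c -> fits c v -> basic V v ->
  sval m (vmap lam v).
Proof.
intros Hl. revert v. induction c as [|k|c IHc d IHd|c IHc d IHd|c IHc]; simpl.
- intros v _ [b ->] _. rewrite vmap_bool. destruct m; constructor.
- intros v Hk Hv _. rewrite (vmap_sort _ k v) by auto.
  apply (sval_vset_inv m (repl lam k)); [now apply Hl|]. apply ZF_repl. eauto.
- intros v [Hc Hd] (a & b & -> & Ha & Hb) H. apply basic_vpair_inv in H.
  rewrite vmap_pair.
  assert (sval m (vmap lam a)) by intuition. assert (sval m (vmap lam b)) by intuition.
  destruct m; now constructor.
- intros v [Hc Hd] (f & -> & HfV & Hf) H. apply basic_vfun_inv in H.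
  destruct H as (_ & Hfun & Hb). rewrite vmap_fun.
  assert (Hf' : forall a b, opair a b ∈ f -> fits c a /\ fits d b /\
    sval m (vmap lam a) /\ sval m (vmap lam b)).
  { intros a b Hab. destruct (Hb _ _ Hab). destruct (Hf _ Hab) as (a' & b' & E & Ka & Kb).
    apply opair_inj in E. destruct E; subst. auto. }
  (* Injectivity of the labelling on the shape of the arguments keeps the relabelled graph
     single-valued. *)
  assert (Hfun' : is_function (map_graph (vmap lam) f)).
  { split.
    - intros p Hp. apply mem_map_graph in Hp. destruct Hp as (a & b & _ & ->). eauto.
    - intros a b b' H1 H2. apply mem_map_graph in H1, H2.
      destruct H1 as (x & y & Hxy & E), H2 as (x' & y' & Hxy' & E').
      apply opair_inj in E, E'. destruct E as [-> ->], E' as [E ->].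
      apply (vmap_inj m lam c) in E; auto; [|now apply (Hf' _ _ Hxy)|now apply (Hf' _ _ Hxy')].
      subst x'. now rewrite (proj2 Hfun _ _ _ Hxy Hxy'). }
  assert (K : forall a b, opair a b ∈ map_graph (vmap lam) f -> sval m a /\ sval m b).
  { intros a b H. apply mem_map_graph in H. destruct H as (x & y & H & E).
    apply opair_inj in E. destruct E; subst. apply Hf' in H. tauto. }
  destruct (graph_domain HV f HfV) as (s & Hs & Hdom).
  assert (Ks : sval m (vmap lam (vset s))).
  { apply (sval_set m lam c); auto. intros a Ha. apply Hdom in Ha. destruct Ha as [b Hab].
    apply Hf' in Hab. tauto. }
  rewrite vmap_set in Ks.
  assert (Kdom : is_domain (map_graph (vmap lam) f) (repl (vmap lam) s)).
  { intros a. rewrite ZF_repl. split.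
    - intros (x & Hx & ->). apply Hdom in Hx. destruct Hx as [y Hxy].
      exists (vmap lam y). apply mem_map_graph. eauto.
    - intros [b H]. apply mem_map_graph in H. destruct H as (x & y & H & E).
      apply opair_inj in E. destruct E; subst. exists x. split; [apply Hdom; eauto|reflexivity]. }
  destruct m; simpl in *.
  + constructor; auto; [|intros; now apply (K a b)..].
    apply (univ_map_graph HV); auto; intros a b Hab; apply (basic_univ HV);
      apply Hf' in Hab; tauto.
  + apply bijective_fun with (repl (vmap lam) s); auto; intros; now apply (K a b).
- intros v Hc (s & -> & Hs & Ha) H. apply basic_vset_inv in H.
  apply (sval_set m lam c); auto. intros a Has. split; [auto|]. apply IHc; auto. now apply H.
Qed.

(** A value that fits a shape may carry relations in place of functions. A good labelling with a
    basic result excludes this, since injectivity on the shape reflects single-valuedness. The case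
    of [SetC] in the quotient argument relies on it. *)
Lemma basic_of_vmap lam c v : good_label Base lam L -> over L c -> fits c v ->
  basic V (vmap lam v) -> basic V v.
Proof.
intros Hl. revert v. induction c as [|k|c IHc d IHd|c IHc d IHd|c IHc]; simpl.
- intros v _ [b ->] _. constructor.
- intros v Hk Hv _. destruct (sort_atom k v Hk Hv) as (y & Hy & ->). now constructor.
- intros v [Hc Hd] (a & b & -> & Ha & Hb). rewrite vmap_pair. intros H.
  apply basic_vpair_inv in H. constructor; intuition.
- intros v [Hc Hd] (f & -> & HfV & Hf). rewrite vmap_fun. intros H.
  apply basic_vfun_inv in H. destruct H as (_ & Hfun & Hb).
  assert (K : forall a b, opair a b ∈ f -> (fits c a /\ basic V a) /\ (fits d b /\ basic V b)).
  { intros a b Hab. destruct (Hf _ Hab) as (a' & b' & E & Ka & Kb).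
    apply opair_inj in E. destruct E; subst a' b'.
    destruct (Hb (vmap lam a) (vmap lam b)); [apply mem_map_graph; eauto|]. auto. }
  constructor; auto.
  + split.
    * intros p Hp. destruct (Hf _ Hp) as (a & b & -> & _). eauto.
    * intros a b b' H1 H2. destruct (K _ _ H1) as (_ & Q & _), (K _ _ H2) as (_ & Q' & _).
      apply (vmap_inj Base lam d); auto.
      apply (proj2 Hfun (vmap lam a)); apply mem_map_graph; eauto.
  + intros a b Hab. apply (K _ _ Hab).
  + intros a b Hab. apply (K _ _ Hab).
- intros v Hc (s & -> & Hs & Ha). rewrite vmap_set. intros H. apply basic_vset_inv in H.
  constructor; auto. intros x Hx. apply IHc; auto. apply H. apply ZF_repl. eauto.
Qed.

Lemma good_label_id m : good_label m (fun x => x) L.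
Proof.
intros k Hk. split; [auto|]. apply sval_basic. destruct (HL k Hk) as [Hk' Ha].
constructor.
- apply (univ_repl HV); auto. intros x Hx. now apply (univ_trans HV) with k.
- intros x Hx. apply ZF_repl in Hx. destruct Hx as (y & Hy & ->).
  destruct (Ha y Hy) as (z & Hz & ->). now constructor.
Qed.

End Labels.

Lemma good_label_Ext lam L : good_label Base lam L -> good_label Ext lam L.
Proof. intros H k Hk. split; [now apply H|]. apply basic_bijective, H; auto. Qed.

Lemma good_label_incl m lam L L' : incl L L' -> good_label m lam L' -> good_label m lam L.
Proof. intros H K k Hk. apply K, H, Hk. Qed.

Lemma good_label_agree m lam mu L :
  (forall k x, In k L -> x ∈ k -> lam x = mu x) -> good_label m lam L -> good_label m mu L.
Proof.
intros E H k Hk. destruct (H k Hk) as [Hi Hs]. split.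
- intros x y Hx Hy. rewrite <- !(E k) by auto. auto.
- replace (repl mu k) with (repl lam k); [exact Hs|]. apply ZF_ext. intros p.
  rewrite !ZF_repl. split; intros (x & Hx & ->); exists x; (split; [exact Hx|]); auto.
  + eauto.
  + symmetry. eauto.
Qed.

(** Disjointness of the new sorts from the old ones lets new atoms be labelled freely while the old
    labels stay. The labels themselves may overlap, as injectivity concerns one sort at a time. *)
Definition extends (L L' : list U) : Prop :=
  incl L L' /\
  forall k', In k' L' -> In k' L \/ forall k x, In k L -> x ∈ k -> ~ x ∈ k'.

Lemma extends_refl L : extends L L.
Proof. split; [apply incl_refl|auto]. Qed.

Lemma extends_trans L L' L'' : extends L L' -> extends L' L'' -> extends L L''.
Proof.
intros [H1 H2] [K1 K2]. split; [now apply incl_tran with L'|]. intros k Hk.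
destruct (K2 k Hk) as [H|H]; [auto|]. right. intros k' x Hk' Hx. eapply H; [|exact Hx]. auto.
Qed.

Definition extend_label (L : list U) (lam mu : U -> U) (x : U) : U :=
  if excluded_middle_informative (exists k, In k L /\ x ∈ k) then lam x else mu x.

Lemma extend_label_old L lam mu k x : In k L -> x ∈ k -> extend_label L lam mu x = lam x.
Proof.
intros Hk Hx. unfold extend_label. destruct (excluded_middle_informative _) as [_|H]; [auto|].
destruct H. eauto.
Qed.

Lemma extend_label_new L lam mu k' x :
  (forall k x, In k L -> x ∈ k -> ~ x ∈ k') -> x ∈ k' -> extend_label L lam mu x = mu x.
Proof.
intros H Hx. unfold extend_label. destruct (excluded_middle_informative _) as [K|_]; [|auto].
destruct K as (k & Hk & Kx). now destruct (H k x Hk Kx).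
Qed.

Lemma good_label_extend m lam mu L L' : extends L L' -> good_label m lam L ->
  (forall k', In k' L' -> ~ In k' L -> good_label m mu [k']) ->
  good_label m (extend_label L lam mu) L'.
Proof.
intros [_ He] Hl Hm k' Hk'. destruct (classic (In k' L)) as [Hk|Hk].
- apply (good_label_agree m lam _ L); auto. intros k x K Hx.
  symmetry. now apply (extend_label_old _ _ _ k).
- destruct (He k' Hk') as [K|K]; [contradiction|].
  apply (good_label_agree m mu _ [k']); [|now apply Hm|simpl; auto].
  intros k x [<-|[]] Hx. symmetry. now apply (extend_label_new _ _ _ k').
Qed.

Lemma good_label_extension m lam L L' : sort_atoms L' -> extends L L' -> good_label m lam L ->
  exists lam', good_label m lam' L' /\ forall k x, In k L -> x ∈ k -> lam' x = lam x.
Proof.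
intros HL' He Hl. exists (extend_label L lam (fun x => x)). split.
- apply good_label_extend; auto. intros k' Hk' _. apply good_label_id.
  intros k [<-|[]]. auto.
- intros k x. apply extend_label_old.
Qed.

(* Foundation provides an index that occurs in no atom of the given sorts. *)
Fixpoint fresh_index (L : list U) : U :=
  match L with [] => empty | k :: L => upair k (upair (fresh_index L) (fresh_index L)) end.

Lemma fresh_index_below L k : In k L -> below k (fresh_index L).
Proof.
induction L as [|k' L IH]; [contradiction|]. simpl. intros [->|Hk].
- apply below_mem, ZF_upair. auto.
- apply below_trans with (fresh_index L); [auto|].
  apply below_trans with (upair (fresh_index L) (fresh_index L));
    apply below_mem, ZF_upair; auto.
Qed.

Lemma fresh_index_univ L : sort_atoms L -> fresh_index L ∈ V.
Proof.
induction L as [|k L IH]; simpl; intros H.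
- now apply univ_empty.
- assert (fresh_index L ∈ V) by (apply IH; intros k' Hk'; apply H; simpl; auto).
  repeat apply (univ_upair HV); auto. apply H. simpl. auto.
Qed.

(** Otherwise [k] would lie below the index, the index below the atom and the atom in [k], a cycle
    against foundation. *)
Lemma fresh_index_notin L k x : In k L -> ~ vatom (opair (fresh_index L) x) ∈ k.
Proof.
intros Hk Hx. apply (below_irrefl k).
apply below_trans with (fresh_index L); [now apply fresh_index_below|].
eapply below_trans; [apply below_opair_l|].
eapply below_trans; [apply below_opair_r|]. apply below_mem. exact Hx.
Qed.

End Shapes.

(** * Shapes of set-level expressions *)

(* [Sbool] is the junk value on shapes that are not sets. *)
Definition elt_shape {U : ZF} (c : @shape U) : @shape U :=
  match c with Sset d => d | _ => Sbool end.

(** Nothing is checked: for well-formed expressions the shapes of the components determine the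
    shape, and a subtype has the shape of its base. The last branch is the right answer for Boolean
    formulas and junk for [SetC] and [BijC]. *)
Fixpoint infer {U : ZF} (K : list (@shape U)) (e : expr) : @shape U :=
  match e with
  | Var n => nth n K Sbool
  | BoolC => Sset Sbool
  | Pair u v => Spair (infer K u) (infer K v)
  | Pr1 u => match infer K u with Spair c _ => c | _ => Sbool end
  | Pr2 u => match infer K u with Spair _ d => d | _ => Sbool end
  | Lam s e => let c := elt_shape (infer K s) in Sarr c (infer (c :: K) e)
  | App f _ => match infer K f with Sarr _ d => d | _ => Sbool end
  | Pi s t =>
      let c := elt_shape (infer K s) in Sset (Sarr c (elt_shape (infer (c :: K) t)))
  | Sum s t =>
      let c := elt_shape (infer K s) in Sset (Spair c (elt_shape (infer (c :: K) t)))
  | Sub s _ => infer K s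
  | _ => Sbool
  end.

Section Inference.
Context {U : ZF} {V : U} (HV : grothendieck V).
Notation shape := (@shape U).
Notation env := (@env U).
Notation semB := (sem V Base).

Lemma elt_shape_over (L : list U) c : over L c -> over L (elt_shape c).
Proof. destruct c; simpl; tauto. Qed.

Lemma infer_over (L : list U) e : forall K, Forall (over L) K -> over L (infer K e).
Proof.
induction e; intros K HK; simpl; auto using elt_shape_over.
- destruct (nth_in_or_default n K Sbool) as [H| ->]; [|exact I].
  now apply (proj1 (Forall_forall _ _) HK).
- specialize (IHe K HK). destruct (infer K e); simpl in *; tauto.
- specialize (IHe K HK). destruct (infer K e); simpl in *; tauto.
- auto 7 using elt_shape_over.
- specialize (IHe1 K HK). destruct (infer K e1); simpl in *; tauto.
- auto 8 using elt_shape_over.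
- auto 8 using elt_shape_over.
Qed.

Section Sound.
Context {L : list U} (HL : sort_atoms (V := V) L).
Notation fits := (fits (V := V)).

Lemma fits_sort_atom k v : over L (Ssort k) -> fits (Ssort k) v -> exists y, v = vatom y.
Proof. intros Hk Hv. destruct (sort_atom HL k v Hk Hv) as (y & _ & ->). eauto. Qed.

Lemma fits_vset c s : over L c -> fits c (vset s) ->
  exists c', c = Sset c' /\ s ∈ V /\ forall a, a ∈ s -> fits c' a.
Proof.
intros Hc H. destruct c.
- destruct H as [b H]. tag_clash.
- apply fits_sort_atom in H; [|exact Hc]. destruct H as [y H]. tag_clash.
- destruct H as (a & b & H & _). tag_clash.
- destruct H as (f & H & _). tag_clash.
- destruct H as (s' & E & Hs & Ha). apply vset_inj in E. subst. eauto.
Qed.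

Lemma fits_vpair c x y : over L c -> fits c (vpair x y) ->
  exists d d', c = Spair d d' /\ fits d x /\ fits d' y.
Proof.
intros Hc H. destruct c.
- destruct H as [b H]. tag_clash.
- apply fits_sort_atom in H; [|exact Hc]. destruct H as [z H]. tag_clash.
- destruct H as (a & b & E & Ha & Hb). apply vpair_inj in E. destruct E; subst. eauto.
- destruct H as (f & H & _). tag_clash.
- destruct H as (s & H & _). tag_clash.
Qed.

Lemma fits_vfun c f : over L c -> fits c (vfun f) ->
  exists d d', c = Sarr d d' /\ f ∈ V /\ forall a b, opair a b ∈ f -> fits d a /\ fits d' b.
Proof.
intros Hc H. destruct c.
- destruct H as [b H]. tag_clash.
- apply fits_sort_atom in H; [|exact Hc]. destruct H as [z H]. tag_clash.
- destruct H as (a & b & H & _). tag_clash.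
- destruct H as (f' & E & Hf & H). apply vfun_inj in E. subst f'. exists c1, c2.
  split; [reflexivity|split; [exact Hf|]]. intros a b Hab.
  destruct (H _ Hab) as (a' & b' & E & Ha & Hb). apply opair_inj in E. now destruct E; subst.
- destruct H as (s & H & _). tag_clash.
Qed.

Definition shape_sound (e : expr) : Prop := forall G X K g v,
  ctx_val semB G X -> X g -> Forall (over L) K -> Forall2 fits K g -> Forall (basic V) g ->
  set_level e = true -> exp_val semB G e g (Val v) -> fits (infer K e) v /\ basic V v.

Lemma sound_elements e G X K g : shape_sound e -> is_Type V Base semB G e ->
  ctx_val semB G X -> X g -> Forall (over L) K -> Forall2 fits K g -> Forall (basic V) g ->
  set_level e = true ->
  forall a, in_exp semB a G e g -> fits (elt_shape (infer K e)) a /\ basic V a.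
Proof.
intros He Ht HX Hg HK Hfit Hb Hl a Ha.
destruct (is_Type_set Base semB G X e g (sem_good V Base) Ht Hl HX Hg) as (S & _ & KS).
apply (in_exp_vset _ _ _ _ S _ (sem_det V Base) KS) in Ha.
destruct (He G X K g _ HX Hg HK Hfit Hb Hl KS) as [F B].
apply fits_vset in F; [|now apply infer_over]. destruct F as (c & -> & _ & F).
apply basic_vset_inv in B. split; [now apply F|now apply B].
Qed.

(** Structural induction is enough here: a formula contributes only a truth value, and by the
    premises the subexpressions that determine a shape are set-level when the whole is. Functions
    lie in [V], as [fits] demands, because their domain is a set in [V] and their values are
    basic. *)
Lemma infer_sound e : shape_sound e.
Proof.
pose proof (sem_good V Base) as HI. pose proof (proj1 HI) as Hd.
induction e; intros G X K g w HX Hg HK Hfit Hb Hl Hw;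
  pose proof Hw as Hw'; apply (good_exp V Base) in Hw'; auto;
  destruct Hw' as (_ & HP & Hval); simpl in HP, Hval, Hl |- *; try discriminate.
- destruct Hval as (a & Ha & E). injection E as <-. split.
  + clear - Hfit Ha. revert n Ha. induction Hfit; intros [|n] Ha; try discriminate; simpl in *.
    * now injection Ha as <-.
    * auto.
  + apply nth_error_In in Ha. now apply (proj1 (Forall_forall _ _) Hb).
- destruct Hval as (s & Hs & H & E). injection E as ->. split.
  + exists s. split; [reflexivity|split; [exact Hs|]]. intros a Ha. now apply H.
  + constructor; [exact Hs|]. intros x Hx. apply H in Hx. destruct Hx as [b ->]. constructor.
- destruct HP as (L1 & L2 & _). destruct Hval as (a & b & Ha & Hb' & E). injection E as ->.
  destruct (IHe1 G X K g a) as [F1 B1]; auto. destruct (IHe2 G X K g b) as [F2 B2]; auto.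
  split; [exists a, b; auto|now constructor].
- destruct Hval as (a & b & Ha & E). injection E as ->.
  destruct (IHe G X K g _ HX Hg HK Hfit Hb Hl Ha) as [F B].
  apply fits_vpair in F; [|now apply infer_over]. destruct F as (d & d' & -> & F & _).
  split; [exact F|]. now apply basic_vpair_inv in B.
- destruct Hval as (a & b & Ha & E). injection E as ->.
  destruct (IHe G X K g _ HX Hg HK Hfit Hb Hl Ha) as [F B].
  apply fits_vpair in F; [|now apply infer_over]. destruct F as (d & d' & -> & _ & F).
  split; [exact F|]. now apply basic_vpair_inv in B.
- destruct HP as [Hs [t Ht]]. pose proof Hs as (L1 & _). pose proof Ht as (L2 & _).
  apply sort_is_Type in Hs; [|exact HI]. set (c := elt_shape (infer K e1)).
  assert (Hc : over L c) by now apply elt_shape_over, infer_over.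
  pose proof (sem_decl HV Base G X e1 HX Hs) as HX1.
  destruct Hval as (f & Hf & E). injection E as ->.
  assert (Q : forall a b, opair a b ∈ f -> (fits c a /\ basic V a) /\
    (fits (infer (c :: K) e2) b /\ basic V b) /\ in_exp semB a G e1 g /\
    exp_val semB (Decl G e1) e2 (a :: g) (Val b)).
  { intros a b Hab. apply Hf in Hab. destruct Hab as (a' & b' & Ha & Hb' & E).
    apply opair_inj in E. destruct E; subst a' b'.
    pose proof (sound_elements e1 G X K g IHe1 Hs HX Hg HK Hfit Hb L1 a Ha) as [Fa Ba].
    split; [auto|split; [|auto]].
    apply (IHe2 (Decl G e1) (decl_env semB G e1 X) (c :: K) (a :: g)); auto.
    exists a, g. auto. }
  assert (Hfun : is_function f).
  { split.
    - intros p Hp. apply Hf in Hp. destruct Hp as (a & b & _ & _ & ->). eauto.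
    - intros a b b' H1 H2. destruct (Q _ _ H1) as (_ & _ & _ & Q1), (Q _ _ H2) as (_ & _ & _ & Q2).
      pose proof (proj2 Hd _ _ _ _ _ Q1 Q2) as E. now injection E. }
  assert (HfV : f ∈ V).
  { destruct (is_Type_set Base semB G X e1 g HI Hs L1 HX Hg) as (S & HS & KS).
    apply (univ_function HV) with S; auto.
    - intros a. rewrite <- (in_exp_vset _ _ _ _ S _ Hd KS). split.
      + intros Ha. destruct (has_type_at V _ _ _ _ _ _ (a :: g) Hd Ht HX1) as (b & Hb' & _).
        * exists a, g. auto.
        * exists b. apply Hf. exists a, b. auto.
      + intros [b Hab]. apply Q in Hab. tauto.
    - intros a b Hab. apply (basic_univ HV). apply Q in Hab. tauto. }
  split.
  + exists f. split; [reflexivity|split; [exact HfV|]]. intros p Hp.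
    destruct (proj1 Hfun p Hp) as (a & b & ->). apply Q in Hp. exists a, b. tauto.
  + constructor; auto; intros a b Hab; apply Q in Hab; tauto.
- destruct HP as (s & t & (L1 & _) & _). destruct Hval as (h & a & b & Hh & _ & Hab & E).
  injection E as ->. destruct (IHe1 G X K g _ HX Hg HK Hfit Hb L1 Hh) as [F B].
  apply fits_vfun in F; [|now apply infer_over]. destruct F as (d & d' & -> & _ & F).
  split; [now apply (F a)|]. apply basic_vfun_inv in B. now apply B in Hab.
- destruct Hval as (a & b & c & _ & _ & _ & E). injection E as ->. split; [eauto|constructor].
- destruct Hval as (b & _ & E). injection E as ->. split; [eauto|constructor].
- destruct Hval as (b & _ & E). injection E as ->. split; [eauto|constructor].
- destruct Hval as (b & b' & _ & _ & E). injection E as ->. split; [eauto|constructor].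
- destruct HP as [Hs Ht]. pose proof Hs as (L1 & _). pose proof Ht as (L2 & _).
  apply sort_is_Type in Hs, Ht; [|exact HI..]. set (c := elt_shape (infer K e1)).
  assert (Hc : over L c) by now apply elt_shape_over, infer_over.
  pose proof (sem_decl HV Base G X e1 HX Hs) as HX1.
  unfold collects in Hval. simpl in Hval. rewrite L1, L2 in Hval.
  destruct Hval as (s & HsV & Hs' & E). injection E as ->.
  assert (Q : forall v, v ∈ s -> fits (Sarr c (elt_shape (infer (c :: K) e2))) v /\ basic V v).
  { intros v Hv. apply Hs' in Hv. destruct Hv as (f & -> & Hfun & H1 & H2).
    assert (Q : forall a b, opair a b ∈ f -> (fits c a /\ basic V a) /\
      (fits (elt_shape (infer (c :: K) e2)) b /\ basic V b)).
    { intros a b Hab. assert (Ha : in_exp semB a G e1 g) by (apply H1; eauto).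
      pose proof (sound_elements e1 G X K g IHe1 Hs HX Hg HK Hfit Hb L1 a Ha) as [Fa Ba].
      split; [auto|]. apply (sound_elements e2 (Decl G e1) _ (c :: K) (a :: g) IHe2 Ht HX1); auto.
      exists a, g. auto. }
    assert (HfV : f ∈ V).
    { destruct (is_Type_set Base semB G X e1 g HI Hs L1 HX Hg) as (S & HS & KS).
      apply (univ_function HV) with S; auto.
      - intros a. rewrite <- H1. symmetry. apply (in_exp_vset _ _ _ _ S _ Hd KS).
      - intros a b Hab. apply (basic_univ HV). apply Q in Hab. tauto. }
    split.
    - exists f. split; [reflexivity|split; [exact HfV|]]. intros p Hp.
      destruct (proj1 Hfun p Hp) as (a & b & ->). apply Q in Hp. exists a, b. tauto.
    - constructor; auto; intros a b Hab; apply Q in Hab; tauto. }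
  split.
  + exists s. split; [reflexivity|split; [exact HsV|]]. intros v Hv. now apply Q.
  + constructor; [exact HsV|]. intros v Hv. now apply Q.
- destruct HP as [Hs Ht]. apply andb_prop in Hl. destruct Hl as [L1 L2].
  set (c := elt_shape (infer K e1)).
  assert (Hc : over L c) by now apply elt_shape_over, infer_over.
  pose proof (sem_decl HV Base G X e1 HX Hs) as HX1.
  unfold collects in Hval. simpl in Hval. rewrite L1, L2 in Hval.
  destruct Hval as (s & HsV & Hs' & E). injection E as ->.
  assert (Q : forall v, v ∈ s -> fits (Spair c (elt_shape (infer (c :: K) e2))) v /\ basic V v).
  { intros v Hv. apply Hs' in Hv. destruct Hv as (a & b & -> & Ha & H2).
    pose proof (sound_elements e1 G X K g IHe1 Hs HX Hg HK Hfit Hb L1 a Ha) as [Fa Ba].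
    destruct (sound_elements e2 (Decl G e1) _ (c :: K) (a :: g) IHe2 Ht HX1) with b as [Fb Bb];
      auto.
    - exists a, g. auto.
    - split; [exists a, b; auto|now constructor]. }
  split.
  + exists s. split; [reflexivity|split; [exact HsV|]]. intros v Hv. now apply Q.
  + constructor; [exact HsV|]. intros v Hv. now apply Q.
- destruct HP as [Hs Ht].
  unfold collects in Hval. simpl in Hval. rewrite Hl in Hval.
  destruct Hval as (s & HsV & Hs' & E). injection E as ->.
  destruct (is_Type_set Base semB G X e1 g HI Hs Hl HX Hg) as (S & HS & KS).
  destruct (IHe1 G X K g _ HX Hg HK Hfit Hb Hl KS) as [F B].
  apply fits_vset in F; [|now apply infer_over]. destruct F as (c & -> & _ & F).
  apply basic_vset_inv in B.
  assert (Q : forall v, v ∈ s -> v ∈ S).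
  { intros v Hv. apply Hs' in Hv. now apply (in_exp_vset _ _ _ _ S _ Hd KS). }
  split.
  + exists s. split; [reflexivity|split; [exact HsV|]]. auto.
  + constructor; [exact HsV|]. intros v Hv. now apply B, Q.
Qed.

End Sound.
End Inference.

(** * Invariance under relabelling *)

(** With the language as a parameter, relabelling inside the base language and the passage to the
    starred expression in the extended one become a single induction. *)
Definition tr (m : language) (e : expr) : expr :=
  match m with Base => e | Ext => star e end.

Lemma tr_unfold m e : tr m e = match e with
  | SetC => sort_S m
  | Pair u v => Pair (tr m u) (tr m v)
  | Pr1 u => Pr1 (tr m u)
  | Pr2 u => Pr2 (tr m u)
  | Lam s e => Lam (tr m s) (tr m e)
  | App f u => App (tr m f) (tr m u)
  | Eq u v => Eq (tr m u) (tr m v)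
  | All s p => All (tr m s) (tr m p)
  | Not p => Not (tr m p)
  | Conn c p q => Conn c (tr m p) (tr m q)
  | Pi s t => Pi (tr m s) (tr m t)
  | Sum s t => Sum (tr m s) (tr m t)
  | Sub s p => Sub (tr m s) (tr m p)
  | e => e
  end.
Proof. now destruct m, e. Qed.

Lemma set_level_star e : set_level (star e) = set_level e.
Proof. induction e; simpl; congruence. Qed.

Lemma set_level_tr m e : set_level (tr m e) = set_level e.
Proof. destruct m; [reflexivity|apply set_level_star]. Qed.

Lemma tr_SetC m : tr m SetC = sort_S m.
Proof. now destruct m. Qed.

Lemma tr_BoolC m : tr m BoolC = BoolC.
Proof. now destruct m. Qed.

Section Invariance.
Context {U : ZF} {V : U} (HV : grothendieck V).
Notation env := (@env U).
Notation semB := (sem V Base).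
Notation isB := (is_Type V Base semB).
Notation hasB := (has_type V Base semB).
Notation declB := (decl_env semB).
Notation detB := (sem_det V Base).
Notation goodB := (sem_good V Base).
Notation fits := (fits (V := V)).
Notation sort_atoms := (sort_atoms (V := V)).
Notation good_label := (good_label (V := V)).
Notation lmap lam := (map (vmap lam)).

Definition flat (L : list U) (g : env) : Prop :=
  exists K, Forall (over L) K /\ Forall2 fits K g.

(* [g] is a pattern over the sorts [L]. *)
Definition generic (X : env -> Prop) (L : list U) (g : env) : Prop :=
  sort_atoms L /\ flat L g /\ Forall (basic V) g /\
  forall lam, good_label Base lam L -> X (lmap lam g).

Definition instance (m : language) (X : env -> Prop) (g' : env) : Prop :=
  exists L g lam, generic X L g /\ good_label m lam L /\ g' = lmap lam g.

(** In the extended language the partner [G'] is constrained only through its environments. It may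
    be the unstarred context, as in [iso_at], where the starred type is evaluated under [G] itself,
    followed by starred declarations for the binders that have been passed. *)
Definition sim (m : language) (G : ctx) (X : env -> Prop) (G' : ctx) (X' : env -> Prop) : Prop :=
  ctx_val (sem V m) G' X' /\
  match m with
  | Base => G' = G /\ X' = X
  | Ext => forall g', X' g' -> instance Ext X g'
  end.

Lemma lmap_agree L lam mu g : sort_atoms L -> flat L g ->
  (forall k x, In k L -> x ∈ k -> lam x = mu x) -> lmap lam g = lmap mu g.
Proof.
intros HL (K & HK & Hf) E. induction Hf as [|c v K g Hc Hf IH]; [reflexivity|].
inversion HK; subst. simpl. f_equal; auto. now apply (vmap_agree HL lam mu c).
Qed.

Lemma lmap_id L g : sort_atoms L -> flat L g -> lmap (fun x => x) g = g.
Proof.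
intros HL (K & HK & Hf). induction Hf as [|c v K g Hc Hf IH]; [reflexivity|].
inversion HK; subst. simpl. f_equal; auto. now apply (vmap_id HL c).
Qed.

Lemma generic_id X L g : generic X L g -> X g.
Proof.
intros (HL & Hf & _ & H). rewrite <- (lmap_id L g HL Hf). apply H. now apply good_label_id.
Qed.

Lemma generic_incl X L L' g : generic X L g -> incl L L' -> sort_atoms L' -> generic X L' g.
Proof.
intros (HL & (K & HK & Hf) & Hb & H) Hi HL'. split; [exact HL'|split; [|split; [exact Hb|]]].
- exists K. split; [|exact Hf]. eapply Forall_impl; [|exact HK]. intros c. now apply over_incl.
- intros lam Hl. apply H. now apply (good_label_incl Base lam L L').
Qed.

Lemma generic_decl G s X L a g :
  generic (declB G s X) L (a :: g) ->
  generic X L g /\ (exists c, over L c /\ fits c a) /\ basic V a /\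
  forall lam, good_label Base lam L -> in_exp semB (vmap lam a) G s (lmap lam g).
Proof.
intros (HL & (K & HK & Hf) & Hb & H). inversion Hf as [|c v K' g' Hc Hf' E1 E2]; subst.
inversion HK; subst. inversion Hb; subst.
assert (Q : forall lam, good_label Base lam L -> X (lmap lam g) /\ in_exp semB (vmap lam a) G s
  (lmap lam g)).
{ intros lam Hl. destruct (H lam Hl) as (b & h & E & Hh & Ha). simpl in E.
  injection E as <- <-. auto. }
split; [|split; [eauto|split; [auto|]]].
- split; [exact HL|split; [|split; [auto|]]].
  + exists K'. auto.
  + intros lam Hl. now apply Q.
- intros lam Hl. now apply Q.
Qed.

Lemma generic_cons G s X L c a g :
  generic X L g -> over L c -> fits c a -> basic V a ->
  (forall lam, good_label Base lam L -> in_exp semB (vmap lam a) G s (lmap lam g)) ->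
  generic (declB G s X) L (a :: g).
Proof.
intros (HL & (K & HK & Hf) & Hb & H) Hc Ha Hba H'.
split; [exact HL|split; [|split; [auto|]]].
- exists (c :: K). auto.
- intros lam Hl. exists (vmap lam a), (lmap lam g). auto.
Qed.

Definition value_claim (G : ctx) (X : env -> Prop) (e : expr) : Prop :=
  forall L g v, generic X L g -> exp_val semB G e g (Val v) ->
  forall m lam G' X', good_label m lam L -> sim m G X G' X' -> X' (lmap lam g) ->
    exp_val (sem V m) G' (tr m e) (lmap lam g) (Val (vmap lam v)).

Definition defined_claim (G : ctx) (X : env -> Prop) (e : expr) : Prop :=
  forall L g m lam G' X',
    generic X L g -> good_label m lam L -> sim m G X G' X' -> X' (lmap lam g) ->
    exists d, exp_val (sem V m) G' (tr m e) (lmap lam g) d.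

(* Every new sort is a set component of [v], so that it becomes basic as soon as
   [v] does. *)
Definition covers (L L' : list U) (v : U) : Prop :=
  forall k, In k L' -> In k L \/
    forall mu, basic V (vmap mu v) -> basic V (vset (repl mu k)).

Definition lift_claim (G : ctx) (X : env -> Prop) (s : expr) : Prop :=
  forall L g m lam G' X' w,
    generic X L g -> good_label m lam L -> sim m G X G' X' -> X' (lmap lam g) ->
    in_exp (sem V m) w G' (tr m s) (lmap lam g) ->
    exists L' lam' v, extends L L' /\ covers L L' v /\ good_label m lam' L' /\
      (forall k x, In k L -> x ∈ k -> lam' x = lam x) /\
      generic (declB G s X) L' (v :: g) /\ vmap lam' v = w.

Definition mem_claim (G : ctx) (X : env -> Prop) (s : expr) : Prop :=
  forall L g v m lam G' X',
    generic (declB G s X) L (v :: g) -> good_label m lam L ->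
    sim m G X G' X' -> X' (lmap lam g) ->
    in_exp (sem V m) (vmap lam v) G' (tr m s) (lmap lam g).

(** The four parts depend on one another: the value of a quantifier needs lifting and membership for
    its domain, a context can be extended only after the members of the declared type have been
    lifted, and definedness of the starred expression rests on typings that are transported by all
    of them. *)
Record claims (G : ctx) (X : env -> Prop) (e : expr) : Prop := {
  cl_defined : defined_claim G X e;
  cl_value : set_level e = true -> value_claim G X e;
  cl_lift : isB G e -> lift_claim G X e;
  cl_mem : isB G e -> mem_claim G X e
}.
Arguments cl_defined {_ _ _} _.
Arguments cl_value {_ _ _} _.
Arguments cl_lift {_ _ _} _.
Arguments cl_mem {_ _ _} _.

Lemma sim_refl G X : ctx_val semB G X -> sim Base G X G X.
Proof. intros H. split; auto. Qed.

Lemma claims_val G X e L g : claims G X e -> set_level e = true ->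
  ctx_val semB G X -> generic X L g ->
  exists v, exp_val semB G e g (Val v).
Proof.
intros C Hl HX Hg. pose proof (generic_id _ _ _ Hg) as HXg.
pose proof Hg as (HL & Hf & _).
destruct (cl_defined C L g Base (fun x => x) G X Hg (good_label_id HV HL Base) (sim_refl _ _ HX))
  as [d Hd].
- now rewrite (lmap_id L).
- rewrite (lmap_id L) in Hd by auto. pose proof (exp_val_level V _ _ _ _ _ _ goodB Hd) as K.
  simpl in K. rewrite Hl in K. destruct K as [v ->]. eauto.
Qed.

(** * Judgments carried to related contexts *)

Section Judgments.
Context {m : language} {G : ctx} {X : env -> Prop} {G' : ctx} {X' : env -> Prop}.
Context (HX : ctx_val semB G X) (S : sim m G X G' X').

Lemma sim_defined e : defined Base semB G e -> claims G X e -> defined m (sem V m) G' (tr m e).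
Proof.
intros He C. destruct m.
- destruct S as (_ & -> & ->). exact He.
- split; [exact I|]. exists X'. split; [apply S|]. intros g' Hg'.
  destruct (proj2 S g' Hg') as (L & g & lam & Hg & Hl & ->).
  now apply (cl_defined C L g Ext lam G' X').
Qed.

Lemma sim_is_Type s : isB G s -> claims G X s -> is_Type V m (sem V m) G' (tr m s).
Proof.
intros Hs C. split; [apply sim_defined; [apply Hs|exact C]|].
destruct m.
- destruct S as (_ & -> & ->). apply Hs.
- exists X'. split; [apply S|]. intros g' Hg'.
  destruct (proj2 S g' Hg') as (L & g & lam & Hg & Hl & ->).
  destruct (set_level s) eqn:Hlev.
  + destruct (is_Type_set Base semB G X s g goodB Hs Hlev HX (generic_id _ _ _ Hg))
      as (s0 & Hs0 & K0).
    exists (Val (vmap lam (vset s0))). split; [exact (cl_value C Hlev L g _ Hg K0 Ext lam G' X'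
      Hl S Hg')|].
    rewrite vmap_set. simpl. exists (repl (vmap lam) s0). split; [|reflexivity].
    pose proof Hg as (HL & (K & HK & Hf) & Hb & _).
    destruct (infer_sound HV HL s G X K g _ HX (generic_id _ _ _ Hg) HK Hf Hb Hlev K0) as [F B].
    apply (sval_vset_inv Ext). rewrite <- vmap_set.
    apply (vmap_sval HV HL Ext lam (infer K s)); auto. now apply infer_over.
  + destruct (cl_defined C L g Ext lam G' X' Hg Hl S Hg') as [d Hd].
    exists d. split; [exact Hd|].
    pose proof (exp_val_level V _ _ _ _ _ _ (sem_good V Ext) Hd) as K.
    rewrite set_level_tr, Hlev in K. destruct K as [D ->]. exact I.
Qed.

(** A typing holds at every environment of the context, hence at every relabelling of the pattern,
    and there the value of [u] is the relabelled [v]. *)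
Lemma generic_typed u s L g v :
  hasB G u s -> claims G X u -> generic X L g ->
  exp_val semB G u g (Val v) -> generic (declB G s X) L (v :: g).
Proof.
intros Hu C Hg Hv. pose proof Hu as (Hlev & _).
pose proof Hg as (HL & (K & HK & Hf) & Hb & HXl). pose proof (generic_id _ _ _ Hg) as HXg.
destruct (infer_sound HV HL u G X K g _ HX HXg HK Hf Hb Hlev Hv) as [F B].
apply (generic_cons G s X L (infer K u)); auto; [now apply infer_over|].
intros lam Hl. apply (has_type_val V Base semB G X u s); auto; [apply sem_det|].
apply (cl_value C Hlev L g v Hg Hv Base lam G X); auto using sim_refl.
Qed.

Lemma sim_has_type u s : hasB G u s -> claims G X u -> claims G X s ->
  has_type V m (sem V m) G' (tr m u) (tr m s).
Proof.
intros Hu Cu Cs. pose proof Hu as (Hlev & Du & Ts & Hmem).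
split; [now rewrite set_level_tr|split; [now apply sim_defined|split; [now apply sim_is_Type|]]].
destruct m.
- destruct S as (_ & -> & ->). exact Hmem.
- exists X'. split; [apply S|]. intros g' Hg'.
  destruct (proj2 S g' Hg') as (L & g & lam & Hg & Hl & ->).
  destruct (claims_val G X u L g Cu Hlev HX Hg) as [v Hv].
  pose proof (generic_typed u s L g v Hu Cu Hg Hv) as Hgv.
  destruct (cl_mem Cs Ts L g v Ext lam G' X' Hgv Hl S Hg') as (d & Hd & K).
  exists (vmap lam v), d. split; [|auto].
  exact (cl_value Cu Hlev L g v Hg Hv Ext lam G' X' Hl S Hg').
Qed.

(** By the lift claim, a member of the starred type over an instance of a pattern yields an instance
    of an extended pattern, so the environments of the extended context are again instances. *)
Lemma sim_decl s : isB G s -> claims G X s ->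
  sim m (Decl G s) (declB G s X) (Decl G' (tr m s)) (decl_env (sem V m) G' (tr m s) X').
Proof.
intros Hs C. split.
- apply (sem_decl HV); [apply S|now apply sim_is_Type].
- destruct m.
  + destruct S as (_ & -> & ->). auto.
  + intros g' (w & h & -> & Hh & Hw).
    destruct (proj2 S h Hh) as (L & g & lam & Hg & Hl & ->).
    destruct (cl_lift C Hs L g Ext lam G' X' w Hg Hl S Hh Hw) as (L' & lam' & v & He & _ & Hl' &
      E & Hgv & <-).
    exists L', (v :: g), lam'. split; [exact Hgv|split; [exact Hl'|]]. simpl. f_equal.
    apply (lmap_agree L); try apply Hg. intros k x Hk Hx. symmetry. eauto.
Qed.

Lemma decl_instance s L g v lam :
  isB G s -> claims G X s ->
  generic (declB G s X) L (v :: g) -> good_label m lam L -> X' (lmap lam g) ->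
  decl_env (sem V m) G' (tr m s) X' (lmap lam (v :: g)).
Proof.
intros Hs C Hg Hl HX'. exists (vmap lam v), (lmap lam g).
split; [reflexivity|split; [exact HX'|]]. now apply (cl_mem C Hs L g v m lam G' X').
Qed.

Lemma set_value s L g s0 lam w :
  value_claim G X s -> generic X L g -> exp_val semB G s g (Val (vset s0)) ->
  good_label m lam L -> X' (lmap lam g) ->
  in_exp (sem V m) w G' (tr m s) (lmap lam g) <-> exists a, a ∈ s0 /\ w = vmap lam a.
Proof.
intros C Hg Hs0 Hl HX'.
pose proof (C L g _ Hg Hs0 m lam G' X' Hl S HX') as H. rewrite vmap_set in H.
rewrite (in_exp_vset _ _ _ _ _ _ (sem_det V m) H), ZF_repl. reflexivity.
Qed.

(** Relabelling fixes truth values, so the commutation of evaluation with labellings becomes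
    invariance of truth. *)
Lemma holds_value p L g lam :
  hasB G p BoolC -> claims G X p -> generic X L g -> good_label m lam L ->
  X' (lmap lam g) ->
  holds semB G p g <-> holds (sem V m) G' (tr m p) (lmap lam g).
Proof.
intros Hp C Hg Hl HX'. pose proof Hp as (Hlev & _).
destruct (has_type_bool Base semB G X p g goodB Hp HX (generic_id _ _ _ Hg)) as [b Hb].
pose proof (cl_value C Hlev L g _ Hg Hb m lam G' X' Hl S HX') as H. rewrite vmap_bool in H.
unfold holds. split; intros K.
- pose proof (proj2 detB _ _ _ _ _ K Hb) as E. injection E as E.
  apply vbool_inj in E. now subst b.
- pose proof (proj2 (sem_det V m) _ _ _ _ _ K H) as E. injection E as E.
  apply vbool_inj in E. now subst b.
Qed.

End Judgments.

Lemma set_element G X s L g s0 a :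
  ctx_val semB G X -> value_claim G X s -> set_level s = true -> generic X L g ->
  exp_val semB G s g (Val (vset s0)) -> a ∈ s0 ->
  generic (declB G s X) L (a :: g).
Proof.
intros HX C Hlev Hg Hs0 Ha. pose proof Hg as (HL & (K & HK & Hf) & Hb & HXl).
destruct (infer_sound HV HL s G X K g _ HX (generic_id _ _ _ Hg) HK Hf Hb Hlev Hs0) as [F B].
pose proof (infer_over L s K HK) as Ho.
apply (fits_vset HL) in F; [|exact Ho]. destruct F as (c & Ec & _ & F). rewrite Ec in Ho.
apply (generic_cons G s X L c); auto.
- now apply (basic_vset_inv V s0 B).
- intros lam Hl. apply (set_value (sim_refl G X HX) s L g s0 lam); auto. eauto.
Qed.

(** At a pattern all elements of a set-level type share the inferred shape, and good labellings are
    injective on a shape. The invariance of equality and of products comes from this. *)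
Lemma set_elements_inj G X s L g S0 m lam :
  ctx_val semB G X -> set_level s = true -> generic X L g ->
  exp_val semB G s g (Val (vset S0)) -> good_label m lam L ->
  forall a b, a ∈ S0 -> b ∈ S0 -> vmap lam a = vmap lam b -> a = b.
Proof.
intros HX Hlev Hg K0 Hl a b Ha Hb E. pose proof Hg as (HL & (K & HK & Hf) & Hbas & _).
destruct (infer_sound HV HL s G X K g _ HX (generic_id _ _ _ Hg) HK Hf Hbas Hlev K0) as [F _].
pose proof (infer_over L s K HK) as Ho.
apply (fits_vset HL) in F; [|exact Ho]. destruct F as (c & Ec & _ & F). rewrite Ec in Ho.
apply (vmap_inj HL m lam c); auto.
Qed.

Lemma generic_at_id G s X L v g :
  generic (declB G s X) L (v :: g) -> in_exp semB v G s g.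
Proof.
intros H. apply generic_id in H. destruct H as (a & h & E & _ & Ha). injection E as <- <-. exact Ha.
Qed.

(** No sort is added: the members of the relabelled set are the relabelled members. *)
Lemma set_level_lift G X s : ctx_val semB G X -> set_level s = true ->
  isB G s -> value_claim G X s -> lift_claim G X s.
Proof.
intros HX Hlev Hs C L g m lam G' X' w Hg Hl S HX' Hw.
destruct (is_Type_set Base semB G X s g goodB Hs Hlev HX (generic_id _ _ _ Hg))
  as (s0 & _ & K0).
apply (set_value S s L g s0 lam w C Hg K0 Hl HX') in Hw. destruct Hw as (a & Ha & ->).
exists L, lam, a. split; [apply extends_refl|split; [intros k Hk; now left|split; [exact
  Hl|split; [auto|split; [|reflexivity]]]]].
now apply (set_element G X s L g s0).
Qed.

Lemma set_level_mem G X s : ctx_val semB G X -> set_level s = true ->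
  isB G s -> value_claim G X s -> mem_claim G X s.
Proof.
intros HX Hlev Hs C L g v m lam G' X' Hgv Hl S HX'.
pose proof (proj1 (generic_decl _ _ _ _ _ _ Hgv)) as Hg.
destruct (is_Type_set Base semB G X s g goodB Hs Hlev HX (generic_id _ _ _ Hg))
  as (s0 & _ & K0).
apply (set_value S s L g s0 lam _ C Hg K0 Hl HX'). exists v. split; [|reflexivity].
apply (in_exp_vset _ _ _ _ s0 _ detB K0). now apply generic_at_id in Hgv.
Qed.

Lemma le_defined m I J G e : le I J -> defined m I G e -> defined (U := U) m J G e.
Proof.
intros [H1 H2] (Hl & Y & HY & H). split; [exact Hl|]. exists Y. split; [auto|].
intros g Hg. destruct (H g Hg). eauto.
Qed.

Lemma le_is_Type m I J G s : le I J -> is_Type V m I G s -> is_Type V m J G s.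
Proof.
intros Hle [Hd (Y & HY & H)]. split; [now apply (le_defined m I)|]. exists Y.
split; [now apply Hle|]. intros g Hg. destruct (H g Hg) as (d & Kd & K). exists d.
split; [now apply Hle|exact K].
Qed.

Lemma le_has_type m I J G u s : le I J -> has_type V m I G u s -> has_type V m J G u s.
Proof.
intros Hle (Hlev & Hu & Hs & Y & HY & H).
split; [exact Hlev|split; [now apply (le_defined m I)|split; [now apply (le_is_Type m I)|]]].
exists Y. split; [now apply Hle|]. intros g Hg. destruct (H g Hg) as (a & d & H1 & H2 & H3).
exists a, d. repeat split; auto; now apply Hle.
Qed.

Lemma in_exp_intro m G X e g v :
  ctx_val (sem V m) G X -> X g -> premise V m (sem V m) G e -> type_former e = true ->
  members V (sem V m) G e g v -> in_exp (sem V m) v G e g.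
Proof.
intros HX Hg HP He Hv.
destruct (value_total HV m _ G X e g (sem_good V m) HX Hg HP) as [d Hd].
exists d. split; [now apply (sem_intro HV m G X)|].
rewrite value_type_former in Hd by exact He. now apply (in_collects V e _ d v) in Hd; apply Hd.
Qed.

Lemma generic_Sum G X s t L a b g :
  ctx_val semB G X -> isB G s -> isB (Decl G s) t ->
  generic (declB (Decl G s) t (declB G s X)) L (b :: a :: g) ->
  generic (declB G (Sum s t) X) L (vpair a b :: g).
Proof.
intros HX Hs Ht Gb.
destruct (generic_decl _ _ _ _ _ _ Gb) as (Ga2 & (cb & Hcb & Fb) & Bb & Ib).
destruct (generic_decl _ _ _ _ _ _ Ga2) as (Gg2 & (ca & Hca & Fa) & Ba & Ia).
apply (generic_cons G (Sum s t) X L (Spair ca cb)); auto.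
- simpl. auto.
- exists a, b. auto.
- now constructor.
- intros la Hla. rewrite vmap_pair. apply (in_exp_intro Base G X); auto.
  + now apply Gg2.
  + split; auto.
  + exists (vmap la a), (vmap la b). auto.
Qed.

Lemma generic_Sum_inv G X s t L v g :
  generic (declB G (Sum s t) X) L (v :: g) ->
  exists a b, v = vpair a b /\ generic (declB G s X) L (a :: g) /\
    generic (declB (Decl G s) t (declB G s X)) L (b :: a :: g).
Proof.
intros Hgv.
pose proof Hgv as (HL & _). destruct (generic_decl _ _ _ _ _ _ Hgv) as (Hg & (c & Hc & Hf) & Hb &
  I0).
apply generic_at_id in Hgv. apply (in_exp_members V Base) in Hgv; [|apply sem_good|reflexivity].
destruct Hgv as (a & b & -> & _). apply (fits_vpair HL) in Hf; [|exact Hc].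
destruct Hf as (ca & cb & -> & Fa & Fb). destruct Hc as [Hca Hcb]. apply basic_vpair_inv in Hb.
assert (Q : forall la, good_label Base la L -> in_exp semB (vmap la a) G s (lmap la g) /\
  in_exp semB (vmap la b) (Decl G s) t (vmap la a :: lmap la g)).
{ intros la Hla. specialize (I0 la Hla). apply (in_exp_members V Base) in I0; [|apply
  sem_good|reflexivity].
  destruct I0 as (a' & b' & E & Ia & Ib). rewrite vmap_pair in E. apply vpair_inj in E.
  destruct E; subst. auto. }
assert (Ga : generic (declB G s X) L (a :: g)).
{ apply (generic_cons G s X L ca); auto; [apply Hb|]. intros la Hla. now apply Q. }
assert (Gb : generic (declB (Decl G s) t (declB G s X)) L (b :: a :: g)).
{ apply (generic_cons (Decl G s) t _ L cb); auto; [apply Hb|]. intros la Hla. now apply Q. }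
eauto.
Qed.

(** Truth at the pattern is truth under the identity labelling, and by [holds_value] it passes to
    all labellings. *)
Lemma generic_Sub G X s p L v g :
  ctx_val semB G X -> isB G s ->
  hasB (Decl G s) p BoolC -> claims (Decl G s) (declB G s X) p ->
  generic (declB G s X) L (v :: g) -> holds semB (Decl G s) p (v :: g) ->
  generic (declB G (Sub s p) X) L (v :: g).
Proof.
intros HX Ts Hp Cp Ga Hh. pose proof (sem_decl HV Base G X s HX Ts) as HX1.
destruct (generic_decl _ _ _ _ _ _ Ga) as (Gg & (ca & Hca & Fa) & Ba & Ia).
apply (generic_cons G (Sub s p) X L ca); auto. intros la Hla.
apply (in_exp_intro Base G X); auto.
- now apply Gg.
- split; auto.
- split; [auto|].
  apply (holds_value HX1 (sim_refl _ _ HX1) p L (v :: g) la Hp Cp Ga Hla); [|exact Hh].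
  now apply Ga.
Qed.

Lemma generic_Sub_inv G X s p L v g :
  generic (declB G (Sub s p) X) L (v :: g) -> generic (declB G s X) L (v :: g).
Proof.
intros Hgv.
destruct (generic_decl _ _ _ _ _ _ Hgv) as (Hg & (c & Hc & Hf) & Hb & I0).
assert (Q : forall la, good_label Base la L -> in_exp semB (vmap la v) G s (lmap la g)).
{ intros la Hla. specialize (I0 la Hla). apply (in_exp_members V Base) in I0; [|apply
  sem_good|reflexivity].
  apply I0. }
assert (Ga : generic (declB G s X) L (v :: g)) by now apply (generic_cons G s X L c).
exact Ga.
Qed.

(** Every other constructor is set-level outright or has a premise that makes its components
    set-level. *)
Lemma class_cases m I G e : premise V m I G e -> set_level e = false ->
  e = SetC \/ e = BijC \/ (exists s t, e = Sum s t) \/ (exists s p, e = Sub s p).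
Proof.
assert (K : forall a b, a = true -> b = true -> (a && b)%bool = false -> False)
  by (intros a b -> ->; discriminate).
destruct e; simpl; intros HP Hl; try discriminate.
- auto.
- auto.
- destruct HP as (L1 & L2 & _). destruct (K _ _ L1 L2 Hl).
- destruct HP as (s & t & H & _). congruence.
- destruct HP as (s & t & H & _). congruence.
- destruct HP as ((L1 & _) & t & L2 & _). destruct (K _ _ L1 L2 Hl).
- destruct HP as (s & t & (L1 & _) & L2 & _). destruct (K _ _ L1 L2 Hl).
- destruct HP as ((L1 & _) & L2 & _). destruct (K _ _ L1 L2 Hl).
- right; right; left; eauto.
- right; right; right; eauto.
Qed.

(** * The induction step over the stages of the base semantics *)

Section Step.
Context {n : nat} (IH : forall G X e, ctx_val semB G X -> defined Base (stage V Base n) G e ->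
  claims G X e).
Notation stB := (stage V Base n).
Notation isN := (is_Type V Base stB).
Notation hasN := (has_type V Base stB).
Context {G : ctx} {X : env -> Prop} (HX : ctx_val semB G X) (HXn : ctx_val stB G X).

Let Hle : le stB semB := stage_le_sem V Base n.
Let HIn : good V Base stB := stage_good V Base n.

Lemma stage_decl s Y : ctx_val stB (Decl G s) Y ->
  isN G s /\ isB G s /\ claims G X s.
Proof.
intros HY. destruct (ctx_decl V Base stB G s Y X HIn HY HXn) as [Hs _].
split; [exact Hs|split; [now apply le_is_Type with stB|]]. apply IH; [exact HX|apply Hs].
Qed.

Lemma decl_claims s e : isB G s -> defined Base stB (Decl G s) e ->
  claims (Decl G s) (declB G s X) e.
Proof. intros Hs He. apply IH; [|exact He]. now apply (sem_decl HV). Qed.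

(** The auxiliary types of a premise are arbitrary, but they are defined at the earlier stage, so
    the induction hypothesis applies to them, and their translations witness the premise in the
    related context. *)
Lemma premise_sim m G' X' g' e :
  sim m G X G' X' -> X' g' -> in_language Base e -> premise V Base stB G e ->
  premise V m (sem V m) G' (tr m e).
Proof.
intros S Hg' Hlang HP.
assert (T1 : forall u s, hasN G u s -> has_type V m (sem V m) G' (tr m u) (tr m s)).
{ intros u s H. pose proof H as (_ & Du & Ts & _).
  apply (sim_has_type HX S); [now apply le_has_type with stB|apply IH; auto|apply IH; auto; apply
    Ts]. }
assert (T2 : forall s, isN G s -> is_Type V m (sem V m) G' (tr m s)).
{ intros s H. apply (sim_is_Type HX S); [now apply le_is_Type with stB|apply IH; auto; apply H]. }
assert (T3 : forall s u t, hasN (Decl G s) u t ->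
  has_type V m (sem V m) (Decl G' (tr m s)) (tr m u) (tr m t)).
{ intros s u t H. pose proof H as (_ & Du & Ts & Y & HY & _).
  destruct (stage_decl s Y HY) as (_ & Hs & Cs).
  apply (sim_has_type (sem_decl HV Base G X s HX Hs) (sim_decl HX S s Hs Cs));
    [now apply le_has_type with stB|apply decl_claims; auto|apply decl_claims; auto; apply Ts]. }
assert (T4 : forall s t, isN (Decl G s) t ->
  is_Type V m (sem V m) (Decl G' (tr m s)) (tr m t)).
{ intros s t H. pose proof H as (Dt & Y & HY & _).
  destruct (stage_decl s Y HY) as (_ & Hs & Cs).
  apply (sim_is_Type (sem_decl HV Base G X s HX Hs) (sim_decl HX S s Hs Cs));
    [now apply le_is_Type with stB|apply decl_claims; auto]. }
assert (T5 : forall u, defined Base stB G u -> defined m (sem V m) G' (tr m u)).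
{ intros u H. apply (sim_defined S); [now apply le_defined with stB|now apply IH]. }

assert (Tsort : forall u, hasN G u SetC -> has_type V m (sem V m) G' (tr m u) (sort_S m)).
{ intros u H. rewrite <- tr_SetC. auto. }
assert (T3sort : forall s u, hasN (Decl G s) u SetC ->
  has_type V m (sem V m) (Decl G' (tr m s)) (tr m u) (sort_S m)).
{ intros s u H. rewrite <- tr_SetC. auto. }
assert (Tbool : forall u, hasN G u BoolC -> has_type V m (sem V m) G' (tr m u) BoolC).
{ intros u H. rewrite <- (tr_BoolC m). auto. }
assert (T3bool : forall s u, hasN (Decl G s) u BoolC ->
  has_type V m (sem V m) (Decl G' (tr m s)) (tr m u) BoolC).
{ intros s u H. rewrite <- (tr_BoolC m). auto. }
rewrite tr_unfold. destruct e; simpl in HP |- *.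
- destruct m.
  + destruct S as (_ & -> & _). exact HP.
  + pose proof (proj2 (proj2 (sem_good V Ext)) _ _ _ (proj1 S) Hg') as E.
    destruct (proj2 S g' Hg') as (L & g & lam & Hg & _ & ->).
    rewrite length_map in E. rewrite <- E.
    rewrite (proj2 (proj2 goodB) _ _ _ HX (generic_id _ _ _ Hg)). exact HP.
- destruct m; simpl; auto.
- exact I.
- discriminate.
- rewrite !set_level_tr. intuition.
- destruct HP as (s & t & H). exists (tr m s), (tr m t). apply T1 in H. now destruct m.
- destruct HP as (s & t & H). exists (tr m s), (tr m t). apply T1 in H. now destruct m.
- destruct HP as [H1 [t H2]]. split; [auto|]. exists (tr m t). auto.
- destruct HP as (s & t & H1 & H2). exists (tr m s), (tr m t). split; [|auto].
  apply T1 in H1. now destruct m.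
- destruct HP as (s & H1 & H2 & H3). exists (tr m s). auto.
- auto.
- auto.
- intuition.
- intuition.
- intuition.
- intuition.
Qed.

Lemma step_defined e : in_language Base e -> premise V Base stB G e -> defined_claim G X e.
Proof.
intros Hlang HP L g m lam G' X' Hg Hl S HX'.
pose proof (premise_sim m G' X' _ e S HX' Hlang HP) as HP'.
destruct (value_total HV m _ G' X' _ _ (sem_good V m) (proj1 S) HX' HP') as [d Hd].
exists d. apply (sem_intro HV m G' X'); [apply S|exact HX'|exact HP'|exact Hd].
Qed.

Lemma stage_typed u s : hasN G u s ->
  set_level u = true /\ hasB G u s /\ claims G X u /\ claims G X s.
Proof.
intros H. pose proof H as (Hl & Du & Ts & _).
split; [exact Hl|split; [now apply le_has_type with stB|split; apply IH; auto; apply Ts]].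
Qed.

Lemma stage_decl_typed s u t : hasN (Decl G s) u t ->
  isB G s /\ claims G X s /\
  set_level u = true /\ hasB (Decl G s) u t /\
  claims (Decl G s) (declB G s X) u.
Proof.
intros H. pose proof H as (Hl & Du & Ts & Y & HY & _).
destruct (stage_decl s Y HY) as (_ & Hs & Cs).
split; [exact Hs|split; [exact Cs|split; [exact Hl|split; [now apply le_has_type with stB|]]]].
now apply decl_claims.
Qed.

Lemma stage_decl_type s t : isN G s -> isN (Decl G s) t ->
  isB G s /\ claims G X s /\
  isB (Decl G s) t /\ claims (Decl G s) (declB G s X) t.
Proof.
intros Hs Ht. assert (Hs' : isB G s) by now apply le_is_Type with stB.
split; [exact Hs'|split; [apply IH; auto; apply Hs|split; [now apply le_is_Type with stB|]]].
apply decl_claims; [exact Hs'|apply Ht].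
Qed.

(* The universal quantifier ranges over arbitrary values on the left but only over
   instances of patterns on the right; lifting along the identity labelling turns
   a value on the left into a pattern, which is then relabelled. *)
Lemma step_All s p L g lam m G' X' :
  hasN (Decl G s) p BoolC ->
  generic X L g -> good_label m lam L -> sim m G X G' X' -> X' (lmap lam g) ->
  (forall a, in_exp semB a G s g -> holds semB (Decl G s) p (a :: g)) <->
  (forall a, in_exp (sem V m) a G' (tr m s) (lmap lam g) ->
     holds (sem V m) (Decl G' (tr m s)) (tr m p) (a :: lmap lam g)).
Proof.
intros Hp Hg Hl S HX'. destruct (stage_decl_typed s p BoolC Hp) as (Hs & Cs & _ & Hp' & Cp).
pose proof (sem_decl HV Base G X s HX Hs) as HX1.
pose proof Hg as (HL & Hf & _).
assert (Ag : forall L' lam' mu, extends L L' -> (forall k x, In k L -> x ∈ k -> lam' x = mu x) ->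
  lmap lam' g = lmap mu g) by (intros; now apply (lmap_agree L)).
split; intros H w Hw.
- destruct (cl_lift Cs Hs L g m lam G' X' w Hg Hl S HX' Hw) as (L' & lam' & v & He & _ & Hl' & E
  & Hgv & <-).
  assert (E' : lmap lam' g = lmap lam g) by now apply (Ag L').
  pose proof (decl_instance S s L' g v lam' Hs Cs Hgv Hl') as HI. rewrite E' in HI.
  specialize (HI HX').
  pose proof (holds_value HX1 (sim_decl HX S s Hs Cs) p L' (v :: g) lam' Hp' Cp Hgv Hl') as K.
  cbn [map] in K, HI. rewrite E' in K, HI. apply (K HI). apply H. now apply generic_at_id in Hgv.
- assert (Hid : lmap (fun x => x) g = g) by now apply (lmap_id L).
  assert (HXg : X (lmap (fun x => x) g)) by (rewrite Hid; now apply generic_id in Hg).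
  destruct (cl_lift Cs Hs L g Base (fun x => x) G X w Hg (good_label_id HV HL Base) (sim_refl _ _
    HX) HXg)
    as (L' & mu & v & He & _ & Hl' & E & Hgv & <-); [now rewrite Hid|].
  assert (E' : lmap mu g = g) by (rewrite <- Hid at 2; now apply (Ag L')).
  assert (K1 : holds semB (Decl G s) p (v :: g) <-> holds semB (Decl G s) p (vmap mu v :: g)).
  { pose proof (decl_instance (sim_refl _ _ HX) s L' g v mu Hs Cs Hgv Hl') as HI.
    rewrite E' in HI. specialize (HI (generic_id _ _ _ Hg)).
    pose proof (holds_value HX1 (sim_refl _ _ HX1) p L' (v :: g) mu Hp' Cp Hgv Hl') as K.
    cbn [map] in K, HI. rewrite E' in K, HI. exact (K HI). }
  apply K1.
  pose proof Hgv as (HL' & _).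
  destruct (good_label_extension HV m lam L L' HL' He Hl) as (lam' & Hlam' & Elam).
  assert (El : lmap lam' g = lmap lam g) by now apply (Ag L').
  pose proof (decl_instance S s L' g v lam' Hs Cs Hgv Hlam') as HI. rewrite El in HI. specialize
    (HI HX').
  pose proof (holds_value HX1 (sim_decl HX S s Hs Cs) p L' (v :: g) lam' Hp' Cp Hgv Hlam') as K.
  cbn [map] in K, HI. rewrite El in K, HI. apply (K HI). apply H.
  rewrite <- El. apply (cl_mem Cs Hs L' g v m lam' G' X'); auto. now rewrite El.
Qed.

Lemma step_Lam s e : premise V Base stB G (Lam s e) -> forall L g v lam m G' X',
  generic X L g -> good_label m lam L -> sim m G X G' X' -> X' (lmap lam g) ->
  value V semB G (Lam s e) g (Val v) ->
  value V (sem V m) G' (Lam (tr m s) (tr m e)) (lmap lam g) (Val (vmap lam v)).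
Proof.
intros [Hs [t Ht]] L g v lam m G' X' Hg Hl S HX' (f & Hf & E). injection E as ->.
destruct (stage_decl_typed s e t Ht) as (Ts & Cs & Lev & Ht' & Ce).
destruct (stage_typed s SetC Hs) as (Levs & Hs' & _). pose proof (cl_value Cs Levs) as Vs.
destruct (is_Type_set Base semB G X s g goodB Ts Levs HX (generic_id _ _ _ Hg))
  as (S0 & _ & K0).
exists (map_graph (vmap lam) f). split; [|now rewrite vmap_fun].
intros p. rewrite mem_map_graph. split.
- intros (a & b & Hab & ->). apply Hf in Hab. destruct Hab as (a' & b' & Ha & Hb & E).
  apply opair_inj in E. destruct E; subst a' b'.
  apply (in_exp_vset _ _ _ _ S0 _ detB K0) in Ha.
  pose proof (set_element G X s L g S0 a HX (cl_value Cs Levs) Levs Hg K0 Ha) as Hga.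
  exists (vmap lam a), (vmap lam b). split; [|split; [|reflexivity]].
  + apply (set_value S s L g S0 lam); auto. eauto.
  + apply (cl_value Ce Lev L (a :: g) b Hga Hb m lam _ _ Hl (sim_decl HX S s Ts Cs)).
    now apply (decl_instance S s L).
(* The body has a value [b] at the pattern extended by [a]; by determinacy its relabelling is the
   given [b']. *)
- intros (a' & b' & Ha & Hb & ->).
  apply (set_value S s L g S0 lam) in Ha; auto.
  destruct Ha as (a & Ha & ->).
  pose proof (set_element G X s L g S0 a HX (cl_value Cs Levs) Levs Hg K0 Ha) as Hga.
  destruct (claims_val (Decl G s) _ e L (a :: g) Ce Lev (sem_decl HV Base G X s HX Ts) Hga) as [b
    Hb0].
  exists a, b. split.
  + apply Hf. exists a, b. split; [|auto]. now apply (in_exp_vset _ _ _ _ S0 _ detB K0).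
  + f_equal.
    pose proof (cl_value Ce Lev L (a :: g) b Hga Hb0 m lam _ _ Hl (sim_decl HX S s Ts Cs)
      (decl_instance S s L g a lam Ts Cs Hga Hl HX')) as Q.
    pose proof (proj2 (sem_det V m) _ _ _ _ _ Hb Q) as E. now injection E.
Qed.

Lemma collects_relabel e L g lam m G' X' e' v :
  set_level e = true -> set_level e' = true -> type_former e = true ->
  generic X L g -> good_label m lam L -> sim m G X G' X' -> X' (lmap lam g) ->
  exp_val semB G e g (Val v) ->
  (forall w, members V (sem V m) G' e' (lmap lam g) w <->
     exists a, members V semB G e g a /\ w = vmap lam a) ->
  collects V e' (members V (sem V m) G' e' (lmap lam g)) (Val (vmap lam v)).
Proof.
intros Hlev Hlev' Htf Hg Hl S HX' Hv H. pose proof Hg as (HL & (K & HK & Hf) & Hb & _).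
destruct (infer_sound HV HL e G X K g v HX (generic_id _ _ _ Hg) HK Hf Hb Hlev Hv) as [F B].
apply (good_exp V Base) in Hv; [|apply sem_good]. destruct Hv as (_ & _ & Hv).
rewrite value_type_former in Hv by exact Htf.
unfold collects in Hv |- *. rewrite Hlev in Hv. rewrite Hlev'.
destruct Hv as (s & Hs & Hs' & E). injection E as ->.
exists (repl (vmap lam) s). split; [|split; [|now rewrite vmap_set]].
- apply (sval_vset_inv m). rewrite <- vmap_set.
  apply (vmap_sval HV HL m lam (infer K e)); auto. now apply infer_over.
- intros w. rewrite H, ZF_repl. split; intros (a & Ha & ->); exists a; (split; [|reflexivity]);
    now apply Hs'.
Qed.

(** Domain and fibres of a dependent family, at the pattern and after relabelling. Injectivity on
    the domain and on each fibre is what allows functions between relabelled sets to be pulled back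
    to the pattern. *)
Lemma family_relabel s t L g lam m G' X' :
  isB G s -> claims G X s -> isB (Decl G s) t ->
  claims (Decl G s) (declB G s X) t -> set_level s = true -> set_level t = true ->
  generic X L g -> good_label m lam L -> sim m G X G' X' -> X' (lmap lam g) ->
  exists S0 T,
    (forall a, in_exp semB a G s g <-> a ∈ S0) /\
    (forall a b, a ∈ S0 -> in_exp semB b (Decl G s) t (a :: g) <-> b ∈ T a) /\
    (forall a', in_exp (sem V m) a' G' (tr m s) (lmap lam g) <->
       exists a, a ∈ S0 /\ a' = vmap lam a) /\
    (forall a b', a ∈ S0 ->
       in_exp (sem V m) b' (Decl G' (tr m s)) (tr m t) (vmap lam a :: lmap lam g) <->
       exists b, b ∈ T a /\ b' = vmap lam b) /\
    (forall a b, a ∈ S0 -> b ∈ S0 -> vmap lam a = vmap lam b -> a = b) /\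
    (forall a b b', a ∈ S0 -> b ∈ T a -> b' ∈ T a -> vmap lam b = vmap lam b' -> b = b').
Proof.
intros Ts Cs Ht Ct Levs Lev Hg Hl S HX'. pose proof (cl_value Cs Levs) as Vs.
pose proof (cl_value Ct Lev) as Vt. pose proof (generic_id _ _ _ Hg) as HXg.
destruct (is_Type_set Base semB G X s g goodB Ts Levs HX HXg) as (S0 & HS0 & K0).
destruct (decl_family Base semB G X s t g S0 goodB HX HXg K0 Ht Lev) as [T HT].
pose proof (sem_decl HV Base G X s HX Ts) as HX1. pose proof (sim_decl HX S s Ts Cs) as S1.
assert (HG : forall a, a ∈ S0 -> generic (declB G s X) L (a :: g))
  by (intros a Ha; now apply (set_element G X s L g S0)).
exists S0, T. split; [|split; [|split; [|split; [|split]]]].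
- intros a. apply (in_exp_vset _ _ _ _ S0 _ detB K0).
- intros a b Ha. apply (in_exp_vset _ _ _ _ (T a) _ detB). now apply HT.
- intros a'. now apply (set_value S s L).
- intros a b' Ha.
  exact (set_value S1 t L (a :: g) (T a) lam b' Vt (HG a Ha) (proj2 (HT a Ha)) Hl
    (decl_instance S s L g a lam Ts Cs (HG a Ha) Hl HX')).
- exact (set_elements_inj G X s L g S0 m lam HX Levs Hg K0 Hl).
- intros a b b' Ha.
  apply (set_elements_inj (Decl G s) _ t L (a :: g) (T a) m lam HX1 Lev (HG a Ha)); auto.
  now apply HT.
Qed.

Lemma step_Pi s t L g lam m G' X' :
  hasN G s SetC -> hasN (Decl G s) t SetC ->
  generic X L g -> good_label m lam L -> sim m G X G' X' -> X' (lmap lam g) ->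
  forall w, members V (sem V m) G' (Pi (tr m s) (tr m t)) (lmap lam g) w <->
    exists a, members V semB G (Pi s t) g a /\ w = vmap lam a.
Proof.
intros Hs Ht Hg Hl S HX' w.
destruct (stage_decl_typed s t SetC Ht) as (Ts & Cs & Lev & Ht' & Ct).
destruct (stage_typed s SetC Hs) as (Levs & _). apply (sort_is_Type Base) in Ht'; [|apply sem_good].
destruct (family_relabel s t L g lam m G' X' Ts Cs Ht' Ct Levs Lev Hg Hl S HX')
  as (S0 & T & memA & memB & HA & HB & inA & inB).
split.
- intros (f' & -> & Hfun & Hdom & Hcod).
  (* The pullback of [f'] along the labelling, inside the dependent sum of the family; injectivity
     on the fibres makes it single-valued. *)
  set (f := sep (fun p => exists a b, p = opair a b /\ opair (vmap lam a) (vmap lam b) ∈ f')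
    (graph S0 T)).
  assert (Hf : forall a b, opair a b ∈ f <-> a ∈ S0 /\ b ∈ T a /\ opair (vmap lam a) (vmap lam b)
    ∈ f').
  { intros a b. unfold f. rewrite ZF_sep, graph_mem. split.
    - intros [(x & y & Hx & Hy & E) (x' & y' & E' & H)]. apply opair_inj in E, E'.
      destruct E, E'; subst. auto.
    - intros (Ha & Hb & H). split; [exists a, b; auto|exists a, b; auto]. }
  exists (vfun f). split.
  + exists f. split; [reflexivity|split; [split|split]].
    * intros p Hp. unfold f in Hp. apply ZF_sep in Hp. destruct Hp as (_ & a & b & -> & _). eauto.
    * intros a b b' H1 H2. apply Hf in H1, H2. destruct H1 as (Ha & Hb & H1), H2 as (_ & Hb' & H2).
      apply (inB a); auto. eapply Hfun; eassumption.
    * intros a. rewrite memA. split.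
      -- intros Ha. assert (Ha' : exists a0, a0 ∈ S0 /\ vmap lam a = vmap lam a0) by eauto.
         apply HA, Hdom in Ha'. destruct Ha' as [b' Hab].
         pose proof (Hcod _ _ Hab) as K. apply HB in K; [|exact Ha]. destruct K as (b & Hb & ->).
         exists b. apply Hf. auto.
      -- intros [b Hab]. apply Hf in Hab. tauto.
    * intros a b Hab. apply Hf in Hab. destruct Hab as (Ha & Hb & _). now apply memB.
  + rewrite vmap_fun. f_equal. apply ZF_ext. intros p. rewrite mem_map_graph. split.
    * intros Hp. destruct (proj1 Hfun p Hp) as (a' & b' & ->).
      assert (Ha : in_exp (sem V m) a' G' (tr m s) (lmap lam g)) by (apply Hdom; eauto).
      apply HA in Ha. destruct Ha as (a & Ha & ->).
      pose proof (Hcod _ _ Hp) as K. apply HB in K; [|exact Ha]. destruct K as (b & Hb & ->).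
      exists a, b. split; [|reflexivity]. apply Hf. auto.
    * intros (a & b & Hab & ->). apply Hf in Hab. tauto.
- intros (v & (f & -> & Hfun & Hdom & Hcod) & ->). rewrite vmap_fun.
  exists (map_graph (vmap lam) f). split; [reflexivity|].
  assert (Hin : forall a b, opair a b ∈ f -> a ∈ S0 /\ b ∈ T a).
  { intros a b Hab. assert (Ha : a ∈ S0) by (apply memA, Hdom; eauto). split; [exact Ha|].
    apply memB; auto. }
  split; [split|split].
  + intros p Hp. apply mem_map_graph in Hp. destruct Hp as (a & b & _ & ->). eauto.
  + intros a' b' c' H1 H2. apply mem_map_graph in H1, H2.
    destruct H1 as (a & b & H1 & E1), H2 as (x & y & H2 & E2). apply opair_inj in E1, E2.
    destruct E1 as [-> ->], E2 as [E ->]. apply inA in E; [|now apply (Hin _ _ H1)|now apply (Hin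
      _ _ H2)].
    subst x. f_equal. eapply Hfun; eassumption.
  + intros a'. rewrite HA. split.
    * intros (a & Ha & ->). apply memA, Hdom in Ha. destruct Ha as [b Hab].
      exists (vmap lam b). apply mem_map_graph. eauto.
    * intros [b' Hab]. apply mem_map_graph in Hab. destruct Hab as (a & b & Hab & E).
      apply opair_inj in E. destruct E; subst. exists a. split; [now apply (Hin a b)|reflexivity].
  + intros a' b' Hab. apply mem_map_graph in Hab. destruct Hab as (a & b & Hab & E).
    apply opair_inj in E. destruct E; subst. apply Hin in Hab. apply HB; [tauto|].
    exists b. tauto.
Qed.

Lemma step_Sum s t L g lam m G' X' :
  isN G s -> isN (Decl G s) t ->
  set_level s = true -> set_level t = true ->
  generic X L g -> good_label m lam L -> sim m G X G' X' -> X' (lmap lam g) ->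
  forall w, members V (sem V m) G' (Sum (tr m s) (tr m t)) (lmap lam g) w <->
    exists a, members V semB G (Sum s t) g a /\ w = vmap lam a.
Proof.
intros Hs Ht Levs Lev Hg Hl S HX' w.
destruct (stage_decl_type s t Hs Ht) as (Ts & Cs & Ht' & Ct).
destruct (family_relabel s t L g lam m G' X' Ts Cs Ht' Ct Levs Lev Hg Hl S HX')
  as (S0 & T & memA & memB & HA & HB & _).
split.
- intros (a' & b' & -> & Ha & Hb). apply HA in Ha. destruct Ha as (a & Ha & ->).
  apply HB in Hb; [|exact Ha]. destruct Hb as (b & Hb & ->).
  exists (vpair a b). rewrite vmap_pair. split; [|reflexivity].
  exists a, b. split; [reflexivity|split; [now apply memA|now apply memB]].
- intros (v & (a & b & -> & Ha & Hb) & ->). apply memA in Ha. apply memB in Hb; [|exact Ha].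
  rewrite vmap_pair. exists (vmap lam a), (vmap lam b). split; [reflexivity|split].
  + apply HA. eauto.
  + apply HB; eauto.
Qed.

Lemma step_Sub s p L g lam m G' X' :
  isN G s -> hasN (Decl G s) p BoolC -> set_level s = true ->
  generic X L g -> good_label m lam L -> sim m G X G' X' -> X' (lmap lam g) ->
  forall w, members V (sem V m) G' (Sub (tr m s) (tr m p)) (lmap lam g) w <->
    exists a, members V semB G (Sub s p) g a /\ w = vmap lam a.
Proof.
intros Hs Hp Levs Hg Hl S HX' w.
destruct (stage_decl_typed s p BoolC Hp) as (Ts & Cs & _ & Hp' & Cp).
pose proof (cl_value Cs Levs) as Vs. pose proof (generic_id _ _ _ Hg) as HXg.
destruct (is_Type_set Base semB G X s g goodB Ts Levs HX HXg) as (S0 & HS0 & K0).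
pose proof (sim_decl HX S s Ts Cs) as S1. pose proof (sem_decl HV Base G X s HX Ts) as HX1.
assert (HA : forall a', in_exp (sem V m) a' G' (tr m s) (lmap lam g) <-> exists a, a ∈ S0 /\ a' =
  vmap lam a)
  by (intros a'; now apply (set_value S s L)).
assert (memA : forall a, in_exp semB a G s g <-> a ∈ S0)
  by (intros a; apply (in_exp_vset _ _ _ _ S0 _ detB K0)).
assert (HH : forall a, a ∈ S0 -> holds semB (Decl G s) p (a :: g) <->
  holds (sem V m) (Decl G' (tr m s)) (tr m p) (vmap lam a :: lmap lam g)).
{ intros a Ha. assert (HG : generic (declB G s X) L (a :: g))
    by now apply (set_element G X s L g S0).
  apply (holds_value HX1 S1 p L (a :: g) lam); auto. now apply (decl_instance S s L). }
split.
- intros [Ha Hw]. apply HA in Ha. destruct Ha as (a & Ha & ->). exists a.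
  split; [|reflexivity]. split; [now apply memA|now apply HH].
- intros (a & [Ha Ka] & ->). apply memA in Ha. split; [apply HA; eauto|now apply HH].
Qed.

Lemma step_value e : in_language Base e -> premise V Base stB G e -> set_level e = true ->
  value_claim G X e.
Proof.
intros Hlang HP Hlev L g v Hg Hv m lam G' X' Hl S HX'.
pose proof (premise_sim m G' X' _ e S HX' Hlang HP) as HP'.
apply (sem_intro HV m G' X'); [apply S|exact HX'|exact HP'|]. clear HP'.
pose proof Hv as Hv0. apply (good_exp V Base) in Hv; [|apply sem_good]. destruct Hv as (_ & _ & Hv).
pose proof (generic_id _ _ _ Hg) as HXg.
assert (CV : forall u s, hasN G u s -> value_claim G X u).
{ intros u s H. destruct (stage_typed u s H) as (Lu & _ & Cu & _). now apply cl_value. }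
rewrite tr_unfold. destruct e; try discriminate; cbv beta iota.
- destruct Hv as (a & Ha & E). injection E as ->.
  exists (vmap lam a). split; [|reflexivity]. now apply map_nth_error.
- apply (collects_relabel BoolC L g lam m G' X' BoolC); auto.
  intros w. split.
  + intros [b ->]. exists (vbool b). rewrite vmap_bool. split; [|reflexivity]. now exists b.
  + intros (a & [b ->] & ->). rewrite vmap_bool. now exists b.
- destruct HP as (L1 & L2 & D1 & D2). destruct Hv as (a & b & Ha & Hb' & E). injection E as ->.
  exists (vmap lam a), (vmap lam b). rewrite vmap_pair. split; [|split; [|reflexivity]].
  + exact (cl_value (IH G X e1 HX D1) L1 L g a Hg Ha m lam G' X' Hl S HX').
  + exact (cl_value (IH G X e2 HX D2) L2 L g b Hg Hb' m lam G' X' Hl S HX').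
- destruct HP as (s & t & H). destruct Hv as (a & b & Ha & E). injection E as ->.
  exists (vmap lam a), (vmap lam b). rewrite <- vmap_pair. split; [|reflexivity].
  exact (CV _ _ H L g _ Hg Ha m lam G' X' Hl S HX').
- destruct HP as (s & t & H). destruct Hv as (a & b & Ha & E). injection E as ->.
  exists (vmap lam a), (vmap lam b). rewrite <- vmap_pair. split; [|reflexivity].
  exact (CV _ _ H L g _ Hg Ha m lam G' X' Hl S HX').
- now apply (step_Lam e1 e2 HP L g v lam m G' X').
- destruct HP as (s & t & H1 & H2). destruct Hv as (h & a & b & Hh & Ha & Hab & E). injection E
  as ->.
  exists (map_graph (vmap lam) h), (vmap lam a), (vmap lam b). rewrite <- vmap_fun.
  split; [exact (CV _ _ H1 L g _ Hg Hh m lam G' X' Hl S HX')|].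
  split; [exact (CV _ _ H2 L g _ Hg Ha m lam G' X' Hl S HX')|].
  split; [|reflexivity]. apply mem_map_graph. eauto.
- destruct HP as (s & H1 & H2 & H3). destruct Hv as (a & b & c & Ha & Hb' & Hc & E). injection E
  as ->.
  exists (vmap lam a), (vmap lam b), c. rewrite vmap_bool.
  split; [exact (CV _ _ H1 L g _ Hg Ha m lam G' X' Hl S HX')|].
  split; [exact (CV _ _ H2 L g _ Hg Hb' m lam G' X' Hl S HX')|].
  split; [|reflexivity]. rewrite Hc. split; [now intros ->|].
  (* The clause for [Eq] places both sides in one set [s], and the labelling is injective on its
     elements, so equality is reflected as well as preserved. *)
  destruct (stage_typed _ _ H1) as (_ & T1 & _), (stage_typed _ _ H2) as (_ & T2 & _),
    (stage_typed _ _ H3) as (L3 & T3 & _). apply (sort_is_Type Base) in T3; [|apply sem_good].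
  destruct (is_Type_set Base semB G X s g goodB T3 L3 HX HXg) as (S0 & HS0 & K0).
  apply (set_elements_inj G X s L g S0 m lam HX L3 Hg K0 Hl);
    apply (in_exp_vset _ _ _ _ S0 _ detB K0);
    [apply (has_type_val V Base semB G X e1)|apply (has_type_val V Base semB G X e2)];
    auto; apply sem_det.
- destruct Hv as (b & Hb' & E). injection E as ->. exists b. rewrite vmap_bool.
  split; [|reflexivity]. rewrite Hb'. now apply (step_All e1 e2 L g lam m G' X').
- destruct Hv as (b & Hb' & E). injection E as ->. exists b. rewrite !vmap_bool.
  split; [|reflexivity]. rewrite <- (vmap_bool lam).
  exact (CV _ _ HP L g _ Hg Hb' m lam G' X' Hl S HX').
- destruct HP as [H1 H2]. destruct Hv as (b & b' & Hb1 & Hb2 & E). injection E as ->. exists b, b'.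
  rewrite !vmap_bool. rewrite <- (vmap_bool lam b), <- (vmap_bool lam b').
  split; [exact (CV _ _ H1 L g _ Hg Hb1 m lam G' X' Hl S HX')|].
  split; [exact (CV _ _ H2 L g _ Hg Hb2 m lam G' X' Hl S HX')|reflexivity].
- destruct HP as [H1 H2].
  apply (collects_relabel (Pi e1 e2) L g lam m G' X'); auto; [simpl; now rewrite !set_level_tr|].
  now apply (step_Pi e1 e2 L g lam m G' X').
- destruct HP as [H1 H2]. pose proof Hlev as Hlev'. simpl in Hlev'. apply andb_prop in Hlev'.
  apply (collects_relabel (Sum e1 e2) L g lam m G' X'); auto; [simpl; now rewrite !set_level_tr|].
  now apply (step_Sum e1 e2 L g lam m G' X').
- destruct HP as [H1 H2].
  apply (collects_relabel (Sub e1 e2) L g lam m G' X'); auto; [simpl; now rewrite !set_level_tr|].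
  now apply (step_Sub e1 e2 L g lam m G' X').
Qed.

(** An arbitrary set of the language is captured without looking into its elements: a fresh sort
    receives one atom for each element, labelled by that element, and the pattern is the set of
    these atoms. *)
Lemma lift_SetC : lift_claim G X SetC.
Proof.
intros L g m lam G' X' w Hg Hl S HX' Hw. rewrite tr_SetC in Hw.
apply (in_exp_members V m) in Hw; [|apply sem_good|now destruct m].
assert (Hw' : sval (V := V) m w /\ exists s, w = vset s) by now destruct m.
clear Hw. destruct Hw' as [Hw [S0 ->]].
pose proof (sval_vset_inv m S0 Hw) as [HS0 HS].
pose proof Hg as (HL & Hf & _).
set (N := fresh_index L). assert (HN : N ∈ V) by now apply fresh_index_univ.
set (at_ := fun x : U => vatom (opair N x)).
set (k := repl at_ S0).
(* The inverse of [at_], which serves as the labelling of the new sort. *)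
set (mu := fun a => epsilon (inhabits empty) (fun x => a = at_ x)).
assert (Hmu : forall x, mu (at_ x) = x).
{ intros x. unfold mu.
  pose proof (epsilon_spec (inhabits empty) (fun y => at_ x = at_ y) (ex_intro _ x eq_refl)) as E.
  unfold at_ in E at 1. apply vatom_inj, opair_inj in E. symmetry. apply E. }
assert (HatV : forall x, x ∈ S0 -> opair N x ∈ V).
{ intros x Hx. apply (univ_opair HV); [exact HN|]. now apply (univ_trans HV) with S0. }
assert (Hk : k ∈ V /\ forall x, x ∈ k -> exists y, y ∈ V /\ x = vatom y).
{ split.
  - apply (univ_repl HV); [exact HS0|]. intros x Hx. apply (univ_vatom HV). auto.
  - intros x Hx. apply ZF_repl in Hx. destruct Hx as (y & Hy & ->). exists (opair N y). auto. }
assert (HkL : sort_atoms (k :: L)).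
{ intros k' [<-|Hk']; [exact Hk|now apply HL]. }
assert (Hdis : forall k' x, In k' L -> x ∈ k' -> ~ x ∈ k).
{ intros k' x Hk' Hx Hxk. apply ZF_repl in Hxk. destruct Hxk as (y & _ & ->).
  now apply fresh_index_notin in Hx. }
assert (Hext : extends L (k :: L)).
{ split; [now apply incl_tl, incl_refl|]. intros k' [<-|Hk']; auto. }
assert (Hgmu : good_label m mu [k]).
{ intros k' [<-|[]]. split.
  - intros x y Hx Hy. apply ZF_repl in Hx, Hy. destruct Hx as (x' & _ & ->), Hy as (y' & _ & ->).
    rewrite !Hmu. now intros ->.
  - replace (repl mu k) with S0; [exact Hw|]. apply ZF_ext. intros x. rewrite ZF_repl. split.
    + intros Hx. exists (at_ x). rewrite Hmu. split; [|reflexivity]. apply ZF_repl. eauto.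
    + intros (y & Hy & ->). apply ZF_repl in Hy. destruct Hy as (z & Hz & ->). now rewrite Hmu. }
set (lam' := extend_label L lam mu).
assert (Hl' : good_label m lam' (k :: L)).
{ apply good_label_extend; auto. intros k' [<-|Hk'] Hn; [exact Hgmu|contradiction]. }
assert (Hb : basic V (vset k)).
{ constructor; [apply Hk|]. intros x Hx. destruct (proj2 Hk x Hx) as (y & Hy & ->). now
  constructor. }
assert (Hfit : fits (Sset (Ssort k)) (vset k)).
{ exists k. split; [reflexivity|split; [apply Hk|auto]]. }
exists (k :: L), lam', (vset k).
split; [exact Hext|split; [|split; [exact Hl'|split; [|split]]]].
(* The new sort is the underlying set of the pattern itself, so both relabel to the same set. *)
- intros k' [<-|Hk']; [right|now left]. intros nu. rewrite vmap_set.
  replace (repl (vmap nu) k) with (repl nu k); [auto|]. apply ZF_ext. intros x. rewrite !ZF_repl.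
  split; intros (y & Hy & ->); exists y; (split; [exact Hy|]);
    destruct (proj2 Hk y Hy) as (z & _ & ->); now rewrite vmap_atom.
- intros k' x. apply extend_label_old.
- apply (generic_cons G SetC X (k :: L) (Sset (Ssort k))); auto.
  + apply (generic_incl X L); auto. apply Hext.
  + simpl. auto.
  + intros la Hla. apply (in_exp_intro Base G X); auto.
    * apply Hg. apply (good_label_incl Base la L (k :: L)); auto. apply Hext.
    * exact I.
    * split; [|rewrite vmap_set; eauto].
      apply (vmap_sval HV HkL Base la (Sset (Ssort k))); simpl; auto.
- rewrite vmap_set. f_equal. apply ZF_ext. intros x. rewrite ZF_repl.
  assert (E : forall y, y ∈ S0 -> vmap lam' (at_ y) = y).
  { intros y Hy. unfold at_. rewrite vmap_atom. fold (at_ y).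
    unfold lam'. rewrite (extend_label_new L lam mu k), Hmu; auto.
    apply ZF_repl. eauto. }
  split.
  + intros (y & Hy & ->). apply ZF_repl in Hy. destruct Hy as (z & Hz & ->). now rewrite E.
  + intros Hx. exists (at_ x). rewrite E by exact Hx. split; [|reflexivity]. apply ZF_repl. eauto.
Qed.

Lemma mem_SetC : mem_claim G X SetC.
Proof.
intros L g v m lam G' X' Hgv Hl S HX'. rewrite tr_SetC.
pose proof Hgv as (HL & _). destruct (generic_decl _ _ _ _ _ _ Hgv) as (_ & (c & Hc & Hf) & Hb & _).
apply generic_at_id in Hgv. apply (in_exp_members V Base) in Hgv; [|apply sem_good|reflexivity].
destruct Hgv as [_ [s ->]].
pose proof (vmap_sval HV HL m lam c _ Hl Hc Hf Hb) as Hv.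
apply (in_exp_intro m G' X'); auto.
- apply S.
- destruct m; [exact I|reflexivity].
- now destruct m.
- destruct m; (split; [exact Hv|rewrite vmap_set; eauto]).
Qed.

(** The second component is lifted over the pattern extended by the first. The second labelling
    agrees with the first one on the sorts already present, so the first component keeps its
    value. *)
Lemma lift_Sum s t : isN G s -> isN (Decl G s) t ->
  lift_claim G X (Sum s t).
Proof.
intros Hs Ht L g m lam G' X' w Hg Hl S HX' Hw.
destruct (stage_decl_type s t Hs Ht) as (Ts & Cs & Ht' & Ct).
pose proof (sem_decl HV Base G X s HX Ts) as HX1. pose proof (sim_decl HX S s Ts Cs) as S1.
rewrite tr_unfold in Hw.
apply (in_exp_members V m) in Hw; [|apply sem_good|reflexivity].
destruct Hw as (a' & b' & -> & Ha & Hb).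
destruct (cl_lift Cs Ts L g m lam G' X' a' Hg Hl S HX' Ha) as (L1 & lam1 & a & He1 & Hc1 & Hl1 &
  E1 & Ga & <-).
pose proof Hg as (HL & Hf & _).
assert (E : lmap lam1 g = lmap lam g) by now apply (lmap_agree L).
assert (HXa : decl_env (sem V m) G' (tr m s) X' (lmap lam1 (a :: g))).
{ exists (vmap lam1 a), (lmap lam g). split; [cbn [map]; now rewrite E|auto]. }
destruct (cl_lift Ct Ht' L1 (a :: g) m lam1 _ _ b' Ga Hl1 S1 HXa) as (L2 & lam2 & b & He2 & Hc2 &
  Hl2 & E2 & Gb & <-).
{ cbn [map]. now rewrite E. }
exists L2, lam2, (vpair a b).
split; [now apply extends_trans with L1|split; [|split; [exact Hl2|split; [|split]]]].
- intros k Hk. destruct (Hc2 k Hk) as [Hk1|H]; [destruct (Hc1 k Hk1) as [Hk0|H]; [now left|]|];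
    right; intros mu; rewrite vmap_pair; intros Hb'; apply basic_vpair_inv in Hb'; apply H; apply
      Hb'.
- intros k x Hk Hx. rewrite (E2 k x); [now apply (E1 k)| |exact Hx]. now apply He1.
- now apply generic_Sum.
- rewrite vmap_pair. f_equal. destruct (generic_decl _ _ _ _ _ _ Ga) as (_ & (ca & Hca & Fa) & _).
  apply (vmap_agree (proj1 Ga) _ _ ca); auto.
Qed.

Lemma mem_Sum s t : isN G s -> isN (Decl G s) t ->
  in_language Base (Sum s t) -> mem_claim G X (Sum s t).
Proof.
intros Hs Ht Hlang L g v m lam G' X' Hgv Hl S HX'.
destruct (stage_decl_type s t Hs Ht) as (Ts & Cs & Ht' & Ct).
pose proof (sem_decl HV Base G X s HX Ts) as HX1. pose proof (sim_decl HX S s Ts Cs) as S1.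
pose proof (premise_sim m G' X' _ (Sum s t) S HX' Hlang (conj Hs Ht)) as HP'.
rewrite tr_unfold in HP' |- *.
apply (in_exp_intro m G' X'); auto; [apply S|].
destruct (generic_Sum_inv G X s t L v g Hgv) as (a & b & -> & Ga & Gb).
rewrite vmap_pair. exists (vmap lam a), (vmap lam b). split; [reflexivity|split].
- now apply (cl_mem Cs Ts L g a m lam G' X').
- apply (cl_mem Ct Ht' L (a :: g) b m lam _ _ Gb Hl S1). now apply (decl_instance S s L).
Qed.

(** A lift for the base type serves the subtype too, since truth of the formula descends from the
    instance to the pattern. *)
Lemma lift_Sub s p : isN G s -> hasN (Decl G s) p BoolC ->
  lift_claim G X (Sub s p).
Proof.
intros Hs Hp L g m lam G' X' w Hg Hl S HX' Hw.
destruct (stage_decl_typed s p BoolC Hp) as (Ts & Cs & _ & Hp' & Cp).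
pose proof (sem_decl HV Base G X s HX Ts) as HX1. pose proof (sim_decl HX S s Ts Cs) as S1.
rewrite tr_unfold in Hw.
apply (in_exp_members V m) in Hw; [|apply sem_good|reflexivity]. destruct Hw as [Hw Hh].
destruct (cl_lift Cs Ts L g m lam G' X' w Hg Hl S HX' Hw) as (L1 & lam1 & a & He1 & Hc1 & Hl1 &
  E1 & Ga & <-).
exists L1, lam1, a. split; [exact He1|split; [exact Hc1|split; [exact Hl1|split; [exact E1|split;
  [|reflexivity]]]]].
pose proof Hg as (HL & Hf & _).
assert (E : lmap lam1 g = lmap lam g) by now apply (lmap_agree L).
assert (HXa : decl_env (sem V m) G' (tr m s) X' (lmap lam1 (a :: g))).
{ exists (vmap lam1 a), (lmap lam g). split; [cbn [map]; now rewrite E|auto]. }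
pose proof (holds_value HX1 S1 p L1 (a :: g) lam1 Hp' Cp Ga Hl1 HXa) as K.
cbn [map] in K. rewrite E in K. apply K in Hh.
now apply generic_Sub.
Qed.

Lemma mem_Sub s p : isN G s -> hasN (Decl G s) p BoolC ->
  in_language Base (Sub s p) -> mem_claim G X (Sub s p).
Proof.
intros Hs Hp Hlang L g v m lam G' X' Hgv Hl S HX'.
destruct (stage_decl_typed s p BoolC Hp) as (Ts & Cs & _ & Hp' & Cp).
pose proof (sem_decl HV Base G X s HX Ts) as HX1. pose proof (sim_decl HX S s Ts Cs) as S1.
pose proof (premise_sim m G' X' _ (Sub s p) S HX' Hlang (conj Hs Hp)) as HP'.
rewrite tr_unfold in HP' |- *.
apply (in_exp_intro m G' X'); auto; [apply S|].
pose proof (generic_Sub_inv G X s p L v g Hgv) as Ga.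
split; [now apply (cl_mem Cs Ts L g v m lam G' X')|].
apply (holds_value HX1 S1 p L (v :: g) lam Hp' Cp Ga Hl).
- now apply (decl_instance S s L).
- apply generic_at_id in Hgv. apply (in_exp_members V Base) in Hgv; [|apply sem_good|reflexivity].
  apply Hgv.
Qed.

Lemma step_claims e : in_language Base e -> premise V Base stB G e -> claims G X e.
Proof.
intros Hlang HP. split.
- now apply step_defined.
- intros Hlev. now apply step_value.
- intros Ts. destruct (set_level e) eqn:Hlev.
  + apply set_level_lift; auto. now apply step_value.
  + destruct (class_cases _ _ _ _ HP Hlev) as [->|[->|[(s & t & ->)|(s & p & ->)]]].
    * apply lift_SetC.
    * discriminate Hlang.
    * destruct HP. now apply lift_Sum.
    * destruct HP. now apply lift_Sub.
- intros Ts. destruct (set_level e) eqn:Hlev.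
  + apply set_level_mem; auto. now apply step_value.
  + destruct (class_cases _ _ _ _ HP Hlev) as [->|[->|[(s & t & ->)|(s & p & ->)]]].
    * apply mem_SetC.
    * discriminate Hlang.
    * destruct HP. now apply mem_Sum.
    * destruct HP. now apply mem_Sub.
Qed.

End Step.

Lemma stage_claims n : forall G X e,
  ctx_val semB G X -> defined Base (stage V Base n) G e -> claims G X e.
Proof.
induction n as [|n IH]; intros G X e HX He.
{ destruct He as (_ & Y & [] & _). }
(* The premise of the clause of [e] is available only through a value at some environment. Without
   environments there are no patterns, as a pattern is itself an environment of its context, and the
   claims are vacuous. *)
destruct (classic (exists g, X g)) as [[g Hg]|HE].
- assert (HXn : ctx_val (stage V Base (S n)) G X).
  { destruct He as (_ & Y & HY & _). replace X with Y; [exact HY|].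
    apply (proj1 detB G); [now exists (S n)|exact HX]. }
  destruct (defined_at _ _ _ _ _ g (proj1 (stage_good V Base (S n))) He HXn Hg) as [d Hd].
  destruct Hd as [(Y & HY & Hg') HC].
  assert (E : Y = X) by (apply (proj1 detB G); [now exists n|exact HX]). subst Y.
  apply exp_clause_iff in HC; [|now apply (proj2 (proj2 (stage_good V Base n)) G X)].
  apply (step_claims IH HX HY e); [apply He|apply HC].
- assert (K : forall L g, ~ generic X L g) by (intros L g Hg; apply HE; exists g; now apply
  generic_id in Hg).
  split.
  + intros L g m lam G' X' Hg. now destruct (K L g).
  + intros _ L g v Hg. now destruct (K L g).
  + intros _ L g m lam G' X' w Hg. now destruct (K L g).
  + intros _ L g v m lam G' X' Hg. apply generic_decl in Hg. now destruct (K L g).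
Qed.

Lemma sem_claims G X e : ctx_val semB G X -> defined Base semB G e -> claims G X e.
Proof.
intros HX He. destruct (defined_stage HV Base G e He) as [n Hn]. now apply (stage_claims n);
  [|apply Hn].
Qed.

End Invariance.

(** * Base contexts read in the extended language *)

Section Contexts.
Context {U : ZF} {V : U} (HV : grothendieck V).
Notation env := (@env U).
Notation semB := (sem V Base).
Notation isB := (is_Type V Base semB).
Notation hasB := (has_type V Base semB).
Notation declB := (decl_env semB).
Notation detB := (sem_det V Base).
Notation goodB := (sem_good V Base).
Notation semE := (sem V Ext).
Notation fits := (fits (V := V)).
Notation sort_atoms := (sort_atoms (V := V)).
Notation good_label := (good_label (V := V)).
Notation generic := (generic (V := V)).
Notation instance := (instance (V := V)).
Notation sim := (sim (V := V)).
Notation lmap lam := (map (vmap lam)).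

Lemma ctx_Nil_inv m X : ctx_val (sem V m) Nil X -> X = fun g => g = [].
Proof.
intros H. apply (sem_good V m) in H. extensionality g. apply propositional_extensionality, H.
Qed.

Lemma ctx_Decl_inv m G s X1 : ctx_val (sem V m) (Decl G s) X1 ->
  exists X, ctx_val (sem V m) G X /\ is_Type V m (sem V m) G s /\ X1 = decl_env (sem V m) G s X.
Proof.
intros H. pose proof H as H0. apply (sem_good V m) in H0.
destruct H0 as (Hs & X & HX & _). exists X. split; [exact HX|split; [exact Hs|]].
apply (proj1 (sem_det V m) _ _ _ H). now apply sem_decl.
Qed.

Lemma ctx_Hyp_inv m G p X1 : ctx_val (sem V m) (Hyp G p) X1 ->
  exists X, ctx_val (sem V m) G X /\ has_type V m (sem V m) G p BoolC /\
    X1 = fun g => X g /\ holds (sem V m) G p g.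
Proof.
intros H. pose proof H as H0. apply (sem_good V m) in H0.
destruct H0 as (Hs & X & HX & _). exists X. split; [exact HX|split; [exact Hs|]].
apply (proj1 (sem_det V m) _ _ _ H). now apply sem_hyp.
Qed.

Lemma Set_Bij G u : has_type V Ext semE G u SetC -> has_type V Ext semE G u BijC.
Proof.
intros Hu. pose proof Hu as (Hl & Du & _ & X & HX & _).
assert (HB : forall g, X g -> exists C, exp_val semE G BijC g (Cls C) /\
  forall a, C a <-> bijective V a /\ exists s, a = vset s).
{ intros g Hg. exists (fun a => bijective V a /\ exists s, a = vset s). split; [|reflexivity].
  apply (sem_intro HV Ext G X); auto; [reflexivity|].
  exists (fun a => bijective V a /\ exists s, a = vset s). split; reflexivity. }
split; [exact Hl|split; [exact Du|split]].
- split.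
  + split; [exact I|]. exists X. split; [exact HX|]. intros g Hg. destruct (HB g Hg) as (C & HC &
    _). eauto.
  + exists X. split; [exact HX|]. intros g Hg. destruct (HB g Hg) as (C & HC & _).
    exists (Cls C). split; [exact HC|exact I].
- exists X. split; [exact HX|]. intros g Hg. destruct (HB g Hg) as (C & HC & H).
  destruct (has_type_at V _ _ _ _ _ _ g (sem_det V Ext) Hu HX Hg) as (a & Ha & K).
  apply (in_exp_members V Ext) in K; [|apply sem_good|reflexivity]. destruct K as [K1 K2].
  exists a, (Cls C). split; [exact Ha|split; [exact HC|]]. apply H.
  split; [now apply (basic_bijective HV)|exact K2].
Qed.

Lemma base_ext_transfer G X : ctx_val semB G X -> ctx_val semE G X ->
  transfer Base Ext semB semE Var G G X X (fun g => g).
Proof.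
intros HB HE. apply (renaming_transfer HV Base Ext G G X X (fun n => n) (fun g => g)); auto.
intros H u. apply Set_Bij.
Qed.

(** [iso_at] evaluates a starred type in the extended language under an unstarred context at
    environments of the base semantics, so both interpretations of the context must agree. *)
Lemma base_ext_ctx G : forall X, ctx_val semB G X -> ctx_val semE G X.
Proof.
induction G as [|G IH s|G IH p]; intros X HX.
- apply ctx_Nil_inv in HX. subst X. exists 1. simpl. tauto.
- apply ctx_Decl_inv in HX. destruct HX as (X0 & HX0 & Hs & ->).
  pose proof (base_ext_transfer G X0 HX0 (IH _ HX0)) as T.
  replace (declB G s X0) with (decl_env semE G s X0).
  + apply (sem_decl HV); [now apply IH|].
    rewrite <- (subst_Var s). now apply (tr_is_Type V T detB).
  + extensionality g'. apply propositional_extensionality. unfold decl_env.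
    split; intros (a & g & -> & Hg & Ha); exists a, g; (split; [reflexivity|split; [exact Hg|]]).
    * apply (tr_in_exp T detB (sem_det V Ext)); [exact Hg|apply Hs|]. now rewrite subst_Var.
    * apply (tr_in_exp T detB (sem_det V Ext)) in Ha; [|exact Hg|apply Hs].
      now rewrite subst_Var in Ha.
- apply ctx_Hyp_inv in HX. destruct HX as (X0 & HX0 & Hp & ->).
  pose proof (base_ext_transfer G X0 HX0 (IH _ HX0)) as T.
  replace (fun g => X0 g /\ holds semB G p g) with (fun g => X0 g /\ holds semE G p g).
  + apply (sem_hyp HV); [now apply IH|].
    rewrite <- (subst_Var p), <- (subst_Var BoolC). now apply (tr_has_type V T detB).
  + extensionality g. apply propositional_extensionality. unfold holds.
    split; intros [Hg Hh]; (split; [exact Hg|]).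
    * apply (tr_val_iff T detB (sem_det V Ext)); [exact Hg|apply Hp|]. now rewrite subst_Var.
    * apply (tr_val_iff T detB (sem_det V Ext)) in Hh; [|exact Hg|apply Hp].
      now rewrite subst_Var in Hh.
Qed.

(** The pattern is built along the context: a declared value is lifted over the pattern found so
    far, and a hypothesis that is true at one instance is true at all. *)
Lemma base_instance G : forall X g, ctx_val semB G X -> X g -> instance Base X g.
Proof.
induction G as [|G IH s|G IH p]; intros X g HX Hg.
- apply ctx_Nil_inv in HX. subst X. subst g. exists [], [], (fun x => x).
  split; [|split; [intros k []|reflexivity]].
  split; [intros k []|split; [|split; auto]]. exists []. auto.
- apply ctx_Decl_inv in HX. destruct HX as (X0 & HX0 & Hs & ->).
  destruct Hg as (a & h & -> & Hh & Ha).
  pose proof (sem_claims HV G X0 s HX0 (proj1 Hs)) as C.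
  destruct (IH X0 h HX0 Hh) as (L & g & lam & Hg & Hl & ->).
  destruct (cl_lift G X0 s C Hs L g Base lam G X0 a Hg Hl (sim_refl _ _ HX0) Hh Ha)
    as (L' & lam' & v & He & _ & Hl' & E & Hgv & <-).
  exists L', (v :: g), lam'. split; [exact Hgv|split; [exact Hl'|]]. simpl. f_equal.
  apply (lmap_agree (V := V) L); try apply Hg. intros k x Hk Hx. symmetry. eauto.
- apply ctx_Hyp_inv in HX. destruct HX as (X0 & HX0 & Hp & ->). destruct Hg as [Hg Hh].
  pose proof (sem_claims HV G X0 p HX0 (proj1 (proj2 Hp))) as C.
  destruct (IH X0 g HX0 Hg) as (L & g0 & lam & Hg0 & Hl & ->).
  exists L, g0, lam. split; [|auto]. pose proof Hg0 as (HL & Hf & Hb & H).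
  split; [exact HL|split; [exact Hf|split; [exact Hb|]]]. intros mu Hmu. split; [auto|].
  apply (holds_value HV HX0 (sim_refl _ _ HX0) p L g0 mu); auto.
  apply (holds_value HV HX0 (sim_refl _ _ HX0) p L g0 lam) in Hh; auto.
Qed.

Lemma base_ext_sim G X : ctx_val semB G X -> sim Ext G X G X.
Proof.
intros HX. split; [now apply base_ext_ctx|]. intros g Hg.
destruct (base_instance G X g HX Hg) as (L & g0 & lam & Hg0 & Hl & ->).
exists L, g0, lam. split; [exact Hg0|split; [|reflexivity]]. now apply good_label_Ext.
Qed.

Lemma type_basic G X s g a : ctx_val semB G X -> isB G s -> X g ->
  in_exp semB a G s g -> basic V a.
Proof.
intros HX Hs Hg Ha. pose proof (sem_claims HV G X s HX (proj1 Hs)) as C.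
destruct (base_instance G X g HX Hg) as (L & g0 & lam & Hg0 & Hl & ->).
destruct (cl_lift G X s C Hs L g0 Base lam G X a Hg0 Hl (sim_refl _ _ HX) Hg Ha)
    as (L' & lam' & v & He & _ & Hl' & E & Hgv & <-).
destruct (generic_decl _ _ _ _ _ _ Hgv) as (_ & (c & Hc & Hf) & Hb & _).
exact (vmap_sval HV (proj1 Hgv) Base lam' c v Hl' Hc Hf Hb).
Qed.

(** * Quotients of patterns *)

Fixpoint smap (q : U -> U) (c : @shape U) : @shape U :=
  match c with
  | Sbool => Sbool
  | Ssort k => Ssort (repl q k)
  | Spair c d => Spair (smap q c) (smap q d)
  | Sarr c d => Sarr (smap q c) (smap q d)
  | Sset c => Sset (smap q c)
  end.

Lemma elt_smap q c : elt_shape (smap q c) = smap q (elt_shape c).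
Proof. now destruct c. Qed.

(** Inference never inspects the sorts. So the shape inferred for an expression at the quotient of a
    pattern is the quotient of the shape inferred at the pattern. *)
Lemma infer_smap q e : forall K, infer (map (smap q) K) e = smap q (infer K e).
Proof.
induction e; intros K; simpl; auto.
- change (@Sbool U) with (smap q Sbool) at 1. apply map_nth.
- now rewrite IHe1, IHe2.
- rewrite IHe. now destruct (infer K e).
- rewrite IHe. now destruct (infer K e).
- specialize (IHe2 (elt_shape (infer K e1) :: K)). cbn [map] in IHe2.
  now rewrite IHe1, (elt_smap q (infer K e1)), IHe2.
- rewrite IHe1. now destruct (infer K e1).
- specialize (IHe2 (elt_shape (infer K e1) :: K)). cbn [map] in IHe2.
  now rewrite IHe1, (elt_smap q (infer K e1)), IHe2, elt_smap.
- specialize (IHe2 (elt_shape (infer K e1) :: K)). cbn [map] in IHe2.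
  now rewrite IHe1, (elt_smap q (infer K e1)), IHe2, elt_smap.
Qed.

Lemma fits_univ L c v : sort_atoms L -> over L c -> fits c v -> v ∈ V.
Proof.
intros HL. revert v. induction c; simpl; intros v Ho Hf.
- destruct Hf as [b ->]. now apply univ_vbool.
- apply (univ_trans HV) with k; [exact Hf|]. now apply HL.
- destruct Hf as (a & b & -> & Ha & Hb). apply (univ_vpair HV); intuition.
- destruct Hf as (f & -> & Hf & _). now apply (univ_vfun HV).
- destruct Hf as (s & -> & Hs & _). now apply (univ_vset HV).
Qed.

Section Quotient.
Context (q : U -> U) {L Lq : list U} (HL : sort_atoms L) (HLq : sort_atoms Lq)
  (Hq : forall k, In k L -> In (repl q k) Lq).

Lemma over_smap c : over L c -> over Lq (smap q c).
Proof. induction c; simpl; intuition. Qed.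

Lemma fits_smap c v : over L c -> fits c v -> fits (smap q c) (vmap q v).
Proof.
revert v. induction c; simpl; intros v Ho Hf.
- destruct Hf as [b ->]. rewrite vmap_bool. eauto.
- rewrite (vmap_sort HL q k v Ho Hf). apply ZF_repl. eauto.
- destruct Hf as (a & b & -> & Ha & Hb). rewrite vmap_pair.
  exists (vmap q a), (vmap q b). intuition.
- destruct Hf as (f & -> & HfV & Hf). rewrite vmap_fun. exists (map_graph (vmap q) f).
  assert (K : forall a b, opair a b ∈ f -> fits (smap q c1) (vmap q a) /\ fits (smap q c2) (vmap
    q b)).
  { intros a b Hab. destruct (Hf _ Hab) as (a' & b' & E & Ha & Hb). apply opair_inj in E.
    destruct E; subst. intuition. }
  split; [reflexivity|split].
  + apply (univ_map_graph HV); [exact HfV| |]; intros a b Hab; apply K in Hab;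
      [apply (fits_univ Lq (smap q c1))|apply (fits_univ Lq (smap q c2))]; auto;
      try apply over_smap; tauto.
  + intros p Hp. apply mem_map_graph in Hp. destruct Hp as (a & b & Hab & ->).
    apply K in Hab. exists (vmap q a), (vmap q b). tauto.
- destruct Hf as (s & -> & Hs & Hf). rewrite vmap_set. exists (repl (vmap q) s).
  split; [reflexivity|split].
  + apply (univ_repl HV); [exact Hs|]. intros a Ha.
    apply (fits_univ Lq (smap q c)); auto. now apply over_smap.
  + intros x Hx. apply ZF_repl in Hx. destruct Hx as (a & Ha & ->). auto.
Qed.

Lemma fits_smap_env K g : Forall (over L) K -> Forall2 fits K g ->
  Forall (over Lq) (map (smap q) K) /\ Forall2 fits (map (smap q) K) (lmap q g).
Proof.
intros HK Hf. induction Hf as [|c v K g Hc Hf IH]; simpl; [auto|].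
inversion HK; subst. destruct IH; [assumption|].
split; constructor; auto using over_smap, fits_smap.
Qed.

(* Membership of one instance of the quotient suffices: the value of [e] and its
   quotient have corresponding inferred shapes, on which labellings are injective. *)
Lemma generic_quotient_set lam e G X g v : good_label Base lam Lq -> set_level e = true ->
  ctx_val semB G X -> isB G e ->
  generic (declB G e X) L (v :: g) -> generic X Lq (lmap q g) ->
  in_exp semB (vmap lam (vmap q v)) G e (lmap lam (lmap q g)) ->
  generic (declB G e X) Lq (vmap q v :: lmap q g).
Proof.
intros Hlam Hlev HX Ht Hgv Hgq Hin.
pose proof (cl_value _ _ _ (sem_claims HV G X e HX (proj1 Ht)) Hlev) as C.
destruct (generic_decl _ _ _ _ _ _ Hgv) as (Hg & _).
pose proof (generic_id HV _ _ _ Hg) as HXg. pose proof (generic_id HV _ _ _ Hgq) as HXq.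
pose proof Hg as (_ & (K & HK & Hf) & Hb & _). pose proof Hgq as (_ & _ & Hbq & HXlam).
destruct (fits_smap_env K g HK Hf) as [HKq Hfq].
destruct (is_Type_set Base semB G X e g goodB Ht Hlev HX HXg) as (S0 & _ & K0).
destruct (is_Type_set Base semB G X e _ goodB Ht Hlev HX HXq) as (S1 & _ & K1).
destruct (infer_sound HV HL e G X K g _ HX HXg HK Hf Hb Hlev K0) as [F0 _].
destruct (infer_sound HV HLq e G X _ _ _ HX HXq HKq Hfq Hbq Hlev K1) as [F1 _].
rewrite infer_smap in F1. pose proof (infer_over L e K HK) as Ho.
apply (fits_vset HL) in F0; [|exact Ho]. destruct F0 as (c & Ec & _ & F0). rewrite Ec in F1, Ho.
destruct F1 as (S1' & E & _ & F1). apply vset_inj in E. subst S1'. simpl in Ho.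
apply (set_value (sim_refl _ _ HX) e Lq _ S1 lam _ C Hgq K1 Hlam) in Hin; [|auto].
destruct Hin as (z & Hz & E).
assert (Hv : v ∈ S0).
{ apply (in_exp_vset _ _ _ _ S0 _ detB K0). now apply (generic_at_id HV) in Hgv. }
apply (vmap_inj HLq Base lam (smap q c)) in E; auto using over_smap, fits_smap.
rewrite E. now apply (set_element HV G X e Lq _ S1).
Qed.

(** Membership under the one labelling [lam] spreads to all others by recursion on the class
    expression: for [SetC] the property of being basic is reflected through [lam], for sums the
    components are treated in turn, and for subtypes truth is independent of the labelling. *)
Lemma generic_quotient lam e : good_label Base lam Lq -> forall G X g v,
  ctx_val semB G X -> isB G e ->
  generic (declB G e X) L (v :: g) -> generic X Lq (lmap q g) ->
  in_exp semB (vmap lam (vmap q v)) G e (lmap lam (lmap q g)) ->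
  generic (declB G e X) Lq (vmap q v :: lmap q g).
Proof.
intros Hlam. induction e; intros G X g v HX Ht Hgv Hgq Hin;
  match goal with |- generic (decl_env _ _ ?e _) _ _ =>
    destruct (set_level e) eqn:Hlev; [now apply (generic_quotient_set lam)|] end;
  pose proof (generic_id HV _ _ _ Hgq) as HXq;
  destruct (defined_at _ _ _ _ _ _ detB (proj1 Ht) HX HXq) as [d Hd];
  apply (good_exp V Base) in Hd; try apply sem_good; destruct Hd as (_ & HP & _);
  destruct (class_cases _ _ _ _ HP Hlev) as [E|[E|[(s & t & E)|(s & p & E)]]]; try discriminate E;
  clear E.
- destruct (generic_decl _ _ _ _ _ _ Hgv) as (_ & (c & Hc & Hf) & _).
  pose proof (in_exp_members V Base _ _ SetC _ _ goodB eq_refl (generic_at_id HV _ _ _ _ _ _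
    Hgv)) as [_ [s ->]].
  apply (in_exp_members V Base) in Hin; [|apply sem_good|reflexivity]. destruct Hin as [Hb _].
  pose proof (over_smap c Hc) as Hcq. pose proof (fits_smap c _ Hc Hf) as Hfq.
  apply (generic_cons G SetC X Lq (smap q c)); auto.
  + now apply (basic_of_vmap HLq lam (smap q c)).
  + intros mu Hmu. apply (in_exp_intro HV Base G X); auto.
    * now apply Hgq.
    * split; [|rewrite !vmap_set; eauto].
      apply (vmap_sval HV HLq Base mu (smap q c)); auto.
      now apply (basic_of_vmap HLq lam (smap q c)).
- destruct Ht as [[Hlang _] _]. discriminate Hlang.
- destruct HP as [Hs Ht2]. destruct (generic_Sum_inv HV G X e1 e2 L v g Hgv) as (a & b & -> & Ga
  & Gb).
  rewrite !vmap_pair in Hin. apply (in_exp_members V Base) in Hin; [|apply sem_good|reflexivity].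
  destruct Hin as (a' & b' & E & Ha & Hb). apply vpair_inj in E. destruct E; subst a' b'.
  rewrite vmap_pair. apply (generic_Sum HV); auto.
  apply (IHe2 (Decl G e1) (declB G e1 X) (a :: g) b); auto.
  + now apply (sem_decl HV).
  + now apply IHe1.
- destruct HP as [Hs Hp]. pose proof (generic_Sub_inv G X e1 e2 L v g Hgv) as Ga.
  apply (in_exp_members V Base) in Hin; [|apply sem_good|reflexivity].
  destruct Hin as [Ha Hh]. pose proof (sem_decl HV Base G X e1 HX Hs) as HX1.
  pose proof (sem_claims HV (Decl G e1) _ e2 HX1 (proj1 (proj2 Hp))) as Cp.
  assert (Gq : generic (declB G e1 X) Lq (vmap q v :: lmap q g)) by now apply IHe1.
  apply (generic_Sub HV); auto.
  apply (holds_value HV HX1 (sim_refl _ _ HX1) e2 Lq (vmap q v :: lmap q g) lam Hp Cp Gq Hlam);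
    [|exact Hh].
  now apply Gq.
Qed.

End Quotient.

(* A bijective set may contain several values with the same two projections.
   Identifying the atoms of the pattern of [w] whose labels have the same projections
   gives a pattern whose labels can be replaced by the projections themselves. *)
Lemma common_pattern G X s g w :
  ctx_val semB G X -> isB G s -> X g -> in_exp semE w G (star s) g ->
  (forall i, in_exp semB (vproj i w) G s g) ->
  exists L g0 v (lab : side -> U -> U) lam,
    generic (declB G s X) L (v :: g0) /\
    (forall i, good_label Base (lab i) L /\ vmap (lab i) v = vproj i w /\ lmap (lab i) g0 = g) /\
    good_label Ext lam L /\ lmap lam g0 = g /\
    forall i k x, In k L -> x ∈ k -> vproj i (lam x) = lab i x.
Proof.
intros HX Ts Hg Hw Hi.
pose proof (sem_claims HV G X s HX (proj1 Ts)) as C.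
destruct (base_instance G X g HX Hg) as (L & g0 & lam0 & Hg0 & Hl0 & ->).
destruct (cl_lift G X s C Ts L g0 Ext lam0 G X w Hg0 (good_label_Ext HV lam0 L Hl0)
  (base_ext_sim G X HX) Hg Hw) as (L' & lam' & v & He & Hcov & Hl' & E & Hgv & <-).
pose proof Hg0 as (HL & Hf0 & _). pose proof Hgv as (HL' & _).
destruct (generic_decl _ _ _ _ _ _ Hgv) as (_ & (c & Hc & Hf) & _).
(* The labels that the atoms should carry on side [i]. They can fail to be injective on a new sort,
   hence the quotient. *)
set (P := fun i x => vproj i (lam' x)).
assert (HPv : forall i, vmap (P i) v = vproj i (vmap lam' v))
  by (intros i; symmetry; now apply (vmap_comp HL' lam' (leaf_proj i) c)).
assert (old : forall k x, In k L -> x ∈ k -> basic V (lam0 x)).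
{ intros k x Hk Hx. apply (sval_vset_inv Base (repl lam0 k)); [now apply Hl0|]. apply ZF_repl.
  eauto. }
assert (Pold : forall i k x, In k L -> x ∈ k -> P i x = lam0 x).
{ intros i k x Hk Hx. unfold P. rewrite (E k x Hk Hx). apply (vproj_basic (V := V)). eauto. }
(* For a new sort, [covers] obtains this from the projected value, which is basic as a member of [s]
   on side [i]. *)
assert (setP : forall i k, In k L' -> basic V (vset (repl (P i) k))).
{ intros i k Hk. destruct (Hcov k Hk) as [Hk0|H].
  - replace (repl (P i) k) with (repl lam0 k); [now apply Hl0|]. apply ZF_ext. intros x.
    rewrite !ZF_repl. split; intros (y & Hy & ->); exists y; (split; [exact Hy|]);
      [symmetry|]; now apply (Pold i k).
  - apply H. rewrite HPv. now apply (type_basic G X s (lmap lam0 g0)). }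
assert (basP : forall i k x, In k L' -> x ∈ k -> basic V (P i x)).
{ intros i k x Hk Hx. apply (basic_vset_inv V (repl (P i) k)); [now apply setP|].
  apply ZF_repl. eauto. }
assert (kerP : forall k x y, In k L' -> x ∈ k -> y ∈ k -> P Left x = P Left y <-> P Right x = P
  Right y).
{ intros k x y Hk Hx Hy. pose proof (proj2 (Hl' k Hk)) as Hb.
  apply (bijective_vset (repl lam' k)) in Hb. apply Hb; apply ZF_repl; eauto. }
assert (kerP' : forall i j k x y, In k L' -> x ∈ k -> y ∈ k -> P i x = P i y -> P j x = P j y).
{ intros [] [] k x y Hk Hx Hy; auto; now apply (kerP k). }
set (N := fresh_index L).
(* A fresh atom that records both projections: atoms with the same projections become one, and
   [comp] reads the labels back. Atoms of the old sorts are kept by [q], because their labels are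
   basic, hence fixed by the projections and already injective. *)
set (pt := fun x => vatom (opair N (opair (P Left x) (P Right x)))).
set (q := extend_label L (fun x => x) pt).
set (comp := fun i y => epsilon (inhabits empty) (fun z => exists z1 z2,
  y = vatom (opair N (opair z1 z2)) /\ z = match i with Left => z1 | Right => z2 end)).
assert (Hcomp : forall i x, comp i (pt x) = P i x).
{ intros i x. unfold comp.
  destruct (epsilon_spec (inhabits (@empty U)) (fun z => exists z1 z2,
    pt x = vatom (opair N (opair z1 z2)) /\ z = match i with Left => z1 | Right => z2 end))
    as (z1 & z2 & Ez & K).
  - exists (P i x), (P Left x), (P Right x). split; [reflexivity|now destruct i].
  - rewrite K. unfold pt in Ez. apply vatom_inj, opair_inj in Ez. destruct Ez as [_ Ez].
    apply opair_inj in Ez. destruct Ez; subst. now destruct i. }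
set (lab := fun i => extend_label L lam0 (comp i)).
(* The iso-pair of the two labels on new atoms; old atoms keep the basic labels that produce the
   given environment. *)
set (lam := extend_label L lam0 (fun y => visopair (comp Left y) (comp Right y))).
assert (cases : forall k, In k L' -> In k L \/ ~ In k L /\ forall x, x ∈ k -> q x = pt x).
{ intros k Hk. destruct (classic (In k L)) as [Hk0|Hk0]; [now left|right; split; [exact Hk0|]].
  destruct (proj2 He k Hk) as [Hk1|H]; [contradiction|]. intros x Hx.
  now apply (extend_label_new L _ pt k). }
assert (qold : forall k x, In k L -> x ∈ k -> q x = x) by (intros k x; apply extend_label_old).
assert (newpt : forall mu x, extend_label L lam0 mu (pt x) = mu (pt x)).
{ intros mu x. apply (extend_label_new L lam0 mu (upair (pt x) (pt x))); [|apply ZF_upair; auto].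
  intros k y Hk Hy Hy'. apply ZF_upair in Hy'. unfold pt in Hy'.
  destruct Hy'; subst y; now apply fresh_index_notin in Hy. }
assert (labq : forall i k x, In k L' -> x ∈ k -> lab i (q x) = P i x).
{ intros i k x Hk Hx. destruct (cases k Hk) as [Hk0|[_ Hn]].
  - rewrite (qold k x Hk0 Hx), (Pold i k x Hk0 Hx). now apply (extend_label_old L _ _ k).
  - rewrite (Hn x Hx). unfold lab. now rewrite newpt. }
assert (lamq : forall i k x, In k L' -> x ∈ k -> vproj i (lam (q x)) = P i x).
{ intros i k x Hk Hx. destruct (cases k Hk) as [Hk0|[_ Hn]].
  - rewrite (qold k x Hk0 Hx), (Pold i k x Hk0 Hx). unfold lam.
    rewrite (extend_label_old L _ _ k) by auto. apply (vproj_basic (V := V)). eauto.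
  - rewrite (Hn x Hx). unfold lam. rewrite newpt, !Hcomp, vproj_isopair. now destruct i. }
assert (bijq : forall k x, In k L' -> x ∈ k -> bijective V (lam (q x))).
{ intros k x Hk Hx. destruct (cases k Hk) as [Hk0|[_ Hn]].
  - rewrite (qold k x Hk0 Hx). unfold lam. rewrite (extend_label_old L _ _ k) by auto.
    apply (basic_bijective HV). eauto.
  - rewrite (Hn x Hx). unfold lam. rewrite newpt, !Hcomp. constructor; eauto. }
(* The labelled sort is bijective, so equal projections on one side force equal projections on the
   other. Each of the two labellings is therefore injective on the quotient sorts by itself. *)
assert (kerq : forall i k x y, In k L' -> x ∈ k -> y ∈ k -> P i x = P i y -> q x = q y).
{ intros i k x y Hk Hx Hy Ep. destruct (cases k Hk) as [Hk0|[_ Hn]].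
  - rewrite !(qold k) by auto. apply (proj1 (Hl0 k Hk0)); auto.
    now rewrite <- (Pold i k x), <- (Pold i k y).
  - rewrite (Hn x Hx), (Hn y Hy). unfold pt. do 2 f_equal. f_equal; now apply (kerP' i _ k). }
assert (atq : forall k x, In k L' -> x ∈ k -> exists y, y ∈ V /\ q x = vatom y).
{ intros k x Hk Hx. destruct (cases k Hk) as [Hk0|[_ Hn]].
  - rewrite (qold k x Hk0 Hx). now apply (HL k Hk0).
  - rewrite (Hn x Hx). eexists. split; [|reflexivity].
    repeat apply (univ_opair HV); [now apply fresh_index_univ|apply (basic_univ HV); eauto..]. }
set (Lq := map (repl q) L').
assert (InLq : forall k, In k Lq <-> exists k0, In k0 L' /\ k = repl q k0).
{ intros k. unfold Lq. rewrite in_map_iff.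
  split; intros (k0 & H1 & H2); exists k0; auto. }
assert (replq : forall (h : U -> U) k, repl h (repl q k) = repl (fun x => h (q x)) k).
{ intros h k. apply ZF_ext. intros z. rewrite !ZF_repl. split.
  - intros (y & Hy & ->). apply ZF_repl in Hy. destruct Hy as (x & Hx & ->). eauto.
  - intros (x & Hx & ->). exists (q x). split; [apply ZF_repl; eauto|reflexivity]. }
assert (HLq : sort_atoms Lq).
{ intros k Hk. apply InLq in Hk. destruct Hk as (k0 & Hk0 & ->). split.
  - apply (univ_repl HV); [now apply HL'|]. intros x Hx.
    destruct (atq k0 x Hk0 Hx) as (y & Hy & ->). now apply (univ_vatom HV).
  - intros z Hz. apply ZF_repl in Hz. destruct Hz as (x & Hx & ->). now apply (atq k0). }
assert (goodlab : forall i, good_label Base (lab i) Lq).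
{ intros i k Hk. apply InLq in Hk. destruct Hk as (k0 & Hk0 & ->). split.
  - intros y z Hy Hz. apply ZF_repl in Hy, Hz. destruct Hy as (x & Hx & ->), Hz as (x' & Hx' & ->).
    rewrite !(labq i k0) by auto. now apply (kerq i k0).
  - rewrite replq. replace (repl (fun x => lab i (q x)) k0) with (repl (P i) k0); [now apply setP|].
    apply ZF_ext. intros z. rewrite !ZF_repl. split; intros (x & Hx & ->); exists x;
      (split; [exact Hx|]); [symmetry|]; now apply (labq i k0). }
assert (goodlam : good_label Ext lam Lq).
{ intros k Hk. apply InLq in Hk. destruct Hk as (k0 & Hk0 & ->). split.
  - intros y z Hy Hz. apply ZF_repl in Hy, Hz. destruct Hy as (x & Hx & ->), Hz as (x' & Hx' & ->).
    intros El. apply (kerq Left k0); auto. rewrite <- !(lamq Left k0) by auto. now rewrite El.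
  - rewrite replq. apply (bijective_vset (repl (fun x => lam (q x)) k0)). split; [|split].
    + apply (univ_repl HV); [now apply HL'|]. intros x Hx. apply (bijective_univ HV). eauto.
    + intros z Hz. apply ZF_repl in Hz. destruct Hz as (x & Hx & ->). eauto.
    + intros y z Hy Hz. apply ZF_repl in Hy, Hz. destruct Hy as (x & Hx & ->), Hz as (x' & Hx' &
      ->).
      rewrite !(lamq _ k0) by auto. now apply (kerP k0). }
assert (qg : lmap q g0 = g0).
{ rewrite (lmap_agree (V := V) L q (fun x => x) g0 HL Hf0); [now apply (lmap_id (V := V) L)|].
  exact qold. }
assert (inclq : incl L Lq).
{ intros k Hk. apply InLq. exists k. split; [now apply He|]. apply ZF_ext. intros z.
  rewrite ZF_repl. split.
  - intros Hz. exists z. now rewrite (qold k).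
  - intros (x & Hx & ->). now rewrite (qold k). }
assert (labv : forall i, vmap (lab i) (vmap q v) = vproj i (vmap lam' v)).
{ intros i. rewrite (vmap_comp HL' q (lab i) c), <- HPv by auto.
  apply (vmap_agree HL' _ _ c); auto. intros k x Hk Hx.
  destruct (atq k x Hk Hx) as (y & _ & Ey). rewrite Ey, vmap_atom, <- Ey. now apply (labq i k). }
assert (oldg : forall mu, lmap (extend_label L lam0 mu) g0 = lmap lam0 g0).
{ intros mu. apply (lmap_agree (V := V) L); auto. intros k x. apply extend_label_old. }
exists Lq, g0, (vmap q v), lab, lam. split; [|split; [|split; [|split]]].
(* The left projection of the original value, a member of [s], is the one instance by which
   [generic_quotient] recognizes the quotient as a pattern. *)
- rewrite <- qg. apply (generic_quotient q HL' HLq) with (lam := lab Left); auto.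
  + intros k Hk. apply InLq. eauto.
  + rewrite qg. now apply (generic_incl (V := V) X L).
  + rewrite labv, qg. unfold lab. rewrite oldg. apply Hi.
- intros i. split; [apply goodlab|split; [apply labv|apply oldg]].
- exact goodlam.
- apply oldg.
- intros i k y Hk Hy. apply InLq in Hk. destruct Hk as (k0 & Hk0 & ->).
  apply ZF_repl in Hy. destruct Hy as (x & Hx & ->).
  now rewrite (lamq i k0), (labq i k0).
Qed.

(** * Evaluation of the instantiated expressions *)

Lemma has_type_inst G X s t e u :
  ctx_val semB G X -> hasB G u s ->
  hasB (Decl G s) e (shift t) ->
  hasB G (inst e u) t /\
  forall g a d, X g -> exp_val semB G u g (Val a) ->
    exp_val semB (Decl G s) e (a :: g) d -> exp_val semB G (inst e u) g d.
Proof.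
intros HX Hu He. pose proof (sem_det V Base) as D.
(* [inst_transfer] takes a map on environments, so the value of [u] is selected by choice. *)
set (val := fun g => epsilon (inhabits empty) (fun a => exp_val semB G u g (Val a))).
assert (Hval : forall g, X g -> exp_val semB G u g (Val (val g))).
{ intros g Hg. apply epsilon_spec.
  destruct (has_type_at V _ _ _ _ _ _ g D Hu HX Hg) as (a & Ha & _). eauto. }
pose proof (sem_decl HV Base G X s HX (proj1 (proj2 (proj2 Hu)))) as HX1.
pose proof (inst_transfer HV Base G X s _ u val HX HX1 Hu Hval) as T.
split.
- rewrite <- (inst_shift t u). exact (tr_has_type V T D _ _ He).
- intros g a d Hg Ha Hd. apply (tr_val T e g d Hg); [apply He|].
  pose proof (proj2 D _ _ _ _ _ Ha (Hval g Hg)) as E. injection E as <-. exact Hd.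
Qed.

Lemma in_exp_shift G X s t a b g :
  ctx_val semB G X -> isB G s ->
  defined Base semB G t ->
  declB G s X (a :: g) ->
  in_exp semB b (Decl G s) (shift t) (a :: g) -> in_exp semB b G t g.
Proof.
intros HX Hs Ht Hg Hb. pose proof (sem_det V Base) as D.
pose proof (shift_transfer HV Base G X s _ HX (sem_decl HV Base G X s HX Hs)) as T.
unfold shift in Hb. rewrite rename_subst in Hb.
now apply (tr_in_exp T D D b t (a :: g) Hg Ht).
Qed.

End Contexts.

Theorem mainTheorem1 (U : ZF) (V : U) (HV : grothendieck V)
  (G : ctx) (s t e : expr)
  (HG : wf_ctx V Base G)
  (bG : ctx_bij_free G = true) (bs : bij_free s = true)
  (bt : bij_free t = true) (be : bij_free e = true)
  (He : models_type V Base (Decl G s) e (shift t))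
  (u v : expr) :
  models_iso V G s u v -> models_iso V G t (inst e u) (inst e v).
Proof.
intros (Ts & Hu & Hv & Hiso). destruct HG as [X HX].
pose proof (sem_det V Base) as D.
destruct (has_type_inst HV G X s t e u HX Hu He) as [Tu Vu].
destruct (has_type_inst HV G X s t e v HX Hv He) as [Tv Vv].
pose proof Tu as (_ & _ & Tt & _).
split; [exact Tt|split; [exact Tu|split; [exact Tv|]]].
intros X' HX' g Hg. rewrite (proj1 D G X' X HX' HX) in Hg. clear X' HX'.
destruct (Hiso X HX g Hg) as (w & a & b & Hw & Ha & Pa & Hb & Pb).
pose proof (proj_extended V Left w a Pa) as Ew.
assert (Ea : a = vproj Left w) by (eapply proj_functional; [exact Pa|now apply vproj_proj]).
assert (Eb : b = vproj Right w) by (eapply proj_functional; [exact Pb|now apply vproj_proj]).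
subst a b. clear Pa Pb.
(* From here on [w] enters only through its projections, which are the instances of one pattern [x]
   under [lab Left] and [lab Right]; [lam] joins the two labellings. *)
destruct (common_pattern HV G X s g w HX Ts Hg Hw) as (L & g0 & x & lab & lam & Hgx & Hlab & Hlam & Eg & Hproj).
{ intros [].
  - exact (has_type_val V Base _ G X u s g _ D Hu HX Hg Ha).
  - exact (has_type_val V Base _ G X v s g _ D Hv HX Hg Hb). }
pose proof (sem_decl HV Base G X s HX Ts) as HX1.
pose proof He as (Lev & De & _).
pose proof (sem_claims HV (Decl G s) _ e HX1 De) as Ce.
destruct (claims_val HV _ _ e L (x :: g0) Ce Lev HX1 Hgx) as [y Hy].
assert (Hinst : forall mu, good_label (V := V) Base mu L ->
  exp_val (sem V Base) (Decl G s) e (map (vmap mu) (x :: g0)) (Val (vmap mu y))).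
{ intros mu Hmu. apply (cl_value _ _ _ Ce Lev L (x :: g0) y Hgx Hy Base mu _ _ Hmu (sim_refl _ _ HX1)).
  now apply Hgx. }
pose proof Hgx as (HL & (K & HK & Hf) & Hbas & HXmu).
destruct (infer_sound HV HL e _ _ K _ y HX1 (generic_id HV _ _ _ Hgx) HK Hf Hbas Lev Hy) as [Fy By].
pose proof (infer_over L e K HK) as Oy.
(* Each relabelling of [y] is the value of [e] at a relabelled environment and so belongs to
   [shift t]; as that type does not depend on the declared variable, it belongs to [t] under [G]. *)
assert (Hgy : generic (V := V) (decl_env (sem V Base) G t X) L (y :: g0)).
{ apply (generic_cons G t X L (infer K e)); auto; [now apply generic_decl in Hgx|].
  intros mu Hmu. apply (in_exp_shift HV G X s t (vmap mu x)); auto; [apply Tt|now apply HXmu|].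
  apply (has_type_val V Base _ _ _ e _ _ _ D He HX1); [now apply HXmu|now apply Hinst]. }
pose proof (vmap_sval HV HL Ext lam _ y Hlam Oy Fy By) as Bw.
(* Projecting after [lam] is the relabelling by [lab i] on every sort, so it has the same effect on
   [y]. *)
assert (Pw : forall i, proj V i (vmap lam y) (vmap (lab i) y)).
{ intros i. replace (vmap (lab i) y) with (vproj i (vmap lam y)).
  - now apply vproj_proj, bijective_extended.
  - unfold vproj. rewrite (vmap_comp HL lam _ (infer K e)) by assumption.
    apply (vmap_agree HL _ _ (infer K e)); auto. intros k z Hk Hz. now apply (Hproj i k). }
assert (Ve : forall i, exp_val (sem V Base) (Decl G s) e (vproj i w :: g) (Val (vmap (lab i) y))).
{ intros i. destruct (Hlab i) as (Hli & Ex & Eg'). rewrite <- Ex, <- Eg'. now apply Hinst. }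
(* The witness is the value of [e] at the pattern, labelled by [lam]; its membership in [star t] is
   the membership claim for [t] over the unstarred context. *)
exists (vmap lam y), (vmap (lab Left) y), (vmap (lab Right) y).
split; [|split; [|split; [|split]]].
- rewrite <- Eg. apply (cl_mem _ _ _ (sem_claims HV G X t HX (proj1 Tt)) Tt L g0 y Ext lam G X); auto.
  + now apply base_ext_sim.
  + now rewrite Eg.
- apply (Vu g (vproj Left w)); auto.
- apply Pw.
- apply (Vv g (vproj Right w)); auto.
- apply Pw.
Qed.
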